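(* Let $X$ be an infinite, uniformly discrete approximate subring in a finite-dimensional simple real algebra $A$, and assume that $X$ spans $A$ over $\mathbb{R}$. Then there exist a number field $K$, an Archimedean place $v$ of $K$, a $K_v$-algebra structure on $A$ extending the $\mathbb{R}$-algebra structure, and a $K_v$-basis $(e_1,\dots,e_d)$ of $A$ such that $X$ is commensurable with $$\sum_{i=1}^d \mathcal{O}_{K,v}\cdot e_i .$$ In the specific case where $A=M_n(\mathbb{R})$, we have $K_v=\mathbb{R}$, $\mathcal{O}_{K,v}$ corresponds to the set $P(K)$ of Pisot--Salem numbers of $K$, and $X$ is commensurable with $\sum_{i=1}^d P(K)\cdot e_i$.
   Context: Algebras are associative; a finite-dimensional real algebra carries its usual topology as a finite-dimensional real vector space. A subset $X$ of a ring is an approximate subring if it is additively symmetric ($0\in X$, $X=-X$) and $(X\cdot X)\cup(X+X)$ is covered by finitely many additive translates of $X$. $X\subseteq A$ is uniformly discrete if there is a neighbourhood $W$ of $0$ such that $(x+W)\cap(y+W)=\emptyset$ for all distinct $x,y\in X$. Two subsets are commensurable if each is covered by finitely many additive translates of the other. For a number field $K$ with set of all places $S_K$ and an Archimedean place $v$, $K_v$ is the completion of $K$ at $v$ (equal to $\mathbb{R}$ or $\mathbb{C}$), and $\mathcal{O}_{K,v}=\{\alpha\in K: |\alpha|_w\leq 1 \text{ for all } w\in S_K\setminus\{v\}\}$, regarded as a subset of $K_v$ via a field embedding $\sigma_v\colon K\to\mathbb{C}$ inducing $v$. When $K_v=\mathbb{R}$ (and $K$ is identified with $\sigma_v[K]\subseteq\mathbb{R}$),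 $P(K)$ denotes the set of Pisot--Salem numbers generating $K$, i.e. real algebraic integers $\alpha>1$ with $\mathbb{Q}(\alpha)=K$ all of whose other Galois conjugates have modulus at most $1$, taken together with their negatives and with $0,1,-1$; with this convention $P(K)=\mathcal{O}_{K,v}$. The sum $\sum_i \mathcal{O}_{K,v}\cdot e_i$ is the set of all $\sum_i\alpha_ie_i$ with $\alpha_i\in\mathcal{O}_{K,v}$. *)

(* Defs.v *)
From HB Require Import structures.
From mathcomp Require Import all_boot all_order all_algebra all_field.
From mathcomp Require Import complex.
From mathcomp Require Import all_classical all_reals all_analysis.

Set Implicit Arguments.
Unset Strict Implicit.
Unset Printing Implicit Defensive.

Import Order.TTheory GRing.Theory Num.Theory.
Import numFieldNormedType.Exports.

Local Open Scope classical_set_scope.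
Local Open Scope ring_scope.

Definition covered_by_translates (V : zmodType) (Y X : set V) : Prop :=
  exists F : set V, finite_set F /\
    Y `<=` \bigcup_(f in F) [set f + x | x in X].

Definition commensurable (V : zmodType) (X Y : set V) : Prop :=
  covered_by_translates X Y /\ covered_by_translates Y X.

Definition approximate_subring (A : nzRingType) (X : set A) : Prop :=
  [/\ X 0,
      X = [set - x | x in X] &
      covered_by_translates
        ([set x * y | x in X & y in X] `|` [set x + y | x in X & y in X]) X].

(* The topology of a finite-dimensional real vector space is transported from
   the product topology of row vectors along coordinates in a basis. *)
Definition vnbhs0 (R : realType) (V : vectType R) (W : set V) : Prop :=
  nbhs (0 : 'rV[R]_(\dim {:V})) (passmx.rVof (vbasis {:V}) @` W).

Definition uniformly_discrete (R : realType) (V : vectType R) (X : set V) :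
    Prop :=
  exists2 W : set V, vnbhs0 W &
    forall x y, X x -> X y -> x <> y ->
      [set x + w | w in W] `&` [set y + w | w in W] = set0.

Definition spans (F : fieldType) (V : vectType F) (X : set V) : Prop :=
  forall a : V, exists s : seq V, (forall x, x \in s -> X x) /\ a \in span s.

(* A is unital and nonzero by virtue of being a falgType; its two-sided
   ideals are then automatically subspaces. *)
Definition simple_algebra (F : fieldType) (A : falgType F) : Prop :=
  forall I : {vspace A},
    (forall a x : A, x \in I -> a * x \in I /\ x * a \in I) ->
    I = 0%VS \/ I = fullv.

Record algebra_structure (F : fieldType) (A : nzRingType) := AlgebraStructure {
  scal : F -> A -> A;
  scalA : forall a b v, scal a (scal b v) = scal (a * b) v;
  scal1 : left_id 1 scal;
  scalDr : right_distributive scal +%R;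
  scalDl : forall v, {morph scal^~ v : a b / a + b};
  scalAl : forall a u v, scal a (u * v) = scal a u * v;
  scalAr : forall a u v, scal a (u * v) = u * scal a v
}.

Definition alg_over (F : fieldType) (A : nzRingType)
  (s : algebra_structure F A) : Type := A.

Section AlgOver.
Variables (F : fieldType) (A : nzRingType) (s : algebra_structure F A).
HB.instance Definition _ := GRing.NzRing.copy (alg_over s) A.
HB.instance Definition _ := GRing.Zmodule_isLmodule.Build F (alg_over s)
  (scalA s) (scal1 s) (scalDr s) (scalDl s).
HB.instance Definition _ := GRing.Lmodule_isLalgebra.Build F (alg_over s)
  (scalAl s).
HB.instance Definition _ := GRing.Lalgebra_isAlgebra.Build F (alg_over s)
  (scalAr s).
End AlgOver.

Definition is_basis (F : fieldType) (V : lmodType F) (d : nat)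
    (e : 'I_d -> V) : Prop :=
  forall v : V, exists! c : {ffun 'I_d -> F}, v = \sum_i c i *: e i.

(* Places of K are represented by nontrivial real-valued absolute values, two
   of which define the same place when they are equivalent; whether w x <= 1
   depends only on the place of w. *)
Record absolute_value (R : realType) (K : fieldType) := AbsoluteValue {
  absv :> K -> R;
  absv_ge0 : forall x, 0 <= absv x;
  absv_eq0 : forall x, absv x = 0 <-> x = 0;
  absvM : {morph absv : x y / x * y};
  absvD : forall x y, absv (x + y) <= absv x + absv y;
  absv_nontrivial : exists2 x, x != 0 & absv x != 1
}.

Definition absv_equiv (R : realType) (K : fieldType) (v w : K -> R) : Prop :=
  exists2 s : R, 0 < s & forall x, v x = w x `^ s.

Definition archimedean_place (R : realType) (K : fieldType)
    (v : absolute_value R K) : Prop :=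
  ~ (forall x y, v (x + y) <= Num.max (v x) (v y)).

Definition induces (R : realType) (K : fieldType)
    (sigma : {rmorphism K -> R[i]}) (v : absolute_value R K) : Prop :=
  absv_equiv v (fun x => Normc.normc (sigma x)).

Definition OKv (R : realType) (K : fieldType) (v : absolute_value R K) :
    set K :=
  [set x | forall w : absolute_value R K, ~ absv_equiv w v -> w x <= 1].

Section ClosureRange.
Variables (C : numFieldType) (K : fieldType) (f : {rmorphism K -> C}).
Let S : set C := closure (range f).

Lemma closure_range1 : S 1.
Proof. by apply: subset_closure; exists 1 => //; exact: rmorph1. Qed.

Lemma closure_rangeB x y : S x -> S y -> S (x - y).
Proof.
move=> cx cy B nB.
have [[U V] /= [nU nV] UV] := @sub_continuous C (x, y) B nB.
have [_ [[a _ <-] Ua]] := cx U nU.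
have [_ [[b _ <-] Vb]] := cy V nV.
exists (f (a - b)); split; first by exists (a - b).
by rewrite rmorphB; exact: (UV (f a, f b)).
Qed.

Lemma closure_rangeM x y : S x -> S y -> S (x * y).
Proof.
move=> cx cy B nB.
have [[U V] /= [nU nV] UV] := @mul_continuous C (x, y) B nB.
have [_ [[a _ <-] Ua]] := cx U nU.
have [_ [[b _ <-] Vb]] := cy V nV.
exists (f (a * b)); split; first by exists (a * b).
by rewrite rmorphM; exact: (UV (f a, f b)).
Qed.

Lemma closure_rangeV x : S x -> S x^-1.
Proof.
have [->|x0] := eqVneq x 0.
  by move=> _; rewrite invr0; apply: subset_closure; exists 0 => //; exact: rmorph0.
move=> cx B nB.
have [_ [[a _ <-] Ba]] := cx _ (@inv_continuous C x x0 B nB).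
exists (f a^-1); split; first by exists a^-1.
by rewrite fmorphV.
Qed.

End ClosureRange.

(* The completion of K at the place induced by sigma, realised as the closure
   of sigma(K) in the complex numbers. *)
Definition completion_set (R : realType) (K : fieldType)
    (sigma : {rmorphism K -> R[i]}) : set R[i] :=
  closure (range sigma : set R[i]^o).

Section Completion.
Variables (R : realType) (K : fieldType) (sigma : {rmorphism K -> R[i]}).

Definition completion_pred : {pred R[i]} := mem (completion_set sigma).

Lemma completion_divring_closed : divring_closed completion_pred.
Proof.
split=> [|x y /set_mem cx /set_mem cy|x y /set_mem cx /set_mem cy].
- by apply/mem_set; exact: (@closure_range1 R[i] K sigma).
- by apply/mem_set; exact: (@closure_rangeB R[i] K sigma).
apply/mem_set; apply: (@closure_rangeM R[i] K sigma) => //.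
exact: (@closure_rangeV R[i] K sigma).
Qed.

HB.instance Definition _ :=
  GRing.isDivringClosed.Build R[i] completion_pred completion_divring_closed.

Record completion := Completion {
  completion_val : R[i];
  completion_valP : completion_val \in completion_pred
}.

HB.instance Definition _ := [isSub for completion_val].
HB.instance Definition _ := [Choice of completion by <:].
HB.instance Definition _ := [SubChoice_isSubIntegralDomain of completion by <:].
HB.instance Definition _ := [SubIntegralDomain_isSubField of completion by <:].

Lemma completion_embed_subproof (x : K) : sigma x \in completion_pred.
Proof. by apply/mem_set/subset_closure; exists x. Qed.

Definition to_completion (x : K) : completion :=
  Completion (completion_embed_subproof x).

Lemma completion_real_subproof (r : R) :
  real_complex R r \in completion_pred.
Proof.
apply/mem_set => B [e /= e0 eB].
have {e0 eB} [d d0 dB] : exists2 d : R, 0 < d &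
    forall z : R[i], `|real_complex R r - z| < real_complex R d -> B z.
  case: e e0 eB => a b; rewrite ltcE /= => /andP[/eqP -> a0] aB.
  by exists a.
have /rat_in_itvoo[q] : r < r + d by rewrite ltrDl.
rewrite in_itv /= => /andP[rq qd].
exists (sigma (ratr q)); split; first by exists (ratr q).
apply: dB; rewrite fmorph_rat -(fmorph_rat (real_complex R)) -rmorphB normc_def.
by rewrite /= expr0n /= addr0 sqrtr_sqr ltcR distrC gtr0_norm ?subr_gt0 // ltrBlDl.
Qed.

Definition real_to_completion (r : R) : completion :=
  Completion (completion_real_subproof r).

End Completion.

Definition extends_scalars (R : realType) (A : falgType R) (F : fieldType)
    (iota : R -> F) (s : algebra_structure F A) : Prop :=
  forall (r : R) (a : A), scal s (iota r) a = r *: a.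

Definition combinations (R : realType) (K : fieldType)
    (sigma : {rmorphism K -> R[i]}) (V : lmodType (completion sigma))
    (L : set K) (d : nat) (e : 'I_d -> V) : set V :=
  [set \sum_i to_completion sigma (alpha i) *: e i |
    alpha in [set alpha : 'I_d -> K | forall i, L (alpha i)]].

(* In the partial order on R[i], 1 < z says that z is real and greater than 1.
   The roots of minPoly in R[i] are the Galois conjugates of sigma x, minPoly
   having rational coefficients. *)
Definition pisot_salem (R : realType) (K : fieldExtType rat)
    (sigma : {rmorphism K -> R[i]}) (x : K) : Prop :=
  [/\ integralOver (intr : int -> K) x,
      1 < sigma x,
      <<1%VS; x>>%VS = {:K}%VS &
      forall b : R[i], root (map_poly sigma (minPoly 1%VS x)) b ->
        b != sigma x -> `|b| <= 1].

Definition PK (R : realType) (K : fieldExtType rat)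
    (sigma : {rmorphism K -> R[i]}) : set K :=
  [set x | [\/ x \in [:: 0; 1; -1],
               pisot_salem sigma x | pisot_salem sigma (- x)]].

(* Main.v *)
(* The real functionals on A that are bounded on X have a two-sided ideal as
   common kernel, so there are none besides 0, and X is relatively dense. Hence
   X lies in a finite-dimensional rational subspace of A. If B is a rational
   subspace of minimal dimension some finitely many translates of which cover
   X, then X is commensurable with Z = (X - X) /\ B, and B is a simple rational
   algebra with real span A. Its center K is a number field, embedded into the
   center of A (R or C) by sigma, and a K-basis e of B is a basis of A over the
   completion.

   Let rho be another embedding of K, not conjugate to sigma. On Z, an additive
   function such as rho of the i-th coordinate is at bounded distance from an
   R-linear function on A, since otherwise its graph would be relatively dense.
   If q is the quadratic real polynomial with root sigma theta, then q(theta)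
   kills the linear function, but q(rho theta) is nonzero; so rho of the
   coordinates is bounded on Z. Since Z is contained in a finitely generated
   group, the coordinates also have bounded denominators. On the other hand,
   O_{K,v} consists of the algebraic integers all of whose conjugates away from
   sigma have modulus at most 1: Ostrowski's theorem describes the other
   Archimedean places, and a maximal subring avoiding a nonintegral number
   yields a place where it is large. By pigeonhole a multiple of Z lies in
   finitely many translates of Y = sum O_{K,v} e_i. So Z and Y are both
   relatively dense, and their differences in a ball form a finite set. *)
Require Import Defs.
From HB Require Import structures.
From mathcomp Require Import all_boot all_order all_algebra all_field.
From mathcomp Require Import complex.
From mathcomp Require Import all_classical all_reals all_analysis.
From mathcomp Require Import ring lra zify.

Set Implicit Arguments.
Unset Strict Implicit.
Unset Printing Implicit Defensive.

Import Order.TTheory GRing.Theory Num.Theory.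
Import numFieldNormedType.Exports.

Local Open Scope classical_set_scope.
Local Open Scope ring_scope.

(** * Coverings by translates *)

(** Every property of [X] holds only up to finitely many translates, so no operation of [A]
    preserves [X] itself. Two devices absorb these errors. Minimality of [B] turns coverings into
    inclusions: a rational subspace of [B] that still covers [X] by finitely many translates is all
    of [B]; this is how [B] becomes closed under products. And boundedness of an additive function
    survives both finitely many translates and division by an integer, which replaces closure of [Z]
    under multiplication by [theta]. The core [Z] stands in for [X] because coordinates over [K]
    exist only on [B]. No structure theorem for simple algebras enters. That [K] acts through real
    or complex numbers, and that a [K]-basis stays independent over the completion, follow from
    showing that suitable sets are two-sided ideals. Nor is a ring of integers or a norm
    constructed: integrality is used through the bounded denominators of the powers of an element,
    and through the finiteness of the set of integral elements with bounded conjugates. *)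

Section Covering.
Variable V : zmodType.
Implicit Types X Y Z : set V.

Lemma cov_sub X Y : Y `<=` X -> covered_by_translates Y X.
Proof.
move=> sYX; exists [set 0]; split; first exact: finite_set1.
by move=> y Yy; exists 0 => //; exists y; rewrite ?add0r //; exact: sYX.
Qed.

Lemma cov_trans X Y Z :
  covered_by_translates Z Y -> covered_by_translates Y X ->
  covered_by_translates Z X.
Proof.
move=> [F [finF ZF]] [G [finG YG]].
exists [set f + g | f in F & g in G]; split; first exact: finite_image2.
move=> z /ZF[f Ff [y /YG[g Gg [x Xx <-]] <-]].
by exists (f + g); [exists f => //; exists g | exists x => //; rewrite addrA].
Qed.

Lemma cov_add X1 X2 Y1 Y2 :
  covered_by_translates Y1 X1 -> covered_by_translates Y2 X2 ->
  covered_by_translates [set x + y | x in Y1 & y in Y2]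
    [set x + y | x in X1 & y in X2].
Proof.
move=> [F [finF YF]] [G [finG YG]].
exists [set f + g | f in F & g in G]; split; first exact: finite_image2.
move=> _ [y1 /YF[f Ff [x1 X1x <-]]] [y2 /YG[g Gg [x2 X2x <-]]] <-.
exists (f + g); first by exists f => //; exists g.
by exists (x1 + x2); [exists x1 => //; exists x2 | rewrite addrACA].
Qed.

Lemma cov_image (W : zmodType) (h : V -> W) X Y :
  {morph h : x y / x + y} -> covered_by_translates Y X ->
  covered_by_translates [set h y | y in Y] [set h x | x in X].
Proof.
move=> hD [F [finF YF]]; exists [set h f | f in F]; split.
  exact: finite_image.
move=> _ [y /YF[f Ff [x Xx <-]] <-]; exists (h f); first by exists f.
by exists (h x); [exists x | rewrite hD].
Qed.

Lemma cov_bigcup_finite (T : Type) (D : set T) (Y : T -> set V) X :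
  finite_set D -> (forall i, D i -> covered_by_translates (Y i) X) ->
  covered_by_translates (\bigcup_(i in D) Y i) X.
Proof.
move=> finD covY.
have /choice[F FP] : forall i, exists F : set V,
    D i -> finite_set F /\ Y i `<=` \bigcup_(f in F) [set f + x | x in X].
  move=> i; have [/covY[F FP]|nDi] := pselect (D i); first by exists F.
  by exists set0.
exists (\bigcup_(i in D) F i); split.
  by apply: bigcup_finite => // i /FP[].
move=> y [i Di /(proj2 (FP i Di))[f Ff [x Xx <-]]].
by exists f; [exists i | exists x].
Qed.

(* The finitely many translates that meet Y are replaced by translates by
   elements of Y, which differ from the others by elements of P. *)
Lemma cov_diff (P : set V) Y :
  (forall x y, P x -> P y -> P (x - y)) -> covered_by_translates Y P ->
  covered_by_translates Y [set z | P z /\ exists x y, [/\ Y x, Y y & z = x - y]].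
Proof.
move=> PB [F [finF YF]].
have /choice[r rP] : forall f, exists y, (exists2 y, Y y & P (y - f)) ->
    Y y /\ P (y - f).
  move=> f; have [[y Yy Py]|] := pselect (exists2 y, Y y & P (y - f)).
    by exists y.
  by exists 0.
exists [set r f | f in F]; split; first exact: finite_image.
move=> y Yy; have [f Ff [p Pp fpy]] := YF y Yy.
have [Yr Pr] : Y (r f) /\ P (r f - f).
  by apply: rP; exists y => //; rewrite -fpy addrC addKr.
exists (r f); first by exists f.
exists (y - r f); last by rewrite addrC subrK.
split; last by exists y, (r f).
suff -> : y - r f = p - (r f - f) by exact: PB.
by rewrite -fpy opprB addrA [f + p]addrC.
Qed.

End Covering.

(** A subspace inside [P] of maximal dimension is all of [P], since a further vector of [P] would
    enlarge it. Dimension theory thus becomes available for subspaces given by a condition. *)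
Lemma pred_vspace (F : fieldType) (V : vectType F) (P : set V) :
  P 0 -> (forall a x y, P x -> P y -> P (a *: x + y)) ->
  exists U : {vspace V}, forall x, x \in U <-> P x.
Proof.
move=> P0 PZD.
pose Q n := `[< exists2 U : {vspace V}, \dim U = n & forall x, x \in U -> P x >].
have exQ : exists n, Q n.
  exists 0%N; apply/asboolP; exists 0%VS; first exact: dimv0.
  by move=> x; rewrite memv0 => /eqP ->.
have ubQ n : Q n -> (n <= \dim {:V})%N.
  by move=> /asboolP[U <- _]; exact/dimvS/subvf.
case: (ex_maxnP exQ ubQ) => n /asboolP[U dimU UP] nmax.
exists U => x; split=> [/UP //|Px].
apply: contrapT => /negP xU.
have /nmax : Q (\dim (U + <[x]>)%VS).
  apply/asboolP; exists (U + <[x]>)%VS => // y /memv_addP[u uU [_ /vlineP[k ->] ->]].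
  by rewrite addrC; apply: PZD => //; exact: UP.
rewrite -dimU leqNgt => /negP; apply.
rewrite (ltn_leqif (dimv_leqif_sup _)) ?addvSl //.
by rewrite subv_add subvv /= -memvE.
Qed.

(* Values of the functions are rounded to a grid of mesh eps. *)
Lemma finite_net (R : realType) (T : Type) (S : set T) (I : finType)
    (g : I -> T -> R) (M eps : R) :
  0 < eps -> (forall k s, S s -> `|g k s| <= M) ->
  exists F : set T, [/\ finite_set F, F `<=` S &
    forall s, S s -> exists2 s0, F s0 & forall k, `|g k s - g k s0| <= eps].
Proof.
move=> e0 gM.
have [[s1 Ss1]|S0] := pselect (exists s, S s); last first.
  by exists set0; split=> // s Ss; case: S0; exists s.
pose N := (Num.truncn (2 * `|M| / eps)).+2.
pose cell s : {ffun I -> 'I_N} :=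
  [ffun k => inord (Num.truncn ((g k s + M) / eps))].
have /choice[r rP] : forall c, exists s, (exists2 s, S s & cell s = c) ->
    S s /\ cell s = c.
  move=> c; have [[s Ss <-]|] := pselect (exists2 s, S s & cell s = c).
    by exists s.
  by exists s1.
exists [set r (cell s) | s in S]; split.
- apply: (@sub_finite_set _ _ [set r c | c in [set: {ffun I -> 'I_N}]]).
    by move=> _ [s _ <-]; exists (cell s).
  exact/finite_image/finite_finset.
- by move=> _ [s Ss <-]; apply: (proj1 (rP _ _)); exists s.
move=> s Ss; exists (r (cell s)); first by exists s.
move=> k; have [Sr cr] : S (r (cell s)) /\ cell (r (cell s)) = cell s.
  by apply: rP; exists s.
have bnd t : S t -> 0 <= (g k t + M) / eps /\
    (Num.truncn ((g k t + M) / eps) < N)%N.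
  move=> St; have := gM k t St; rewrite ler_norml => /andP[l u].
  have p0 : 0 <= (g k t + M) / eps by rewrite divr_ge0 ?(ltW e0) //; lra.
  split=> //; rewrite ltnS -(ler_nat R).
  rewrite -truncn_le in p0; apply: (le_trans p0); apply: (@le_trans _ _ (2 * `|M| / eps)).
    rewrite ler_pM2r ?invr_gt0 //; have := ler_norm M; lra.
  exact/ltW/truncnS_gt.
have [p1 b1] := bnd _ Ss; have [p2 b2] := bnd _ Sr.
have := congr1 (fun c : {ffun I -> 'I_N} => nat_of_ord (c k)) cr.
rewrite !ffunE !inordK // => E.
have := truncn_itv p1; have := truncn_itv p2; rewrite E.
move: (Num.truncn _) => m /andP[l2 u2] /andP[l1 u1].
have -> : g k s - g k (r (cell s)) =
   eps * ((g k s + M) / eps - (g k (r (cell s)) + M) / eps).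
  by rewrite -mulrBl mulrC divfK ?gt_eqF //; ring.
rewrite normrM gtr0_norm // -[leRHS]mulr1 ler_pM2l // ler_norml.
rewrite -natr1 in u1 u2.
by apply/andP; split; lra.
Qed.

(** * Euclidean descent and relative density *)

Section Dot.
Variables (R : realType) (m : nat).
Implicit Types v w : 'rV[R]_m.

Definition dotr w v : R := \sum_i w 0 i * v 0 i.

Lemma dotrDr w v v' : dotr w (v + v') = dotr w v + dotr w v'.
Proof.
by rewrite /dotr -big_split /=; apply: eq_bigr => i _; rewrite mxE mulrDr.
Qed.

Lemma dotrZr w a v : dotr w (a *: v) = a * dotr w v.
Proof.
by rewrite /dotr mulr_sumr; apply: eq_bigr => i _; rewrite mxE mulrCA.
Qed.

Lemma dotrC v w : dotr v w = dotr w v.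
Proof. by apply: eq_bigr => i _; rewrite mulrC. Qed.

Lemma dotrDl w w' v : dotr (w + w') v = dotr w v + dotr w' v.
Proof. by rewrite dotrC dotrDr ![dotr v _]dotrC. Qed.

Lemma dotrZl a w v : dotr (a *: w) v = a * dotr w v.
Proof. by rewrite dotrC dotrZr dotrC. Qed.

Lemma dotrNr w v : dotr w (- v) = - dotr w v.
Proof. by rewrite -scaleN1r dotrZr mulN1r. Qed.

Lemma coord_norm v i : `|v 0 i| <= `|v|.
Proof.
rewrite {2}/Num.norm /= mx_normrE.
exact: (le_bigmax_cond _ (fun ij : 'I_1 * 'I_m => `|v ij.1 ij.2|) (j := (0, i))).
Qed.

Lemma norm_coord_le v (c : R) : 0 <= c -> (forall i, `|v 0 i| <= c) -> `|v| <= c.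
Proof.
move=> c0 vc; rewrite {1}/Num.norm /= mx_normrE.
by apply/bigmax_leP; split=> // -[i j] _ /=; rewrite ord1.
Qed.

Lemma dotr_norm w v : `|dotr w v| <= m%:R * `|w| * `|v|.
Proof.
rewrite (le_trans (ler_norm_sum _ _ _)) //.
rewrite (le_trans (ler_sum _ (G := fun=> `|w| * `|v|) _)) //.
  by move=> i _; rewrite normrM ler_pM ?coord_norm.
by rewrite sumr_const card_ord -[leLHS]mulr_natl mulrA.
Qed.

Lemma dotr_ge0 v : 0 <= dotr v v.
Proof. by apply: sumr_ge0 => i _; exact: sqr_ge0. Qed.

Lemma dotr_continuous v : continuous (fun w => dotr w v).
Proof.
apply: continuous_big => [|i _ w]; first exact: add_continuous.
apply: (@cvgM _ _ (nbhs w)); [exact: coord_continuous | exact: cvg_cst].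
Qed.

End Dot.

(* A step s of bounded length with (v - s0, s) large compared with |v - s0|
   brings s0 closer to v in the Euclidean norm; steps that work for all
   directions exist by compactness of the unit sphere. *)
Lemma relatively_dense_of_unbounded (R : realType) (m : nat) (S : set 'rV[R]_m)
    (C : R) :
  S 0 -> (forall s, S s -> S (- s)) ->
  (forall s t, S s -> S t -> exists2 u, S u & `|s + t - u| <= C) ->
  (forall w, w != 0 -> forall M, exists2 s, S s & M < `|dotr w s|) ->
  exists K, forall v, exists2 s, S s & `|v - s| <= K.
Proof.
move=> S0 SN SD Sunb.
have C0 : 0 <= C by have [u _] := SD 0 0 S0 S0; exact: le_trans.
(* With [e = v - s], a step [x] gains [2 * dotr e x], and rounding back into [S] costs at most
   [2 * m * C * |e|]. The extra 1 leaves a gain of [2 * |e|] against the constant [M'] below. *)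
pose L := m%:R * C + 1.
have [r [r0 rP]] : exists r : R, 0 <= r /\
    (forall w : 'rV[R]_m, `|w| = 1 ->
      exists s, [/\ S s, `|s| <= r & L <= dotr w s]).
  have cptK : compact [set w : 'rV[R]_m | `|w| = 1].
    apply: bounded_closed_compact.
      by exists 1; split; rewrite ?num_real // => x x1 w /= ->; exact: ltW.
    apply: (@closed_comp _ _ (fun w : 'rV[R]_m => `|w|) [set 1]).
      by move=> x _; exact: norm_continuous.
    exact: closed_eq.
  have := @near_covering_withinP _ [set w : 'rV[R]_m | `|w| = 1].
  rewrite -compact_near_coveringP => -[_ /(_ cptK)].
  move=> /(_ R (pinfty_nbhs R)
    (fun r w => exists s, [/\ S s, `|s| <= r & L <= dotr w s]) _)[].
    move=> w /= w1; have w0 : w != 0 by rewrite -normr_gt0 w1.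
    have [s Ss Ls] : exists2 s, S s & L < dotr w s.
      have [s Ss] := Sunb w w0 L; case: ger0P => _ Ls.
        by exists s.
      by exists (- s); [exact: SN | rewrite dotrNr].
    exists ([set w' | L < dotr w' s], [set r | `|s| <= r]) => /=; last first.
      by move=> [w' r] /= [Lw sr] _; exists s; split=> //; exact: ltW.
    split; last exact: nbhs_pinfty_ge.
    apply: (@dotr_continuous R m s w [set y | L < y]); exact: lt_nbhsr.
  move=> M [_ MP]; exists (Num.max 0 (M + 1)); split.
    by rewrite le_max lexx.
  by move=> w w1; apply: MP; rewrite ?lt_max ?ltrDl ?ltr01 ?orbT.
pose M' := m%:R * (C + r) * (C + r).
have M'0 : 0 <= M' by rewrite !mulr_ge0 ?addr_ge0.
pose K := M' + 1.
exists K => v.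
have step s : S s -> K < `|v - s| ->
    exists2 t, S t & dotr (v - t) (v - t) <= dotr (v - s) (v - s) - 1.
  move=> Ss Kvs; set e := v - s.
  have e0 : 0 < `|e| by apply: le_lt_trans Kvs; rewrite addr_ge0.
  have [|x [Sx xr]] := rP (`|e|^-1 *: e).
    by rewrite normrZ normfV normr_id mulVf ?gt_eqF.
  rewrite dotrZl ler_pdivlMl // => Lx.
  have [t St] := SD s x Ss Sx; set f := s + x - t => fC.
  exists t => //; have -> : v - t = e - x + f.
    by rewrite /f /e; apply/rowP => i; rewrite !mxE; ring.
  have -> : dotr (e - x + f) (e - x + f) =
      dotr e e - 2 * dotr e x + 2 * dotr e f + dotr (f - x) (f - x).
    rewrite {Kvs e0 Lx fC}; clearbody e f.
    have dN u : dotr (- x) u = - dotr x u by rewrite dotrC dotrNr dotrC.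
    rewrite !(dotrDr, dotrDl) !dN !dotrNr (dotrC x e) (dotrC f e) (dotrC x f).
    by ring.
  have ef : dotr e f <= m%:R * `|e| * C.
    rewrite (le_trans (ler_norm _)) // (le_trans (dotr_norm _ _)) //.
    by rewrite ler_wpM2l ?mulr_ge0.
  have fx : dotr (f - x) (f - x) <= M'.
    rewrite (le_trans (ler_norm _)) // (le_trans (dotr_norm _ _)) //.
    have : `|f - x| <= C + r.
      by rewrite (le_trans (ler_normB _ _)) // lerD.
    by move=> fxC; rewrite ler_pM ?mulr_ge0 ?ler_wpM2l.
  have Lx' : `|e| * (m%:R * C) + `|e| <= dotr e x.
    by rewrite (le_trans _ Lx) // /L mulrDr mulr1.
  rewrite /K -/e in Kvs.
  rewrite [_ * C](_ : _ = `|e| * (m%:R * C)) in ef; last by ring.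
  by lra.
(* Induction on an integer bound for the squared distance, which drops by at least 1 at each
   step. *)
suff H n s : S s -> dotr (v - s) (v - s) <= n%:R ->
    exists2 t, S t & `|v - t| <= K.
  by apply: (H _ 0 S0 (ltW (truncnS_gt _))).
elim: n s => [|n IHn] s Ss q.
  have [|/(step s Ss)[t _]] := lerP (`|v - s|) K; first by exists s.
  by have := dotr_ge0 (v - t); lra.
have [|/(step s Ss)[t St qt]] := lerP (`|v - s|) K; first by exists s.
by apply: (IHn t St); move: q; rewrite -natr1; lra.
Qed.

(** * Relatively dense sets *)

Section VNorm.
Variables (R : realType) (V : vectType R).
Implicit Types x y a b : V.

Definition vcoord a : 'rV[R]_(\dim {:V}) := passmx.rVof (vbasis {:V}) a.
Definition vnorm a : R := `|vcoord a|.

Lemma vcoord_is_linear : linear vcoord.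
Proof. exact: passmx.rVof_linear. Qed.
HB.instance Definition _ := GRing.isSemilinear.Build R V _ _ vcoord
  (GRing.semilinear_linear vcoord_is_linear).

Lemma vcoord_bij : bijective vcoord.
Proof.
exists (passmx.vecof (vbasis {:V})).
- exact: (passmx.rVofK (vbasisP _)).
- exact: (passmx.vecofK (vbasisP _)).
Qed.

Lemma vcoord_sum a : a = \sum_i vcoord a 0 i *: (vbasis {:V})`_i.
Proof. by rewrite -[LHS](passmx.rVofK (vbasisP _)). Qed.

Lemma vnorm_ge0 a : 0 <= vnorm a. Proof. exact: normr_ge0. Qed.

Lemma vnormN a : vnorm (- a) = vnorm a.
Proof. by rewrite /vnorm linearN normrN. Qed.

Lemma vnormD a b : vnorm (a + b) <= vnorm a + vnorm b.
Proof. by rewrite /vnorm linearD ler_normD. Qed.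

Lemma vnormB a b : vnorm (a - b) <= vnorm a + vnorm b.
Proof. by rewrite -(vnormN b) vnormD. Qed.

Lemma vnormZ (t : R) a : vnorm (t *: a) = `|t| * vnorm a.
Proof. by rewrite /vnorm linearZ normrZ. Qed.

Definition locally_finite (X : set V) :=
  forall r, finite_set (X `&` [set x | vnorm x <= r]).

Definition relatively_dense (X : set V) :=
  exists K, forall v, exists2 x, X x & vnorm (v - x) <= K.

Lemma finite_bounded (F : set V) : finite_set F ->
  exists2 M, 0 <= M & forall x, F x -> vnorm x <= M.
Proof.
move=> /finite_seqP[s ->]; exists (\sum_(x <- s) vnorm x).
  by apply: sumr_ge0 => x _; exact: vnorm_ge0.
move=> x /= xs; rewrite (big_rem x) //= lerDl.
by apply: sumr_ge0 => y _; exact: vnorm_ge0.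
Qed.

Lemma locally_finite_cov (X Y : set V) :
  covered_by_translates Y X -> locally_finite X -> locally_finite Y.
Proof.
move=> [F [finF YF]] lfX r; have [M M0 FM] := finite_bounded finF.
apply: (@sub_finite_set _ _
  [set f + x | f in F & x in X `&` [set x | vnorm x <= r + M]]).
  move=> y [/YF[f Ff [x Xx <-]] /= yr]; exists f => //; exists x => //.
  split=> //=; rewrite -[x](addKr f) [_ + (f + x)]addrC.
  by rewrite (le_trans (vnormB _ _)) // lerD // FM.
exact: finite_image2.
Qed.

Lemma relatively_dense_cov (X Y : set V) :
  covered_by_translates Y X -> relatively_dense Y -> relatively_dense X.
Proof.
move=> [F [finF YF]] [K YK]; have [M M0 FM] := finite_bounded finF.
exists (K + M) => v; have [y /YF[f Ff [x Xx <-]] yK] := YK v.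
exists x => //; have -> : v - x = v - (f + x) + f.
  by rewrite opprD addrA addrAC subrK.
by rewrite (le_trans (vnormD _ _)) // lerD // FM.
Qed.

(** The passage from geometry to coverings: each point of [Y] has a point of [X] within a fixed
    distance, and the finitely many differences of that size serve as translations. *)
Lemma cov_of_relatively_dense (X Y : set V) : relatively_dense X ->
  (forall r, finite_set [set z | exists x y,
     [/\ X x, Y y, z = y - x & vnorm z <= r]]) ->
  covered_by_translates Y X.
Proof.
move=> [K XK] fin; eexists; split; first exact: (fin K).
move=> y Yy; have [x Xx yxK] := XK y.
by exists (y - x); [exists x, y | exists x; rewrite ?subrK].
Qed.

(** Two points of a ball in the same cell of mesh [e / 2] differ by an element of [W]. As 0 lies in
    [W], the point [x] then belongs to both [x + W] and [x0 + W]. *)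
Lemma uniformly_discrete_locally_finite (X : set V) :
  uniformly_discrete X -> locally_finite X.
Proof.
move=> [W /nbhs_ballP[e /= e0 We] XW] r.
pose S := X `&` [set x | vnorm x <= r].
have := @finite_net R V S 'I_(\dim {:V}) (fun i x => vcoord x 0 i) r (e / 2).
case=> [|i x [_ xr]|F [finF FS SF]].
- by rewrite divr_gt0.
- exact: le_trans (coord_norm _ _) xr.
apply: sub_finite_set finF => x Sx; have [x0 Fx0 xx0] := SF x Sx.
suff -> : x = x0 by [].
apply: contrapT => neq.
have [Sx0 _] := FS _ Fx0; have [Xx _] := Sx.
have : ([set x + w | w in W] `&` [set x0 + w | w in W]) x.
  have W0 : W 0.
    have [w Ww w0] := We 0 (ballxx _ e0).
    by suff -> : 0 = w by []; apply: (bij_inj vcoord_bij); rewrite linear0 -w0.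
  have [w Ww] : (passmx.rVof (vbasis {:V}) @` W) (vcoord (x - x0)).
    apply: We; rewrite -ball_normE /ball_ /= sub0r normrN.
    apply: (@le_lt_trans _ _ (e / 2)); last by lra.
    apply: norm_coord_le => [|i]; first by rewrite ltW // divr_gt0.
    by have := xx0 i; rewrite linearB !mxE.
  move=> /(can_inj (passmx.rVofK (vbasisP _))) ww.
  by split; [exists 0; rewrite ?addr0 | exists w => //; rewrite ww addrC subrK].
by rewrite XW.
Qed.

End VNorm.

Definition rlinear (R : realType) (V W : lmodType R) (f : V -> W) :=
  forall a x y, f (a *: x + y) = a *: f x + f y.

Lemma rlinear0 (R : realType) (V W : lmodType R) (f : V -> W) :
  rlinear f -> f 0 = 0.
Proof. by move=> /(_ (-1) 0 0); rewrite scaler0 addr0 scaleN1r addNr. Qed.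

Lemma rlinear_sum (R : realType) (V W : lmodType R) (f : V -> W) (I : finType)
    (c : I -> R) (v : I -> V) :
  rlinear f -> f (\sum_i c i *: v i) = \sum_i c i *: f (v i).
Proof.
move=> fl; elim/big_ind2: _ => [|_ x _ y <- <-|i _].
- exact: rlinear0.
- by have := fl 1 x y; rewrite !scale1r.
by rewrite -[c i *: v i]addr0 fl rlinear0 // addr0.
Qed.

Lemma rlinear_bounded (R : realType) (V : vectType R) (W : normedModType R)
    (f : V -> W) :
  rlinear f -> exists2 C, 0 <= C & forall x, `|f x| <= C * vnorm x.
Proof.
move=> fl; pose b := vbasis {:V}.
exists (\sum_(i < \dim {:V}) `|f b`_i|); first by apply: sumr_ge0.
move=> x; rewrite [x in `|f x|]vcoord_sum rlinear_sum // mulr_suml.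
rewrite (le_trans (ler_norm_sum _ _ _)) //; apply: ler_sum => i _.
by rewrite normrZ mulrC ler_wpM2l // coord_norm.
Qed.

Definition symmetric_set (V : zmodType) (X : set V) :=
  X 0 /\ forall x, X x -> X (- x).

Definition bdd_on (R : realType) (T : Type) (f : T -> R) (X : set T) :=
  exists M, forall x, X x -> `|f x| <= M.

Definition subgroup_set (V : zmodType) (G : set V) :=
  G 0 /\ forall x y, G x -> G y -> G (x - y).

(** The translations that occur are differences of elements of [H], so additivity on [H] applies to
    them. The restriction to [H] matters because coordinate functions are additive only on a
    rational subspace. *)
Lemma bdd_on_cov (R : realType) (V : zmodType) (H X Y : set V)
    (f : V -> R) : subgroup_set H -> X `<=` H -> Y `<=` H ->
  (forall x y, H x -> H y -> f (x + y) = f x + f y) ->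
  covered_by_translates Y X -> bdd_on f X -> bdd_on f Y.
Proof.
move=> [H0 HB] XH YH fD [F [/finite_seqP[s ->] YF]] [M fM].
exists (\sum_(u <- s) `|f u| + M) => y Yy.
have [u us [x Xx uxy]] := YF _ Yy; move: (us); rewrite /= => us'.
have Hu : H u.
  have := HB y x (YH _ Yy) (XH _ Xx).
  by rewrite -uxy addrK.
rewrite -uxy fD ?(le_trans (ler_normD _ _)) // ?lerD ?fM //; last exact: XH.
by rewrite (big_rem u) //= lerDl sumr_ge0.
Qed.

Lemma subgroup_setD (V : zmodType) (G : set V) : subgroup_set G ->
  forall x y, G x -> G y -> G (x + y).
Proof.
move=> [G0 GB] x y Gx Gy; rewrite -[y]opprK; apply: (GB _ _ Gx).
by rewrite -[- y]sub0r; exact: GB.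
Qed.

Lemma subgroup_setN (V : zmodType) (G : set V) : subgroup_set G ->
  forall x, G x -> G (- x).
Proof. by move=> [G0 GB] x Gx; rewrite -[- x]sub0r; exact: GB. Qed.

Lemma subgroup_setT (V : zmodType) : subgroup_set [set: V].
Proof. by []. Qed.

Lemma span_closed (F : fieldType) (V : vectType F) (P : set V) (s : seq V) :
  P 0 -> (forall a x y, P x -> P y -> P (a *: x + y)) ->
  (forall x, x \in s -> P x) -> forall x, x \in span s -> P x.
Proof.
move=> P0 PZD sP x; have [U UP] := pred_vspace P0 PZD.
by move=> xs; apply/UP; move: x xs; apply/subvP/span_subvP => x /sP /UP.
Qed.

Lemma exists_orthogonal (R : realType) n (U : {vspace 'rV[R]_n}) :
  U != fullv -> exists2 u, u != 0 & forall w, w \in U -> dotr w u = 0.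
Proof.
move=> UT; have dT : \dim {:'rV[R]_n} = n by rewrite dimvf /dim /= mul1n.
have : (\dim U < \dim {:'rV[R]_n})%N.
  by rewrite (ltn_leqif (dimv_leqif_eq (subvf U))).
rewrite dT => dU.
pose M : 'M[R]_(\dim U, n) := \matrix_i (vbasis U)`_i.
have : kermx M^T != 0.
  rewrite -mxrank_eq0 mxrank_ker mxrank_tr subn_eq0 -ltnNge.
  exact: leq_ltn_trans (rank_leq_row _) dU.
case/rowV0Pn => u /sub_kermxP uM u0; exists u => // w.
rewrite -(span_basis (vbasisP U)).
apply: (@span_closed _ _ (fun w => dotr w u = 0)) => [|a x y x0 y0|x].
- by rewrite /dotr big1 // => i _; rewrite mxE mul0r.
- by rewrite dotrDl dotrZl x0 y0 mulr0 addr0.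
move=> /tnthP[i ->].
have := congr1 (fun N : 'rV_(\dim U) => N 0 i) uM.
rewrite !mxE => E; rewrite -[RHS]E; apply: eq_bigr => j _.
by rewrite !mxE mulrC (tnth_nth 0).
Qed.

Section RelativelyDense.
Variables (R : realType) (V : vectType R).

Lemma relatively_dense_of_unbounded_functionals (S : set V) :
  symmetric_set S ->
  covered_by_translates [set x + y | x in S & y in S] S ->
  (forall f : V -> R^o, rlinear f -> bdd_on (f : V -> R) S ->
    forall x, f x = 0) ->
  relatively_dense S.
Proof.
move=> [S0 SN] [F [finF SF]] unb; have [M M0 FM] := finite_bounded finF.
have [|_ [s Ss <-]|_ _ [s Ss <-] [t St <-]|w w0 B|K KP] :=
    @relatively_dense_of_unbounded R _ [set vcoord s | s in S] M.
- by exists 0; rewrite ?linear0.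
- by exists (- s); [exact: SN | rewrite linearN].
- have /SF[f Ff [u Su fust]] : [set x + y | x in S & y in S] (s + t).
    by exists s => //; exists t.
  exists (vcoord u); first by exists u.
  by rewrite -linearD -linearB -fust addrK; exact: FM.
- apply: contrapT => bdd; case/eqP: w0.
  have fl : rlinear (fun v => dotr w (vcoord v) : R^o).
    by move=> a x y; rewrite linearP dotrDr dotrZr.
  have [[g gK Kg]] := (vcoord_bij V, fl).
  have {}bdd : bdd_on (fun v => dotr w (vcoord v)) S.
    exists B => s Ss; rewrite leNgt; apply/negP => Bs; apply: bdd.
    by exists (vcoord s) => //; exists s.
  move=> _; have := unb _ fl bdd (g w).
  rewrite Kg => ww; apply/rowP => i; rewrite mxE.
  apply/eqP; rewrite -sqrf_eq0; apply/eqP.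
  by move/psumr_eq0P: ww => ww; rewrite expr2 ww // => j _; exact: sqr_ge0.
exists K => v; have [_ [s Ss <-] vs] := KP (vcoord v).
by exists s => //; rewrite /vnorm linearB.
Qed.

(* Greedy walk from z to 0 with steps of bounded length. *)
Lemma finitely_generated (Z : set V) :
  Z 0 -> relatively_dense Z ->
  locally_finite [set x - y | x in Z & y in Z] ->
  exists D, [/\ finite_set D, D `<=` [set x - y | x in Z & y in Z] &
    forall G, subgroup_set G -> D `<=` G -> Z `<=` G].
Proof.
move=> Z0 [K ZK] lf.
have K0 : 0 <= K by have [x _] := ZK 0; exact/le_trans/vnorm_ge0.
pose r := 2 * K + 1.
exists ([set x - y | x in Z & y in Z] `&` [set x | vnorm x <= r]).
split=> [||G subG DG]; [exact: lf | by move=> x [] |].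
have step z : Z z -> exists y, [/\ Z y, G (z - y) &
    (vnorm z <= r -> y = 0) /\ (r < vnorm z -> vnorm y <= vnorm z - 1)].
  move=> Zz; have [zr|zr] := lerP (vnorm z) r.
    exists 0; split=> //; apply: DG; split; last by rewrite subr0.
    by exists z => //; exists 0.
  have z0 : 0 < vnorm z by apply: le_lt_trans zr; rewrite /r; lra.
  (* The point [(1 - t) *: z] is closer to 0 than [z] by [K + 1]. A point of [Z] within [K] of it is
     within [r] of [z], and its norm is smaller than that of [z] by at least 1. *)
  pose t := (K + 1) / vnorm z.
  have [y Zy yK] := ZK ((1 - t) *: z).
  have t0 : 0 <= t by rewrite divr_ge0 // ltW // ltr_wpDl.
  have t1 : t <= 1 by rewrite ler_pdivrMr // mul1r; move: zr; rewrite /r; lra.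
  have tz : t * vnorm z = K + 1 by rewrite divfK // gt_eqF.
  exists y; split=> //.
    apply: DG; split; first by exists z => //; exists y.
    have -> /= : z - y = ((1 - t) *: z - y) + t *: z.
      by rewrite scalerBl scale1r addrAC subrK.
    rewrite (le_trans (vnormD _ _)) // vnormZ ger0_norm // tz.
    by rewrite /r; move: yK; lra.
  split=> [//|_].
  have -> : y = (1 - t) *: z - ((1 - t) *: z - y) by rewrite subKr.
  rewrite (le_trans (vnormB _ _)) // vnormZ ger0_norm ?subr_ge0 //.
  by rewrite mulrBl mul1r tz; move: yK; lra.
suff H n z : Z z -> vnorm z <= n%:R -> G z.
  by move=> z Zz; apply: (H _ z Zz (ltW (truncnS_gt _))).
elim: n z => [|n IHn] z Zz zn; have [y [Zy Gzy [y0 y1]]] := step z Zz.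
  have : vnorm z <= r by apply: le_trans zn _; rewrite /r; lra.
  by move=> /y0 y00; move: Gzy; rewrite y00 subr0.
have [/y0 y00|/y1 yn] := lerP (vnorm z) r.
  by move: Gzy; rewrite y00 subr0.
rewrite -(subrK y z); apply: (subgroup_setD subG) => //; apply: IHn => //.
by move: zn; rewrite -natr1; lra.
Qed.

End RelativelyDense.

(** * Relative density of the approximate subring *)

Section IdealArgument.
Variables (R : realType) (A : falgType R).
Hypothesis simpleA : simple_algebra A.

Lemma simple_ideal (P : set A) :
  P 0 -> (forall x y, P x -> P y -> P (x + y)) ->
  (forall a x, P x -> P (a * x) /\ P (x * a)) ->
  (forall x, P x -> x = 0) \/ (forall x, P x).
Proof.
move=> P0 PD PM; have [|U UP] := @pred_vspace _ _ P P0.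
  by move=> a x y Px Py; apply: PD => //; rewrite -mulr_algl; case: (PM a%:A x).
have [|U0|UT] := simpleA (I := U).
- by move=> a x /UP Px; split; apply/UP; case: (PM a x).
- by left=> x /UP; rewrite U0 memv0 => /eqP.
- by right=> x; apply/UP; rewrite UT memvf.
Qed.

Variable X : set A.
Hypothesis spanX : spans X.

Lemma spans_closed (P : set A) :
  P 0 -> (forall a x y, P x -> P y -> P (a *: x + y)) -> X `<=` P ->
  forall a, P a.
Proof.
move=> P0 PZD XP a; have [s [sX]] := spanX a.
by apply: span_closed => // x /sX /XP.
Qed.

Hypotheses (X_inf : infinite_set X) (lfX : locally_finite X).
Hypothesis apX : approximate_subring X.

Lemma approximate_subring_sym : symmetric_set X.
Proof.
have [X0 XN _] := apX; split=> // x Xx; rewrite XN.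
by exists x.
Qed.

Lemma approximate_subringD :
  covered_by_translates [set x + y | x in X & y in X] X.
Proof.
have [_ _ covX] := apX; apply: cov_trans covX; apply: cov_sub => x ?.
by right.
Qed.

Lemma approximate_subringM :
  covered_by_translates [set x * y | x in X & y in X] X.
Proof.
have [_ _ covX] := apX; apply: cov_trans covX; apply: cov_sub => x ?.
by left.
Qed.

(* The common zeros of the functionals that are bounded on X form an ideal. *)
Lemma approximate_subring_relatively_dense : relatively_dense X.
Proof.
apply: relatively_dense_of_unbounded_functionals.
- exact: approximate_subring_sym.
- exact: approximate_subringD.
move=> f fl fb.
pose bd (g : A -> R^o) := rlinear g /\ bdd_on (g : A -> R) X.
(* Multiplication by an element of [X] preserves bounded functionals because [X * X] is covered by
   translates of [X]. As [X] spans [A], their common kernel [I] is a two-sided ideal. *)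
have bdM (x : A) (g : A -> R^o) : X x -> bd g ->
    bd (fun y => g (x * y)) /\ bd (fun y => g (y * x)).
  move=> Xx [gl gb]; have {}gb := bdd_on_cov (@subgroup_setT A) _ _ _
    approximate_subringM gb.
  have [|||M gM] := gb.
  - by [].
  - by [].
  - by move=> a b _ _; have := gl 1 a b; rewrite !scale1r.
  split; split.
  - by move=> a y z; rewrite mulrDr -scalerAr gl.
  - by exists M => y Xy; apply: gM; exists x => //; exists y.
  - by move=> a y z; rewrite mulrDl -scalerAl gl.
  - by exists M => y Xy; apply: gM; exists y => //; exists x.
pose I := [set a | forall g, bd g -> g a = 0].
have [|a b Ia Ib g gb|a x Ix|I0|IT] := @simple_ideal I.
- by move=> g [gl _]; exact: rlinear0.
- by have := gb.1 1 a b; rewrite !scale1r Ia // Ib // addr0.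
- move: a; apply: spans_closed.
  + by split; rewrite ?mul0r ?mulr0 => g [gl _]; exact: rlinear0.
  + move=> a b c [H1 H2] [H3 H4]; split=> g gb.
      by rewrite mulrDl -scalerAl gb.1 H1 // H3 // scaler0 addr0.
    by rewrite mulrDr -scalerAr gb.1 H2 // H4 // scaler0 addr0.
  + move=> y Xy; split=> g gb; have [b1 b2] := bdM y g Xy gb.
      exact: (Ix _ b1).
    exact: (Ix _ b2).
(* If [I] is zero, no nonzero vector is orthogonal to all bounded functionals, so every functional
   is bounded. Then all coordinates are bounded on [X], and local finiteness makes [X] finite. *)
- pose B := [set w : 'rV[R]_(\dim {:A}) | bd (fun v => dotr w (vcoord v))].
  have dl w : rlinear (fun v : A => dotr w (vcoord v) : R^o).
    by move=> a x y; rewrite linearP dotrDr dotrZr.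
  have [||U UB] := @pred_vspace _ _ B.
  + split=> //; exists 0 => x _; rewrite /dotr big1 ?normr0 // => i _.
    by rewrite mxE mul0r.
  + move=> a x y [_ [M xM]] [_ [N yN]]; split=> //.
    exists (`|a| * M + N) => z Xz; rewrite dotrDl dotrZl.
    rewrite (le_trans (ler_normD _ _)) // normrM lerD ?yN // ler_wpM2l //.
    exact: xM.
  have [UT|/exists_orthogonal[u u0 uU]] := eqVneq U fullv; last first.
    case/eqP: u0; have [g gK Kg] := vcoord_bij A.
    rewrite -[u]Kg (I0 (g u)) ?linear0 // => h [hl hb].
    pose wh : 'rV[R]_(\dim {:A}) := \row_i h (vbasis {:A})`_i.
    have hE v : h v = dotr wh (vcoord v).
      rewrite [in LHS](vcoord_sum v) (rlinear_sum _ _ hl); apply: eq_bigr => i _.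
      by rewrite [RHS]mulrC [wh _ _]mxE.
    rewrite hE Kg; apply/uU/UB; split=> //.
    by have [M hM] := hb; exists M => x Xx; rewrite -hE hM.
  exfalso; apply: X_inf.
  have coordb i : exists M, 0 <= M /\ forall x, X x -> `|vcoord x 0 i| <= M.
    have /UB[_ [M MP]] : delta_mx 0 i \in U by rewrite UT memvf.
    exists (Num.max 0 M); split; first by rewrite le_max lexx.
    move=> x Xx; rewrite le_max.
    rewrite -[X in _ || (X <= _)](_ : `|dotr (delta_mx 0 i) (vcoord x)| = _) ?MP ?orbT //.
    rewrite /dotr (bigD1 i) //= big1 ?addr0 ?mxE ?eqxx ?mul1r // => j ji.
    by rewrite !mxE eqxx (negbTE ji) mul0r.
  have [M MP] := choice coordb.
  have := lfX (\sum_i M i); apply: sub_finite_set => x Xx; split=> //=.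
  apply: norm_coord_le => [|i]; first by apply: sumr_ge0 => i _; have [] := MP i.
  have [_ /(_ x Xx)] := MP i; move=> /le_trans; apply.
  by rewrite (bigD1 i) //= lerDl; apply: sumr_ge0 => j _; have [] := MP j.
by move=> x; exact: IT.
Qed.

End IdealArgument.

(** * The rational form *)

Section RationalSpan.
Variables (R : realType) (A : lmodType R).

Definition qsubspace (P : set A) :=
  [/\ P 0, forall x y, P x -> P y -> P (x + y) &
    forall q x, P x -> P (ratr q *: x)].

Definition qcomb N (b : 'I_N -> A) (c : 'rV[rat]_N) : A :=
  \sum_i ratr (c 0 i) *: b i.

Lemma qcombD N (b : 'I_N -> A) c c' :
  qcomb b (c + c') = qcomb b c + qcomb b c'.
Proof.
by rewrite -big_split; apply: eq_bigr => i _; rewrite mxE rmorphD scalerDl.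
Qed.

Lemma qcombZ N (b : 'I_N -> A) q c :
  qcomb b (q *: c) = ratr q *: qcomb b c.
Proof.
by rewrite scaler_sumr; apply: eq_bigr => i _; rewrite mxE rmorphM scalerA.
Qed.

Lemma qcomb0 N (b : 'I_N -> A) : qcomb b 0 = 0.
Proof. by rewrite -(scale0r 0) qcombZ rmorph0 scale0r. Qed.

Lemma qcomb_delta N (b : 'I_N -> A) i : qcomb b (delta_mx 0 i) = b i.
Proof.
rewrite /qcomb (bigD1 i) //= mxE !eqxx rmorph1 scale1r big1 ?addr0 // => j ji.
by rewrite mxE (negbTE ji) andbF rmorph0 scale0r.
Qed.

Definition qspan N (b : 'I_N -> A) : set A := range (qcomb b).

Lemma qspan_subspace N (b : 'I_N -> A) : qsubspace (qspan b).
Proof.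
split; first by exists 0; rewrite ?qcomb0.
  by move=> _ _ [c _ <-] [c' _ <-]; exists (c + c'); rewrite ?qcombD.
by move=> q _ [c _ <-]; exists (q *: c); rewrite ?qcombZ.
Qed.

Lemma qsubspace_subgroup (P : set A) : qsubspace P -> subgroup_set P.
Proof.
move=> [P0 PD PZ]; split=> // x y Px Py; apply: PD => //.
by have := PZ (-1) _ Py; rewrite rmorphN1 scaleN1r.
Qed.

Lemma qspan_vbasis N (b : 'I_N -> A) (U : {vspace 'rV[rat]_N}) :
  qspan (fun j : 'I_(\dim U) => qcomb b (vbasis U)`_j) =
  [set qcomb b c | c in [set c | c \in U]].
Proof.
have sumE (d : 'rV[rat]_(\dim U)) :
    qcomb (fun j : 'I_(\dim U) => qcomb b (vbasis U)`_j) d =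
    qcomb b (\sum_j d 0 j *: (vbasis U)`_j).
  rewrite {1}/qcomb.
  elim/big_ind2: _ => [|u a v c -> ->|j _]; first by rewrite qcomb0.
    by rewrite qcombD.
  by rewrite qcombZ.
apply/seteqP; split=> [_ [d _ <-]|_ [c /= cU <-]].
  rewrite sumE; eexists; last by [].
  apply: rpred_sum => j _; apply: rpredZ.
  by apply: (vbasis_mem (U := U)); rewrite mem_nth // size_tuple.
exists (\row_j coord (vbasis U) j c) => //; rewrite sumE.
by rewrite [in RHS](coord_vbasis cU); congr qcomb; apply: eq_bigr => j _; rewrite mxE.
Qed.

(** The coefficient rows with value in [P] form a subspace [U], whence at most [N] generators. A
    shortest generating family is independent: a complement of a relation among the rows would give
    a shorter one. If no generator is saved, [U] is everything. *)
Lemma qsubspace_basis (P : set A) N (b : 'I_N -> A) :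
  qsubspace P -> P `<=` qspan b ->
  exists m (k : 'I_m -> A),
    [/\ (m <= N)%N, injective (qcomb k), qspan k = P & m = N -> P = qspan b].
Proof.
move=> [P0 PD PZ] Pb.
have [||U UP] := @pred_vspace _ _ [set c : 'rV[rat]_N | P (qcomb b c)].
- by rewrite /= qcomb0.
- by move=> a x y Px Py /=; rewrite qcombD qcombZ; apply: PD => //; exact: PZ.
have dT : \dim {:'rV[rat]_N} = N by rewrite dimvf /dim /= mul1n.
pose Q m := `[< exists k : 'I_m -> A, qspan k = P >].
have QU : Q (\dim U).
  apply/asboolP; exists (fun j : 'I_(\dim U) => qcomb b (vbasis U)`_j).
  rewrite qspan_vbasis; apply/seteqP; split.
    by move=> _ [c /= /UP ? <-].
  by move=> x Px; have [c _ cx] := Pb x Px; exists c => //; apply/UP; rewrite /= cx.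
have exQ : exists m, Q m by exists (\dim U).
case: (ex_minnP exQ) => m /asboolP[k kP] mmin.
have mU : (m <= \dim U)%N := mmin _ QU.
have UN : (\dim U <= N)%N by rewrite -[X in (_ <= X)%N]dT dimvS // subvf.
exists m, k; split=> //.
- exact: leq_trans UN.
- suff ker0 c : qcomb k c = 0 -> c = 0.
    move=> x y xy; apply/eqP; rewrite -subr_eq0; apply/eqP/ker0.
    by rewrite -scaleN1r qcombD qcombZ xy rmorphN1 scaleN1r subrr.
  move=> kc; apply/eqP/negP => /negP c0.
  pose W := (<[c]>^C)%VS.
  have : (m <= \dim W)%N.
    apply: mmin; apply/asboolP.
    exists (fun j : 'I_(\dim W) => qcomb k (vbasis W)`_j).
    rewrite qspan_vbasis -kP.
    apply/seteqP; split=> [_ [d _ <-]|_ [d _ <-]]; first by exists d.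
    have : d \in (<[c]> + W)%VS by rewrite addv_complf memvf.
    case/memv_addP => _ /vlineP[t ->] [w wW ->]; exists w => //.
    by rewrite qcombD qcombZ kc scaler0 add0r.
  have dT' : \dim {:'rV[rat]_m} = m by rewrite dimvf /dim /= mul1n.
  have : (0 < m)%N.
    by rewrite -dT' lt0n dimv_eq0; apply: contra c0 => /eqP T0; rewrite -memv0 -T0 memvf.
  by rewrite dimv_compl dT' dim_vline c0; lia.
move=> mN; have UT : U = fullv.
  by apply/eqP; rewrite eqEdim subvf dT -{1}mN.
apply/seteqP; split=> // _ [c _ <-].
by apply/(UP c); rewrite UT memvf.
Qed.

Lemma finite_qspan (D : set A) : finite_set D ->
  exists N (b : 'I_N -> A), D `<=` qspan b.
Proof.
move=> /finite_seqP[s ->]; exists (size s), (fun i => s`_i) => x /= xs.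
exists (delta_mx 0 (Ordinal (etrans (index_mem x s) xs))) => //.
by rewrite qcomb_delta nth_index.
Qed.

(* The minimal number of generators makes the span minimal. *)
Lemma minimal_qspan (X : set A) N (b : 'I_N -> A) : X `<=` qspan b ->
  exists m (k : 'I_m -> A),
    [/\ injective (qcomb k), covered_by_translates X (qspan k) &
     forall P, qsubspace P -> P `<=` qspan k -> covered_by_translates X P ->
       qspan k `<=` P].
Proof.
move=> Xb.
pose Q m := `[< exists k : 'I_m -> A, covered_by_translates X (qspan k) >].
have exQ : exists m, Q m by exists N; apply/asboolP; exists b; exact: cov_sub.
case: (ex_minnP exQ) => m /asboolP[k kX] mmin.
have minP P : qsubspace P -> P `<=` qspan k -> covered_by_translates X P ->
    qspan k `<=` P.
  move=> subP Pk PX; have [n [l [nm _ lP PE]]] := qsubspace_basis subP Pk.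
  rewrite -PE //; apply/eqP; rewrite eqn_leq nm mmin //.
  by apply/asboolP; exists l; rewrite lP.
have [n [l [nm injl lk _]]] := qsubspace_basis (qspan_subspace k) (fun x kx => kx).
by exists n, l; rewrite lk.
Qed.

End RationalSpan.

(** * Units and the identity in rational ideals *)

Lemma linear_dependence (F : fieldType) n (f : 'I_n.+1 -> 'rV[F]_n) :
  exists2 c : 'rV[F]_n.+1, c != 0 & \sum_i c 0 i *: f i = 0.
Proof.
pose M : 'M[F]_(n.+1, n) := \matrix_i f i.
have : kermx M != 0.
  by rewrite -mxrank_eq0 mxrank_ker subn_eq0 -ltnNge ltnS rank_leq_col.
case/rowV0Pn => c /sub_kermxP cM c0; exists c => //.
rewrite -[RHS]cM mulmx_sum_row; apply: eq_bigr => i _.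
by rewrite rowK.
Qed.

Lemma poly_row_neq0 (F : fieldType) n (c : 'rV[F]_n.+1) : c != 0 ->
  \poly_(i < n.+1) c 0 (inord i) != 0.
Proof.
apply: contra => /eqP p0; apply/eqP/rowP => i; rewrite mxE.
have := congr1 (fun p : {poly F} => p`_i) p0.
by rewrite coef_poly coef0 ltn_ord inord_val.
Qed.

Lemma horner_alg_row (F : fieldType) (A : algType F) n (c : 'rV[F]_n.+1) (y : A) :
  horner_alg y (\poly_(i < n.+1) c 0 (inord i)) = \sum_i c 0 i *: y ^+ i.
Proof.
rewrite poly_def linear_sum; apply: eq_bigr => i _.
by rewrite linearZ /= rmorphXn /= horner_algX inord_val mulr_algl.
Qed.

Lemma algebraic_elt (R : realType) (A : falgType R) (y : A) :
  exists2 p : {poly R}, p != 0 & horner_alg y p = 0.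
Proof.
have [c c0 cE] := linear_dependence (fun i : 'I__.+1 => vcoord (y ^+ i)).
exists (\poly_(i < (\dim {:A}).+1) c 0 (inord i)); first exact: poly_row_neq0.
rewrite horner_alg_row; apply: (bij_inj (vcoord_bij A)).
rewrite linear0 -[RHS]cE linear_sum; apply: eq_bigr => i _.
by rewrite linearZ.
Qed.

Lemma poly_avoid (F : idomainType) (p : {poly F}) (a : nat -> F) :
  p != 0 -> injective a -> exists n, ~~ root p (a n).
Proof.
move=> p0 inja; apply: contrapT => H.
have all_root : all (root p) [seq a n | n <- iota 0 (size p)].
  apply/allP => _ /mapP[n _ ->]; apply: contrapT => /negP na; apply: H.
  by exists n.
have := max_poly_roots p0 all_root.
rewrite map_inj_uniq ?iota_uniq // size_map size_iota ltnn.
by move=> /(_ isT).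
Qed.

(** Relative to the unit [w], the element with coefficient [t] is [w * (1 + (t - r) *: y)]. It is a
    unit unless [a = 1 / (r - t)] is a root of a polynomial [p] killing [y]: from
    [p - p(a) = (X - a) * g] one gets [(a - y) * g(y) = p(a)]. Only finitely many [t] are
    excluded. *)
Lemma unit_perturb (R : realType) (A : falgType R) (c u : A) (r : R) :
  c + r *: u \is a GRing.unit ->
  exists n : nat, c + n%:R *: u \is a GRing.unit.
Proof.
set w := c + _ => wU; pose y := w^-1 * u.
have [p p0 py] := algebraic_elt y.
have [n0 n0r] : exists n0 : nat, r < n0%:R.
  by exists (Num.truncn r).+1; exact: truncnS_gt.
pose a n : R := (r - (n0 + n)%:R)^-1.
have rn n : r - (n0 + n)%:R != 0.
  by rewrite subr_eq0 lt_eqF // (lt_le_trans n0r) // ler_nat leq_addr.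
have [|n] := poly_avoid (a := a) p0.
  by move=> i j /invr_inj/addrI/oppr_inj/eqP; rewrite eqr_nat eqn_add2l => /eqP.
rewrite /root => pan; exists (n0 + n)%N; set t := (n0 + n)%:R.
have -> : c + t *: u = w * (1 + (t - r) *: y).
  by rewrite mulrDr mulr1 -scalerAr mulVKr // scalerBl /w -addrA [r *: u + _]addrC subrK.
rewrite unitrMl //.
have -> : 1 + (t - r) *: y = (r - t) *: ((a n)%:A - y).
  by rewrite scalerBr scalerA mulfV ?rn // scale1r -scaleNr opprB.
have [g gE] : exists g, p - (p.[a n])%:P = ('X - (a n)%:P) * g.
  have /factor_theorem[g ->] : root (p - (p.[a n])%:P) (a n).
    by rewrite /root hornerD hornerN hornerC subrr.
  by exists g; rewrite mulrC.
have := congr1 (horner_alg y) gE.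
rewrite rmorphM !rmorphB /= py horner_algX !horner_algC sub0r => E.
apply/unitrP; exists ((r - t)^-1 *: ((p.[a n])^-1 *: horner_alg y g)).
have E' : ((a n)%:A - y) * horner_alg y g = (p.[a n])%:A.
  by rewrite -opprB mulNr -E opprK.
have E'' : horner_alg y g * ((a n)%:A - y) = (p.[a n])%:A.
  rewrite -E' -[y in _ - y](horner_algX y) -(horner_algC y (a n)) -rmorphB.
  by rewrite -!rmorphM mulrC.
have rt : r - t != 0 := rn n.
split.
  rewrite scalerA -scalerAl -scalerAr E'' !scalerA -[RHS]scale1r.
  by congr (_ *: _); field; rewrite -natrD pan rt.
rewrite scalerA -scalerAl -scalerAr E' !scalerA -[RHS]scale1r.
by congr (_ *: _); field; rewrite -natrD pan rt.
Qed.

(** The unit 1 is a real combination of elements of [I]. Its real coefficients are replaced one at a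
    time by natural numbers, keeping the sum invertible. *)
Lemma exists_unit (R : realType) (A : falgType R) (I : set A) :
  qsubspace I ->
  (forall P : set A, P 0 -> (forall a x y, P x -> P y -> P (a *: x + y)) ->
    I `<=` P -> P 1) ->
  exists2 u, I u & u \is a GRing.unit.
Proof.
move=> [I0 ID IZ] spanI.
pose S (s : seq (R * A)) := \sum_(p <- s) p.1 *: p.2.
pose P a := exists2 s, (forall p, p \in s -> I p.2) & a = S s.
have [||u Iu|s sI s1] := spanI P.
- by exists [::] => //; rewrite /S big_nil.
- move=> a _ _ [s sI ->] [t tI ->].
  exists ([seq (a * p.1, p.2) | p <- s] ++ t).
    by move=> p; rewrite mem_cat => /orP[/mapP[q qs ->]|/tI //]; exact: (sI q).
  rewrite /S big_cat big_map scaler_sumr; congr (_ + _).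
  by apply: eq_bigr => p _; rewrite scalerA.
- exists [:: (1, u)]; first by move=> p; rewrite inE => /eqP ->.
  by rewrite /S big_seq1 scale1r.
suff H u0 : I u0 -> u0 + S s \is a GRing.unit ->
    exists2 u, I u & u \is a GRing.unit.
  by apply: (H 0 I0); rewrite add0r -s1 unitr1.
elim: s u0 sI {s1} => [|[r u] s IHs] u0 sI Iu0; rewrite /S.
  by rewrite big_nil addr0; exists u0.
rewrite big_cons /= -/(S s) addrA addrAC => /unit_perturb[n].
rewrite addrAC; apply: IHs => [p ps|]; first by apply: sI; rewrite inE ps orbT.
apply: (ID _ _ Iu0); rewrite -(ratr_nat R); apply: IZ.
by apply: (sI (r, u)); rewrite inE eqxx.
Qed.

(** The powers of [u] lie in a finite-dimensional rational space, so [u] is a root of a nonzero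
    rational polynomial. Cancelling powers of the unit [u] makes the constant term nonzero, and then
    1 is a combination of positive powers of [u], all of which lie in [I]. *)
Lemma one_in_ideal (R : realType) (A : falgType R) N (b : 'I_N -> A)
    (I : set A) (u : A) :
  qsubspace I -> (forall x y, I x -> I y -> I (x * y)) -> I `<=` qspan b ->
  I u -> u \is a GRing.unit -> I 1.
Proof.
move=> [I0 ID IZ] IM Ib Iu uU.
have IX n : I (u ^+ n.+1) by elim: n => // n IHn; rewrite exprS; exact: IM.
have /choice[c cE] n : exists c, qcomb b c = u ^+ n.+1.
  by have [c _ <-] := Ib _ (IX n); exists c.
pose H (p : {poly rat}) := horner_alg u (map_poly ratr p : {poly R}).
have HXC p q : H (p * 'X + q%:P) = H p * u + (ratr q)%:A.
  rewrite /H rmorphD rmorphM /= map_polyX map_polyC /=.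
  by rewrite rmorphD rmorphM /= horner_algX horner_algC.
have H0 : H 0 = 0 by rewrite /H !rmorph0.
have HI p : I (H p * u).
  elim/poly_ind: p => [|p q IHp]; first by rewrite H0 mul0r.
  by rewrite HXC mulrDl mulr_algl; apply: ID; [exact: IM | exact: IZ].
have Hnz p : p != 0 -> H p = 0 -> I 1.
  elim/poly_ind: p => [|p q IHp]; first by rewrite eqxx.
  have [->|q0] := eqVneq q 0.
    rewrite addr0 => pX; rewrite -[p * 'X]addr0 -polyC0 HXC rmorph0 scale0r addr0.
    move=> /(congr1 (fun x => x * u^-1)); rewrite mulrK // mul0r; apply: IHp.
    by apply: contraNneq pX => ->; rewrite mul0r.
  move=> _; rewrite HXC => /eqP; rewrite addrC addr_eq0 => /eqP E.
  have -> : 1 = ratr (- q^-1) *: (H p * u).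
    rewrite -[H p * u]opprK -E scalerN -scaleNr -rmorphN opprK scalerA -rmorphM /=.
    by rewrite mulVf // rmorph1 scale1r.
  exact: IZ.
have [d d0 dE] := linear_dependence (fun i : 'I_N.+1 => c i).
have /Hnz := poly_row_neq0 d0; apply.
suff -> : H (\poly_(i < N.+1) d 0 (inord i)) =
    qcomb b (\sum_i d 0 i *: c i) * u^-1 by rewrite dE qcomb0 mul0r.
rewrite /H poly_def rmorph_sum /= linear_sum.
have -> : qcomb b (\sum_i d 0 i *: c i) = \sum_i ratr (d 0 i) *: u ^+ i.+1.
  elim/big_ind2: _ => [|x y x' y' <- <-|i _]; first exact: qcomb0.
    exact: qcombD.
  by rewrite qcombZ cE.
rewrite mulr_suml; apply: eq_bigr => i _.
rewrite inord_val map_polyZ map_polyXn linearZ /= rmorphXn /= horner_algX mulr_algl.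
by rewrite exprSr -scalerAl mulrK.
Qed.

(** Elements of [Z] whose images lie in the same translate of [P] differ by an element that [h] maps
    into [P]. One representative for each translate is therefore enough. *)
Lemma cov_preimage (V : zmodType) (h : V -> V) (P Q Z : set V) :
  (forall x y, h (x - y) = h x - h y) -> subgroup_set P -> subgroup_set Q ->
  Z `<=` Q -> covered_by_translates [set h z | z in Z] P ->
  covered_by_translates Z [set x | Q x /\ P (h x)].
Proof.
move=> hB [P0 PB] [Q0 QB] ZQ [F [finF hF]].
apply: (@cov_trans _ _ (\bigcup_(f in F) [set z | Z z /\ P (h z - f)])).
  apply: cov_sub => z Zz; have [|f Ff [p Pp fp]] := hF (h z); first by exists z.
  by exists f => //; split=> //; rewrite -fp addrC addKr.
apply: cov_bigcup_finite => // f Ff.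
have [[z0 [Zz0 Pz0]]|no] := pselect (exists z, Z z /\ P (h z - f)); last first.
  exists set0; split; first exact: finite_set0.
  by move=> z Zz; case: no; exists z.
exists [set z0]; split; first exact: finite_set1.
move=> z [Zz Pz]; exists z0 => //; exists (z - z0); last by rewrite addrC subrK.
split; first by apply: QB; exact: ZQ.
suff -> : h (z - z0) = (h z - f) - (h z0 - f) by exact: PB.
by rewrite hB opprB addrA subrK.
Qed.

(** * The minimal rational subspace as a simple algebra *)

Section RationalForm.
Variables (R : realType) (A : falgType R) (X : set A).
Hypotheses (simpleA : simple_algebra A) (spanX : spans X).
Hypotheses (X_inf : infinite_set X) (lfX : locally_finite X).
Hypothesis apX : approximate_subring X.
Variables (N : nat) (b : 'I_N -> A).
Let B := qspan b.
Hypothesis covXB : covered_by_translates X B.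
Hypothesis minB : forall P, qsubspace P -> P `<=` B ->
  covered_by_translates X P -> B `<=` P.

Let subB : qsubspace B. Proof. exact: qspan_subspace. Qed.
Let grpB : subgroup_set B. Proof. exact: qsubspace_subgroup. Qed.

Definition core_set : set A :=
  [set z | qspan b z /\ exists x y, [/\ X x, X y & z = x - y]].
Let Z := core_set.

Lemma core_setB : Z `<=` B. Proof. by move=> z []. Qed.

Lemma cov_X_core : covered_by_translates X Z.
Proof. by apply: cov_diff covXB; have [] := grpB. Qed.

Lemma cov_core_X : covered_by_translates Z X.
Proof.
apply: cov_trans (approximate_subringD apX); apply: cov_sub.
move=> z [_ [x [y [Xx Xy ->]]]]; exists x => //; exists (- y) => //.
by have [_] := approximate_subring_sym apX; apply.
Qed.

Lemma core_sym : symmetric_set Z.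
Proof.
have [X0 _] := approximate_subring_sym apX; split.
  by split; [have [] := subB | exists 0, 0; rewrite subr0].
move=> z [Bz [x [y [Xx Xy zE]]]]; split; first exact: subgroup_setN.
by exists y, x; rewrite zE opprB.
Qed.

Lemma cov_coreD : covered_by_translates [set x + y | x in Z & y in Z] Z.
Proof.
apply: cov_trans cov_X_core; apply: cov_trans (approximate_subringD apX).
exact/cov_add/cov_core_X/cov_core_X.
Qed.

Lemma core_relatively_dense : relatively_dense Z.
Proof.
apply: relatively_dense_cov cov_X_core _.
exact: approximate_subring_relatively_dense.
Qed.

Lemma core_diff_locally_finite :
  locally_finite [set x - y | x in Z & y in Z].
Proof.
apply: locally_finite_cov lfX; apply: cov_trans cov_core_X.
apply: cov_trans cov_coreD; apply: cov_sub => _ [x Zx [y Zy <-]].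
by exists x => //; exists (- y) => //; have [_] := core_sym; apply.
Qed.

(** The intersection of [Q] with [B] contains [Z], hence covers [X] by finitely many translates, and
    minimality applies. In effect [Z] generates [B] over the rationals. *)
Lemma core_min Q : qsubspace Q -> Z `<=` Q -> B `<=` Q.
Proof.
move=> [Q0 QD QZ] ZQ; have [B0 BD BZ] := subB.
suff : B `<=` [set x | Q x /\ B x] by move=> BQ x /BQ[].
apply: minB.
- split=> // [x y [Qx Bx] [Qy By]|q x [Qx Bx]]; split.
  + exact: QD.
  + exact: BD.
  + exact: QZ.
  + exact: BZ.
- by move=> x [].
- by apply: cov_trans cov_X_core _; apply: cov_sub => z Zz; split; [exact: ZQ | case: Zz].
Qed.

(** The elements of [B] that multiplication by [x] keeps in [B] form a rational subspace.
    Multiplication maps [Z] into finitely many translates of [X], hence of [B], so by [cov_preimage]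
    this subspace still covers [X] and minimality makes it [B]. *)
Lemma mulXB x a : X x -> B a -> B (x * a) /\ B (a * x).
Proof.
move=> Xx; have [B0 BD BZ] := subB.
have key (h : A -> A) : (forall q u v, h (ratr q *: u + v) = ratr q *: h u + h v) ->
    covered_by_translates [set h z | z in X] X -> B a -> B (h a).
  move=> hl hX; suff : B `<=` [set x | B x /\ B (h x)] by move=> H /H[].
  have hD u v : h (u + v) = h u + h v.
    by have := hl 1 u v; rewrite rmorph1 !scale1r.
  have h0 : h 0 = 0 by apply: (addrI (h 0)); rewrite -hD !addr0.
  have hZ q u : h (ratr q *: u) = ratr q *: h u by rewrite -[_ *: u]addr0 hl h0 addr0.
  have hB u v : h (u - v) = h u - h v.
    by rewrite hD; have := hZ (-1) v; rewrite rmorphN1 !scaleN1r => ->.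
  apply: minB.
  - split; first by rewrite /= h0.
      by move=> u v [Bu Bhu] [Bv Bhv]; rewrite /= hD; split; exact: BD.
    by move=> q u [Bu Bhu]; rewrite /= hZ; split; exact: BZ.
  - by move=> u [].
  apply: cov_trans cov_X_core _; apply: cov_preimage => //.
    exact: core_setB.
  apply: cov_trans covXB; apply: cov_trans hX.
  exact: cov_image cov_core_X.
split; [apply: (key ( *%R x)) | apply: (key ( *%R^~ x))] => //.
- by move=> q u v; rewrite mulrDr scalerAr.
- apply: cov_trans (approximate_subringM apX); apply: cov_sub => _ [y Xy <-].
  by exists x => //; exists y.
- by move=> q u v; rewrite mulrDl scalerAl.
- apply: cov_trans (approximate_subringM apX); apply: cov_sub => _ [y Xy <-].
  by exists y => //; exists x.
Qed.

Lemma rational_mul x y : B x -> B y -> B (x * y).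
Proof.
move=> + By; have [B0 BD BZ] := subB.
suff H : B `<=` [set x | B (x * y)] by move=> /H.
apply: core_min.
  split; first by rewrite /= mul0r.
    by move=> u v /=; rewrite mulrDl; exact: BD.
  by move=> q u /=; rewrite -scalerAl; exact: BZ.
move=> _ [_ [u [v [Xu Xv ->]]]] /=; rewrite mulrBl.
by have [_] := grpB; apply; [case: (mulXB Xu By) | case: (mulXB Xv By)].
Qed.

Definition real_closed (P : set A) :=
  P 0 /\ forall a x y, P x -> P y -> P (a *: x + y).

(** The real span [W] of [B] is stable under multiplication by [X] on both sides, hence an ideal
    since [X] spans [A]. It is not zero: otherwise [Z] would be zero and [X] finite. *)
Lemma rational_real_span P : real_closed P -> B `<=` P -> forall a, P a.
Proof.
move=> [P0 PZD] BP.
pose W := [set a | forall Q, real_closed Q -> B `<=` Q -> Q a].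
suff : forall a, W a by move=> WA a; exact: WA.
have PD (Q : set A) x y : real_closed Q -> Q x -> Q y -> Q (x + y).
  by move=> [_ QZD] Qx Qy; rewrite -[x]scale1r; exact: QZD.
have W0 : W 0 by move=> Q [].
have WD x y : W x -> W y -> W (x + y).
  by move=> Wx Wy Q Qc QB; apply: PD (Wx Q Qc QB) (Wy Q Qc QB).
have WZ a x : W x -> W (a *: x).
  move=> Wx Q Qc QB; have [Q0 QZD] := Qc.
  by rewrite -[_ *: x]addr0; apply: QZD => //; exact: (Wx Q Qc QB).
have Wc : real_closed W by split=> // a x y /WZ Wx; exact: WD.
have BW : B `<=` W by move=> x Bx Q _; apply.
have WM a x : W x -> W (a * x) /\ W (x * a).
  move=> Wx; split; move: a; apply: (spans_closed spanX).
  - by rewrite mul0r.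
  - by move=> c u v Wu Wv; rewrite mulrDl -scalerAl; apply: WD => //; exact: WZ.
  - move=> u Xu; apply: (Wx [set x | W (u * x)]).
      split; first by rewrite /= mulr0.
      by move=> c y z /= Wy Wz; rewrite mulrDr -scalerAr; apply: WD => //; exact: WZ.
    by move=> y By; apply: BW; case: (mulXB Xu By).
  - by rewrite mulr0.
  - by move=> c u v Wu Wv; rewrite mulrDr -scalerAr; apply: WD => //; exact: WZ.
  move=> u Xu; apply: (Wx [set x | W (x * u)]).
    split; first by rewrite /= mul0r.
    by move=> c y z /= Wy Wz; rewrite mulrDl -scalerAl; apply: WD => //; exact: WZ.
  by move=> y By; apply: BW; case: (mulXB Xu By).
have [WA|//] := simple_ideal simpleA W0 WD WM.
case: X_inf; have X0 z : Z z -> z = 0 by move=> /core_setB/BW/WA.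
have [F [finF XF]] := cov_X_core.
apply: sub_finite_set finF => x /XF[f Ff [z /X0 ->]].
by rewrite addr0 => <-.
Qed.

(** Since [B] spans [A], the real span of [I] is a nonzero ideal of [A], hence everything. So [I]
    contains a unit by [exists_unit], and 1 by [one_in_ideal]. Taking [I] to be [B] itself yields
    that [B] is unital. *)
Lemma rational_ideal_one I u : qsubspace I -> I `<=` B ->
  (forall a x, B a -> I x -> I (a * x) /\ I (x * a)) ->
  I u -> u != 0 -> I 1.
Proof.
move=> subI IB IM Iu u0.
have [v Iv vU] : exists2 v, I v & v \is a GRing.unit.
  apply: exists_unit => // P P0 PZD IP.
  pose W := [set a | forall Q, real_closed Q -> I `<=` Q -> Q a].
  suff W1 : W 1 by apply: W1.
  have W0 : W 0 by move=> Q [].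
  have WZD a x y : W x -> W y -> W (a *: x + y).
    move=> Wx Wy Q Qc IQ; have [_ QZD] := Qc.
    by apply: QZD; [exact: (Wx Q Qc IQ) | exact: (Wy Q Qc IQ)].
  have WD x y : W x -> W y -> W (x + y).
    by move=> Wx; rewrite -[x]scale1r; exact: WZD.
  have WM a x : W x -> W (a * x) /\ W (x * a).
    move=> Wx; split; move: a; apply: rational_real_span.
    - split; rewrite /= ?mul0r // => c y z Wy Wz.
      by rewrite mulrDl -scalerAl; exact: WZD.
    - move=> a Ba /=; apply: (Wx [set x | W (a * x)]).
        split; rewrite /= ?mulr0 // => c y z Wy Wz.
        by rewrite mulrDr -scalerAr; exact: WZD.
      by move=> y Iy Q _ IQ; apply: IQ; case: (IM a y Ba Iy).
    - split; rewrite /= ?mulr0 // => c y z Wy Wz.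
      by rewrite mulrDr -scalerAr; exact: WZD.
    - move=> a Ba /=; apply: (Wx [set x | W (x * a)]).
        split; rewrite /= ?mul0r // => c y z Wy Wz.
        by rewrite mulrDl -scalerAl; exact: WZD.
      by move=> y Iy Q _ IQ; apply: IQ; case: (IM a y Ba Iy).
  have [W0'|WT] := simple_ideal simpleA W0 WD WM; last exact: WT.
  by case/eqP: u0; apply: W0' => Q _; apply.
by apply: (one_in_ideal subI _ IB Iv vU) => x y Ix Iy; case: (IM x y (IB _ Ix) Iy).
Qed.

Lemma rational_neq0 : exists2 u, B u & u != 0.
Proof.
apply: contrapT => no; have BE0 u : B u -> u = 0.
  by move=> Bu; apply/eqP/negP => /negP u0; apply: no; exists u.
have c0 : real_closed [set (0 : A)].
  by split=> // c x y -> ->; rewrite scaler0 addr0.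
by have /eqP := rational_real_span c0 BE0 1; rewrite oner_eq0.
Qed.

Lemma rational_one : B 1.
Proof.
have [u Bu u0] := rational_neq0.
apply: rational_ideal_one Bu u0 => //.
by move=> a x Ba Bx; split; exact: rational_mul.
Qed.

Definition rational_center : set A :=
  [set k | qspan b k /\ forall a, k * a = a * k].
Let K := rational_center.

Lemma commute_rational k : B k -> (forall a, B a -> k * a = a * k) -> K k.
Proof.
move=> Bk kB; split=> //; apply: rational_real_span => //.
split; first by rewrite /= mul0r mulr0.
by move=> c x y /= xk yk; rewrite mulrDr mulrDl -scalerAr -scalerAl xk yk.
Qed.

(** As [k] is central, [k] times [B] is a two-sided ideal; it contains [k], hence 1. The cofactor of
    1 commutes with everything because [k] does. *)
Lemma rational_center_inv k : K k -> k != 0 -> exists2 k', K k' & k * k' = 1.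
Proof.
move=> [Bk kC] k0; have [B0 BD BZ] := subB.
have [|||||a Ba ka1] := @rational_ideal_one [set k * a | a in B] k.
- split; first by exists 0; rewrite ?mulr0.
    by move=> _ _ [u Bu <-] [v Bv <-]; exists (u + v); rewrite ?mulrDr //; exact: BD.
  by move=> q _ [u Bu <-]; exists (ratr q *: u); rewrite ?scalerAr //; exact: BZ.
- by move=> _ [u Bu <-]; exact: rational_mul.
- move=> a _ Ba [u Bu <-]; split.
    by exists (a * u); [exact: rational_mul | rewrite mulrA kC mulrA].
  by exists (u * a); [exact: rational_mul | rewrite mulrA].
- by exists 1; rewrite ?mulr1 //; exact: rational_one.
- by [].
exists a => //; split=> // c.
have ak1 : a * k = 1 by rewrite -kC.
by rewrite -[a * c]mulr1 -ka1 mulrA -[a * c * k]mulrA -kC !mulrA ak1 mul1r.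
Qed.

(** Sums of this form make up the ideal generated by [u]. The explicit expression of 1 is what
    allows a coefficient of a linear relation to be normalised. *)
Lemma rational_simple u : B u -> u != 0 -> exists s : seq (A * A),
  (forall p, p \in s -> B p.1 /\ B p.2) /\ \sum_(p <- s) p.1 * u * p.2 = 1.
Proof.
move=> Bu u0; have [B0 BD BZ] := subB.
pose I := [set a | exists s : seq (A * A),
  (forall p, p \in s -> B p.1 /\ B p.2) /\ \sum_(p <- s) p.1 * u * p.2 = a].
apply: (@rational_ideal_one I u) => //.
- split; first by exists [::]; rewrite big_nil.
    move=> _ _ [s [sB <-]] [t [tB <-]]; exists (s ++ t); rewrite big_cat; split=> //.
    by move=> p; rewrite mem_cat => /orP[/sB|/tB].
  move=> q _ [s [sB <-]]; exists [seq (ratr q *: p.1, p.2) | p <- s]; split.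
    by move=> _ /mapP[p /sB[p1 p2] ->]; split=> //; exact: BZ.
  by rewrite big_map scaler_sumr; apply: eq_bigr => p _; rewrite !scalerAl.
- move=> _ [s [sB <-]]; rewrite big_seq; elim/big_ind: _ => // p /sB[p1 p2].
  by do 2![apply: rational_mul => //].
- move=> a _ Ba [s [sB <-]]; split.
    exists [seq (a * p.1, p.2) | p <- s]; split.
      by move=> _ /mapP[p /sB[p1 p2] ->]; split=> //; exact: rational_mul.
    by rewrite big_map mulr_sumr; apply: eq_bigr => p _; rewrite !mulrA.
  exists [seq (p.1, p.2 * a) | p <- s]; split.
    by move=> _ /mapP[p /sB[p1 p2] ->]; split=> //; exact: rational_mul.
  by rewrite big_map mulr_suml; apply: eq_bigr => p _; rewrite !mulrA.
exists [:: (1, 1)]; split.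
  by move=> p; rewrite inE => /eqP ->; split; exact: rational_one.
by rewrite big_seq1 mul1r mulr1.
Qed.

(* Normalise the last coefficient to 1 and take commutators with B: the
   relation gets shorter, so by induction the coefficients are central. *)
Lemma central_relation m (u t : 'I_m -> A) :
  (forall j, B (u j)) -> (forall j a, t j * a = a * t j) ->
  \sum_j u j * t j = 0 ->
  (forall j, u j = 0) \/
  exists z : 'I_m -> A,
    [/\ forall j, K (z j), exists j, z j != 0 & \sum_j z j * t j = 0].
Proof.
elim: m u t => [|m IHm] u t Bu tC E; first by left=> -[].
have [B0 BD BZ] := subB.
have K0 : K 0 by split=> // a; rewrite mul0r mulr0.
have extend (z : 'I_m -> A) : [/\ forall j, K (z j), exists j, z j != 0 &
     \sum_j z j * t (widen_ord (leqnSn m) j) = 0] ->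
    exists z : 'I_m.+1 -> A,
    [/\ forall j, K (z j), exists j, z j != 0 & \sum_j z j * t j = 0].
  move=> [Kz [j zj] zE].
  pose z' (j : 'I_m.+1) := if unlift ord_max j is Some i then z i else 0.
  have z'w i : z' (widen_ord (leqnSn m) i) = z i.
    rewrite /z' (_ : widen_ord _ i = lift ord_max i) ?liftK //.
    by apply: val_inj; rewrite /= /bump leqNgt ltn_ord.
  exists z'; split.
  - by move=> i; rewrite /z'; case: (unlift _ _) => [k|].
  - by exists (widen_ord (leqnSn m) j); rewrite z'w.
  rewrite big_ord_recr /= /z' unlift_none mul0r addr0 -[RHS]zE.
  by apply: eq_bigr => i _; rewrite -z'w.
have [um0|um0] := eqVneq (u ord_max) 0.
  have [|j a||u0|[z zP]] := IHm (fun j => u (widen_ord (leqnSn m) j))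
      (fun j => t (widen_ord (leqnSn m) j)).
  - by [].
  - exact: tC.
  - by move: E; rewrite big_ord_recr /= um0 mul0r addr0.
  - left=> j; case: (unliftP ord_max j) => [i ->|-> //].
    rewrite -(u0 i); congr u.
    by apply: val_inj; rewrite /= /bump leqNgt ltn_ord.
  - by right; apply: extend zP.
have [s [sB s1]] := rational_simple (Bu ord_max) um0.
pose u' j := \sum_(p <- s) p.1 * u j * p.2.
have u'1 : u' ord_max = 1 := s1.
have Bu' j : B (u' j).
  rewrite /u' big_seq; elim/big_ind: _ => // p /sB[p1 p2].
  by do 2![apply: rational_mul => //].
have E' : \sum_j u' j * t j = 0.
  have -> : \sum_j u' j * t j = \sum_(p <- s) p.1 * (\sum_j u j * t j) * p.2.
    under eq_bigr do rewrite mulr_suml.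
    rewrite exchange_big; apply: eq_bigr => p _.
    rewrite mulr_sumr mulr_suml; apply: eq_bigr => j _.
    by rewrite -!mulrA tC.
  by rewrite E big1 // => p _; rewrite mulr0 mul0r.
right.
have [allc|] := pselect (forall a j, B a -> a * u' j = u' j * a).
  exists u'; split=> //; last by exists ord_max; rewrite u'1 oner_neq0.
  by move=> j; apply: commute_rational => // a Ba; rewrite allc.
move=> /existsNP[a /existsNP[j0 /not_implyP[Ba neq]]].
have [j|j c||u0|[z zP]] := IHm
    (fun j => a * u' (widen_ord (leqnSn m) j) - u' (widen_ord (leqnSn m) j) * a)
    (fun j => t (widen_ord (leqnSn m) j)).
- by have [_] := grpB; apply; exact: rational_mul.
- exact: tC.
- have : a * (\sum_j u' j * t j) - (\sum_j u' j * t j) * a = 0.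
    by rewrite E' mulr0 mul0r subrr.
  rewrite mulr_sumr mulr_suml -sumrB big_ord_recr /= u'1 mul1r.
  rewrite tC subrr addr0 => H; rewrite -[RHS]H; apply: eq_bigr => j _.
  by rewrite mulrBl !mulrA -[u' _ * t _ * a]mulrA tC mulrA.
(* If all commutators with [a] vanish, including the last one, where the coefficient is 1, then the
   choice of [a] is contradicted. *)
- case: neq; case: (unliftP ord_max j0) => [i ->|->]; last first.
    by rewrite u'1 mulr1 mul1r.
  apply/eqP; rewrite -subr_eq0 -(u0 i).
  rewrite (_ : lift ord_max i = widen_ord (leqnSn m) i) //.
  by apply: val_inj; rewrite /= /bump leqNgt ltn_ord.
by apply: extend zP.
Qed.

End RationalForm.

(** * Growth of powers and the complex modulus *)

Lemma expr_small (R : realType) (a e : R) :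
  0 <= a < 1 -> 0 < e -> exists n, a ^+ n < e.
Proof.
move=> /andP[a0 a1] e0.
have : (GRing.exp a @ \oo --> (0 : R))%classic by apply: cvg_expr; rewrite ger0_norm.
move=> /cvgrPdist_lt/(_ e e0)[n _ /(_ n (leqnn n))] /=.
by rewrite sub0r normrN ger0_norm ?exprn_ge0 // => ?; exists n.
Qed.

(** If [u > 1], the Bernoulli inequality, squared, gives quadratic growth of [u ^+ (k * 2)] against
    a linear bound. Used to turn an inequality that holds up to a slowly growing factor into an
    exact one by passing to powers. *)
Lemma le1_of_linear_growth (R : realType) (u c d : R) :
  0 <= u -> (forall k : nat, u ^+ k <= c * k%:R + d) -> u <= 1.
Proof.
move=> u0 H; rewrite leNgt; apply/negP => u1.
set h := u - 1; have h0 : 0 < h by rewrite subr_gt0.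
have bern k : 1 + k%:R * h <= u ^+ k.
  elim: k => [|k IHk]; first by rewrite mul0r addr0.
  rewrite exprS; apply: (@le_trans _ _ (u * (1 + k%:R * h))); last first.
    by rewrite ler_pM2l // (lt_trans _ u1).
  have -> : u = 1 + h by rewrite /h addrC subrK.
  rewrite -natr1; have := mulr_ge0 (ler0n R k) (ltW (mulr_gt0 h0 h0)).
  move=> kh; rewrite -subr_ge0; apply: le_trans kh _.
  by rewrite le_eqVlt; apply/orP; left; apply/eqP; ring.
have quad (k : nat) : (k%:R * h) ^+ 2 <= 2 * `|c| * k%:R + `|d|.
  apply: (@le_trans _ _ (u ^+ (k * 2))).
    rewrite exprM ler_sqr ?nnegrE ?mulr_ge0 ?exprn_ge0 ?(ltW h0) ?ler0n //.
    by apply: le_trans (bern k); rewrite lerDr.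
  apply: le_trans (H _) _; rewrite natrM lerD ?ler_norm //.
  rewrite [2 * _]mulrC mulrA mulrAC; apply: ler_wpM2r => //; apply: ler_wpM2r => //.
  exact: ler_norm.
pose k := (Num.truncn ((2 * `|c| + `|d|) / h ^+ 2)).+1.
have kb : (2 * `|c| + `|d|) < k%:R * h ^+ 2.
  by rewrite -ltr_pdivrMr ?exprn_gt0 // truncnS_gt.
have k1 : 1 <= k%:R :> R by rewrite ler1n.
have := quad k; rewrite exprMn expr2 -mulrA leNgt => /negP; apply.
have k0 : 0 < k%:R :> R by rewrite ltr0n.
apply: (@le_lt_trans _ _ (k%:R * (2 * `|c| + `|d|))); last by rewrite ltr_pM2l.
rewrite mulrDr mulrC lerD2l ler_peMl //.
Qed.

Lemma le1_of_bounded_powers (R : realType) (u d : R) :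
  0 <= u -> (forall k : nat, u ^+ k <= d) -> u <= 1.
Proof.
by move=> u0 H; apply: (@le1_of_linear_growth _ u 0 d) => // k; rewrite mul0r add0r.
Qed.

Notation nc := Normc.normc.

Section Normc.
Variable R : realType.
Implicit Types z w : R[i].

Lemma nc_ge0 z : 0 <= nc z. Proof. by case: z => a b; exact: sqrtr_ge0. Qed.
Lemma nc0 : nc (0 : R[i]) = 0. Proof. exact: Normc.normc0. Qed.
Lemma nc1 : nc (1 : R[i]) = 1. Proof. exact: Normc.normc1. Qed.
Lemma ncM z w : nc (z * w) = nc z * nc w. Proof. exact: Normc.normcM. Qed.
Lemma ncD z w : nc (z + w) <= nc z + nc w. Proof. exact: le_normcD. Qed.
Lemma ncN z : nc (- z) = nc z. Proof. exact: normcN. Qed.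
Lemma ncB z w : nc (z - w) <= nc z + nc w. Proof. by rewrite -(ncN w) ncD. Qed.
Lemma ncX z n : nc (z ^+ n) = nc z ^+ n.
Proof. by elim: n => [|n IHn]; rewrite ?nc1 // !exprS ncM IHn. Qed.
Lemma nc_eq0 z : nc z = 0 -> z = 0. Proof. exact: Normc.eq0_normc. Qed.
Lemma normC_nc z : `|z| = real_complex R (nc z).
Proof. by case: z => a b; rewrite normc_def. Qed.
Lemma nc_sqr z : nc z ^+ 2 = complex.Re z ^+ 2 + complex.Im z ^+ 2.
Proof. by case: z => a b /=; rewrite sqr_sqrtr // addr_ge0 ?sqr_ge0. Qed.
Lemma trace_conjc z : real_complex R (2 * complex.Re z) = z + conjc z.
Proof.
by case: z => a b; apply/eqP; rewrite eq_complex /=; apply/andP; split; apply/eqP; ring.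
Qed.
Lemma norm_conjc z : real_complex R (nc z ^+ 2) = z * conjc z.
Proof.
rewrite nc_sqr; case: z => a b; apply/eqP; rewrite eq_complex /=.
by apply/andP; split; apply/eqP; ring.
Qed.
Lemma nc_real (r : R) : nc (real_complex R r) = `|r|.
Proof. by rewrite /= expr0n /= addr0 sqrtr_sqr. Qed.
Lemma nc_rat (q : rat) : nc (ratr q : R[i]) = `|ratr q : R|.
Proof. by rewrite -nc_real fmorph_rat. Qed.
Lemma nc_sum (I : Type) (r : seq I) (P : pred I) (F : I -> R[i]) :
  nc (\sum_(i <- r | P i) F i) <= \sum_(i <- r | P i) nc (F i).
Proof.
elim/big_ind2: _ => [|u a v b ua vb|//]; first by rewrite nc0.
by rewrite (le_trans (ncD _ _)) // lerD.
Qed.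
Lemma Re_le_nc z : `|complex.Re z| <= nc z.
Proof.
rewrite -ler_sqr ?nnegrE ?nc_ge0 // nc_sqr real_normK ?num_real //.
by rewrite lerDl sqr_ge0.
Qed.
Lemma Im_le_nc z : `|complex.Im z| <= nc z.
Proof.
rewrite -ler_sqr ?nnegrE ?nc_ge0 // nc_sqr real_normK ?num_real //.
by rewrite lerDr sqr_ge0.
Qed.
Lemma nc_le_ReIm z : nc z <= `|complex.Re z| + `|complex.Im z|.
Proof.
rewrite -ler_sqr ?nnegrE ?nc_ge0 ?addr_ge0 // nc_sqr sqrrD.
by rewrite !real_normK ?num_real // -addrA lerD2l lerDr mulrn_wge0 ?mulr_ge0.
Qed.
End Normc.

(** * Embeddings and integral elements *)

Section Embeddings.
Variables (R : realType) (K : fieldExtType rat).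
Implicit Types (sigma tau : {rmorphism K -> R[i]}) (theta x k : K).

Lemma primitive_element_exists : exists theta : K, <<1%VS; theta>>%VS = fullv.
Proof.
have sep : separable (1%AS : {subfield K}) {:K}%AS.
  apply/separableP=> u _; apply: pcharf0_separable.
  exact: (ftrans (pchar_lalg K) (pchar_num _)).
exists (separable_generator 1%AS {:K}%AS).
by rewrite -eq_adjoin_separable_generator ?sub1v.
Qed.

Lemma embed_rat sigma (q : rat) : sigma q%:A = ratr q.
Proof. by rewrite -(fmorph_eq_rat (sigma \o in_alg K)). Qed.

Lemma map_poly_alg sigma (q : {poly rat}) :
  map_poly sigma (map_poly (in_alg K) q) = map_poly ratr q.
Proof.
rewrite -map_poly_comp; apply: eq_map_poly => c /=; exact: embed_rat.
Qed.

Lemma primitive_horner theta x : <<1%VS; theta>>%VS = fullv ->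
  exists q : {poly rat}, x = (map_poly (in_alg K) q).[theta].
Proof. by move=> genK; apply/Fadjoin1_polyP; rewrite genK memvf. Qed.

Lemma minPoly_rat theta : exists2 q : {poly rat},
  minPoly 1%VS theta = map_poly (in_alg K) q & q \is monic.
Proof.
have /polyOver1P[q qE] := minPolyOver 1%AS theta; exists q => //.
by have := monic_minPoly 1%AS theta; rewrite qE map_monic.
Qed.

Lemma rmorph_primitive_eq theta sigma tau : <<1%VS; theta>>%VS = fullv ->
  sigma theta = tau theta -> sigma =1 tau.
Proof.
move=> genK E x; have [q ->] := primitive_horner x genK.
by rewrite -!horner_map !map_poly_alg E.
Qed.

(** The value at [q(theta)] is [q(z)], independent of [q] because [mu] vanishes at [z]. The root
    condition is stated with [ratr] so that no embedding has to exist beforehand;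
    [central_embedding] obtains [sigma] in this way. *)
Lemma embedding_of_rat_root theta (mu : {poly rat}) (z : R[i]) :
  <<1%VS; theta>>%VS = fullv ->
  minPoly 1%VS theta = map_poly (in_alg K) mu -> root (map_poly ratr mu) z ->
  exists tau : {rmorphism K -> R[i]}, tau theta = z.
Proof.
move=> genK muE rz.
pose f x := (map_poly ratr (projT1 (cid (primitive_horner x genK)))).[z].
have fE (q : {poly rat}) : f (map_poly (in_alg K) q).[theta] = (map_poly ratr q).[z].
  rewrite /f; case: cid => p /= pE; apply/eqP; rewrite -subr_eq0 -hornerN -hornerD.
  rewrite -rmorphB /=; have : minPoly 1%AS theta %| map_poly (in_alg K) (p - q).
    apply: minPoly_dvdp; first by apply/polyOver1P; exists (p - q).
    by rewrite /root rmorphB hornerD hornerN /= -pE subrr.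
  rewrite muE dvdp_map => /dvdpP[g ->]; rewrite rmorphM hornerM /=.
  by move: rz; rewrite /root => /eqP ->; rewrite mulr0.
have fB : zmod_morphism f.
  move=> x y; have [p ->] := primitive_horner x genK.
  have [q ->] := primitive_horner y genK.
  by rewrite -hornerN -hornerD -rmorphB !fE rmorphB /= hornerD hornerN.
have fM : monoid_morphism f.
  split=> [|x y].
    rewrite -(hornerC 1 theta) -(rmorph1 (in_alg K)) -map_polyC fE map_polyC /=.
    by rewrite rmorph1 hornerC.
  have [p ->] := primitive_horner x genK; have [q ->] := primitive_horner y genK.
  by rewrite -hornerM -rmorphM !fE rmorphM /= hornerM.
pose F : {rmorphism K -> R[i]} := HB.pack f
  (GRing.isZmodMorphism.Build _ _ f fB) (GRing.isMonoidMorphism.Build _ _ f fM).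
exists F; rewrite -{1}(hornerX theta) -(map_polyX (in_alg K)).
by rewrite -[F _]/(f _) fE map_polyX hornerX.
Qed.

Lemma embedding_of_root theta sigma (z : R[i]) : <<1%VS; theta>>%VS = fullv ->
  root (map_poly sigma (minPoly 1%VS theta)) z ->
  exists tau : {rmorphism K -> R[i]}, tau theta = z.
Proof.
move=> genK; have [mu muE _] := minPoly_rat theta.
by rewrite muE map_poly_alg; exact: embedding_of_rat_root.
Qed.

(* The matrix of the embeddings on a basis is invertible because on powers of
   theta it is a Vandermonde matrix. *)
Lemma embeddings sigma theta : <<1%VS; theta>>%VS = fullv ->
  exists tau : 'I_(\dim {:K}) -> {rmorphism K -> R[i]},
    (forall rho : {rmorphism K -> R[i]}, exists j, rho =1 tau j) /\
    exists2 C : R, 0 <= C & forall x i,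
      `|ratr (coord (vbasis {:K}) i x)| <= C * \sum_j nc (tau j x).
Proof.
move=> genK; set n := \dim {:K}.
have dn : adjoin_degree 1%AS theta = n.
  by have := dim_Fadjoin 1%AS theta; rewrite genK dimv1 muln1.
have [mu muE mu_monic] := minPoly_rat theta.
have [r rE] := closed_field_poly_normal (map_poly (ratr : rat -> R[i]) mu).
have lc1 : lead_coef (map_poly (ratr : rat -> R[i]) mu) = 1.
  by apply/eqP; rewrite -[_ == 1]/(_ \is monic) map_monic.
rewrite lc1 scale1r in rE.
have sr : size r = n.
  have := size_minPoly 1%AS theta; rewrite dn muE size_map_poly.
  by rewrite -(size_map_poly (ratr : {rmorphism rat -> R[i]})) rE size_prod_XsubC => -[].
have ur : uniq r.
  rewrite -separable_prod_XsubC -rE separable_map.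
  rewrite -(separable_map (in_alg K)) -muE.
  apply: (@pcharf0_separable _ K 1%AS).
  exact: (ftrans (pchar_lalg K) (pchar_num _)).
have rootr (i : 'I_n) : root (map_poly sigma (minPoly 1%VS theta)) r`_i.
  by rewrite muE map_poly_alg rE root_prod_XsubC mem_nth // sr.
have /choice[tau tauE] i := embedding_of_root genK (rootr i).
exists tau; split.
  move=> rho; have : rho theta \in r.
    rewrite -root_prod_XsubC -rE -(map_poly_alg rho) -muE /root horner_map.
    by rewrite minPolyxx rmorph0.
  move=> /(nthP 0)[l]; rewrite sr => llt E; exists (Ordinal llt).
  by apply: (rmorph_primitive_eq genK); rewrite tauE.
pose e := vbasis {:K}.
pose T : 'M[R[i]]_n := \matrix_(i, j) tau j e`_i.
have TU : T \in unitmx.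
  pose V := Vandermonde n (\row_j r`_j : 'rV[R[i]]_n).
  pose M : 'M[R[i]]_n := \matrix_(l, i) ratr (coord e i (theta ^+ l)).
  have VE : V = M *m T.
    apply/matrixP => l j; rewrite !mxE -tauE -rmorphXn.
    rewrite [in LHS](coord_vbasis (memvf (theta ^+ l))) rmorph_sum.
    by apply: eq_bigr => i _; rewrite !mxE -mulr_algl rmorphM embed_rat.
  have : \det V != 0.
    rewrite det_Vandermonde; apply/prodf_neq0 => i _; apply/prodf_neq0 => j ij.
    by rewrite !mxE subr_eq0 nth_uniq ?sr // gtn_eqF.
  by rewrite VE det_mulmx mulf_eq0 negb_or unitmxE unitfE => /andP[].
exists (\sum_i \sum_j nc (invmx T j i)).
  by apply: sumr_ge0 => i _; apply: sumr_ge0 => j _; exact: nc_ge0.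
move=> x i; pose c : 'rV[R[i]]_n := \row_i ratr (coord e i x).
have cT : c *m T = \row_j tau j x.
  apply/rowP => j; rewrite !mxE [in RHS](coord_vbasis (memvf x)) rmorph_sum.
  by apply: eq_bigr => l _; rewrite !mxE -[in RHS]mulr_algl rmorphM embed_rat.
have : c 0 i = (\row_j tau j x *m invmx T) 0 i by rewrite -cT mulmxK.
rewrite !mxE => E; rewrite -nc_rat E.
apply: le_trans (nc_sum _ _ _) _; rewrite mulr_sumr; apply: ler_sum => j _.
rewrite ncM mxE mulrC ler_wpM2r ?nc_ge0 // (bigD1 i) //= (bigD1 j) //= -addrA.
rewrite lerDl addr_ge0 //; first by apply: sumr_ge0 => l _; exact: nc_ge0.
by apply: sumr_ge0 => a _; apply: sumr_ge0 => l _; exact: nc_ge0.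
Qed.

End Embeddings.

Lemma common_denominator (I : finType) (q : I -> rat) :
  exists2 d : nat, (0 < d)%N & forall i, exists z : int, d%:R * q i = z%:~R.
Proof.
exists (\prod_i `|denq (q i)|)%N.
  by rewrite prodn_gt0 // => i; rewrite absz_gt0 denq_neq0.
move=> i; rewrite (bigD1 i) //=; set m := (\prod_(_ | _) _)%N.
exists (m%:Z * numq (q i)); rewrite natrM rmorphM /= numqE -pmulrn.
have -> : `|denq (q i)|%N%:R = (denq (q i))%:~R :> rat.
  by rewrite pmulrn gez0_abs // denq_ge0.
by ring.
Qed.

Section Integral.
Variables (R : realType) (K : fieldExtType rat).
Local Notation isint := (integralOver (intr : int -> K)).

Lemma intr_alg_eq0 (z : int) : (z%:~R == 0 :> K) = (z == 0).
Proof. by rewrite -scaler_int scaler_eq0 oner_eq0 orbF intr_eq0. Qed.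

Lemma integral_multiple (x : K) : exists2 d : nat, (0 < d)%N & isint (d%:R * x).
Proof.
have [q qE q_monic] := minPoly_rat x.
have [p [a a0 pE]] := rat_poly_scale q.
have p0 : p != 0.
  by apply: contraNneq (monic_neq0 q_monic) => pz; rewrite pE pz rmorph0 scaler0.
have px : (map_poly (intr : int -> K) p).[x] = 0.
  have := minPolyxx 1%AS x; rewrite qE pE linearZ /= hornerZ => /eqP.
  rewrite mulf_eq0 scaler_eq0 oner_eq0 orbF invr_eq0 intr_eq0 (negbTE a0) /=.
  rewrite -map_poly_comp => /eqP E; rewrite -[RHS]E; congr _.[_].
  by apply: eq_map_poly => c /=; rewrite scaler_int.
set l := lead_coef p; have l0 : l != 0 by rewrite lead_coef_eq0.
suff lx : isint (l%:~R * x).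
  exists `|l|%N; first by rewrite absz_gt0.
  have [lp|ln] := lerP 0 l.
    by have -> : `|l|%N%:R = l%:~R :> K by rewrite -{2}(gez0_abs lp).
  have -> : `|l|%N%:R = - l%:~R :> K by rewrite -{2}(opprK l) -(ltz0_abs ln) rmorphN opprK.
  by rewrite mulNr; apply: integral_opp.
pose D := (size p).-1.
(* The polynomial [P] below is [p (X / l)] scaled by [l ^ (D - 1)]: its leading coefficient becomes
   1 and the others stay integral. *)
have sp : size p = D.+1 by rewrite /D prednK // size_poly_gt0.
pose P : {poly int} := 'X^D + \poly_(i < D) (p`_i * l ^+ (D.-1 - i)).
exists P.
  rewrite /P monicE lead_coefDl ?lead_coefXn // size_polyXn ltnS.
  exact: size_poly.
(* For [D = 0] the exponent [D.-1] has no meaning, but a nonzero constant has no root. *)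
have [D0|D0] := posnP D.
  move: px; rewrite (size1_polyC (p := p)) ?sp ?D0 // map_polyC hornerC /=.
  move/eqP; rewrite intr_alg_eq0 => /eqP p00; case/eqP: p0.
  by rewrite (size1_polyC (p := p)) ?sp ?D0 // p00.
rewrite /root /P rmorphD /= map_polyXn hornerD hornerXn.
have -> : map_poly (intr : int -> K) (\poly_(i < D) (p`_i * l ^+ (D.-1 - i))) =
   \poly_(i < D) (p`_i * l ^+ (D.-1 - i))%:~R.
  apply/polyP => i; rewrite coef_map !coef_poly /=; case: ifP => // _.
rewrite horner_poly; apply/eqP.
suff -> : (l%:~R * x) ^+ D + \sum_(i < D) (p`_i * l ^+ (D.-1 - i))%:~R * (l%:~R * x) ^+ i
   = l%:~R ^+ D.-1 * (map_poly (intr : int -> K) p).[x] by rewrite px mulr0.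
rewrite horner_coef size_map_poly_id0 ?intr_alg_eq0 // sp big_ord_recr /=.
rewrite [LHS]addrC mulrDr mulr_sumr.
congr (_ + _).
  apply: eq_bigr => i _; rewrite coef_map /= exprMn rmorphM rmorphXn /=.
  have -> : (l%:~R : K) ^+ D.-1 = l%:~R ^+ (D.-1 - i) * l%:~R ^+ i.
    by rewrite -exprD subnK // -ltnS prednK.
  by ring.
rewrite coef_map /= -[D in p`_D]/(size p).-1 -lead_coefE -/l exprMn -{1}(prednK D0) exprSr.
by ring.
Qed.

(** Remainders modulo a monic integral polynomial. All powers of [x] thus share the denominators of
    finitely many of them. *)
Lemma integral_powers (x : K) : isint x -> exists D : nat, forall n,
  exists c : 'I_D -> int, x ^+ n = \sum_i (c i)%:~R * x ^+ i.
Proof.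
move=> [p p_monic px]; exists (size p) => n.
pose r := Pdiv.CommonRing.rmodp 'X^n p.
exists (fun i => r`_i).
have sr : (size r <= size p)%N.
  by rewrite ltnW // Pdiv.Ring.ltn_rmodpN0 // monic_neq0.
have := Pdiv.RingMonic.rdivp_eq p_monic 'X^n.
move=> /(congr1 (fun q => (map_poly (intr : int -> K) q).[x])).
rewrite map_polyXn hornerXn rmorphD rmorphM hornerD hornerM /= (eqP px) mulr0 add0r.
move=> ->; rewrite -/r (horner_coef_wide (n := size p)).
  by apply: eq_bigr => i _; rewrite coef_map.
exact: leq_trans (size_poly _ _) sr.
Qed.

(** Takes the place of the fact that a nonzero integral element has norm at least 1. If all
    conjugates were below 1, the rational coordinates of [x ^+ n] would tend to 0; having a common
    denominator, they would vanish for some [n]. *)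
Lemma integral_large_conjugate (sigma : {rmorphism K -> R[i]}) (x : K) :
  isint x -> x != 0 -> exists rho : {rmorphism K -> R[i]}, 1 <= nc (rho x).
Proof.
move=> ix x0; apply: contrapT => small.
have [theta genK] := primitive_element_exists K.
have [tau [_ [C C0 tauC]]] := embeddings sigma genK.
have {}small j : nc (tau j x) < 1.
  by rewrite ltNge; apply/negP => ?; apply: small; exists (tau j).
have [D powx] := integral_powers ix.
have [d d0 dP] := common_denominator (fun li : 'I_D * 'I_(\dim {:K}) =>
  coord (vbasis {:K}) li.2 (x ^+ li.1)).
pose a := \big[Num.max/0]_j nc (tau j x).
have a01 : 0 <= a < 1.
  apply/andP; split; first by apply: bigmax_ge_id.
  by apply: bigmax_lt => [|j _]; [exact: ltr01 | exact: small].
have m0 : 0 < d%:R * (C * (\dim {:K})%:R) + 1 :> R.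
  by rewrite ltr_wpDl // !mulr_ge0.
have [n an] := expr_small a01 (divr_gt0 ltr01 m0).
case/eqP: x0; apply/eqP; suff : x ^+ n == 0 by rewrite expf_eq0 => /andP[].
rewrite (coord_vbasis (memvf (x ^+ n))) big1 // => i _.
suff -> : coord (vbasis {:K}) i (x ^+ n) = 0 by rewrite scale0r.
have [z zE] : exists z : int, d%:R * coord (vbasis {:K}) i (x ^+ n) = z%:~R.
  have [c ->] := powx n.
  have /choice[z zE] l := dP (l, i).
  exists (\sum_l c l * z l); rewrite linear_sum mulr_sumr rmorph_sum.
  apply: eq_bigr => l _; rewrite rmorphM /= -zE mulrCA; congr (_ * _).
  have -> : (c l)%:~R * x ^+ l = ((c l)%:~R : rat) *: x ^+ l.
    by rewrite -mulr_algl scaler_int.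
  by rewrite linearZ.
have : `|ratr (d%:R * coord (vbasis {:K}) i (x ^+ n)) : R| < 1.
  rewrite rmorphM normrM rmorph_nat normr_nat.
  apply: (@le_lt_trans _ _ (d%:R * (C * (\dim {:K})%:R * a ^+ n))).
    rewrite ler_wpM2l // (le_trans (tauC _ _)) // -mulrA ler_wpM2l //.
    rewrite mulr_natl -[X in _ *+ X]card_ord -sumr_const; apply: ler_sum => j _.
    rewrite rmorphXn ncX lerXn2r ?nnegrE ?nc_ge0 //; first by case/andP: a01.
    exact: (le_bigmax_cond _ (fun j => nc (tau j x))).
  rewrite mulrA; apply: (@le_lt_trans _ _
     ((d%:R * (C * (\dim {:K})%:R) + 1) * a ^+ n)).
    by rewrite ler_wpM2r ?exprn_ge0 ?lerDl //; case/andP: a01.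
  by rewrite mulrC -ltr_pdivlMr.
rewrite zE ratr_int -intr_norm -[1]/(1%:~R) ltr_int => z1.
have : z = 0 by apply/eqP; rewrite -absz_eq0; move: z1; lia.
move=> z0; move: zE; rewrite z0 => /eqP.
by rewrite mulf_eq0 pnatr_eq0 gtn_eqF //= => /eqP.
Qed.

(** Two such elements in one cell of mesh one third differ by an integral element whose conjugates
    are all at most two thirds, hence by 0 in view of [integral_large_conjugate]. *)
Lemma finite_integral (sigma : {rmorphism K -> R[i]}) (r : R) :
  finite_set [set x | isint x /\
    forall rho : {rmorphism K -> R[i]}, nc (rho x) <= r].
Proof.
have [theta genK] := primitive_element_exists K.
have [tau [tau_all _]] := embeddings sigma genK.
set S := [set x | _].
have [|[b j] x [_ xr]|F [finF FS SF]] := @finite_net R K S (bool * 'I_(\dim {:K}))%type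
   (fun bj x => if bj.1 then complex.Re (tau bj.2 x) else complex.Im (tau bj.2 x)) r (3%:R^-1).
- by rewrite invr_gt0.
- by case: b => /=; [exact: le_trans (Re_le_nc _) _ | exact: le_trans (Im_le_nc _) _].
apply: sub_finite_set finF => x Sx; have [y Fy xy] := SF x Sx.
suff -> : x = y by [].
apply: contrapT => /eqP; rewrite -subr_eq0 => xy0.
have [ix _] := Sx; have [iy _] := FS _ Fy.
have [rho] := integral_large_conjugate sigma (integral_sub ix iy) xy0.
have [j ->] := tau_all rho; rewrite leNgt => /negP; apply.
apply: le_lt_trans (nc_le_ReIm _) _.
have := xy (true, j); have := xy (false, j); rewrite /= rmorphB !raddfB /=.
by lra.
Qed.

End Integral.

Lemma powR_exp (R : realType) (a s : R) n : 0 <= a -> (a ^+ n) `^ s = (a `^ s) ^+ n.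
Proof.
move=> a0; elim: n => [|n IHn]; first by rewrite !expr0 powR1.
by rewrite !exprS powRM ?exprn_ge0 // IHn.
Qed.

Lemma powR_mono (R : realType) (a b s : R) : 0 <= s -> 0 <= a -> a <= b ->
  a `^ s <= b `^ s.
Proof.
by move=> s0 a0 ab; apply: ge0_ler_powR; rewrite ?nnegrE ?(le_trans a0 ab).
Qed.

(** * Absolute values *)

Section AbsoluteValue.
Variables (R : realType) (K : fieldType) (w : absolute_value R K).

Lemma absv0 : w 0 = 0. Proof. exact/absv_eq0. Qed.

Lemma absv_gt0 x : x != 0 -> 0 < w x.
Proof.
move=> x0; rewrite lt_neqAle absv_ge0 andbT eq_sym; apply: contra x0 => /eqP.
by move=> /absv_eq0 ->.
Qed.

Lemma absv1 : w 1 = 1.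
Proof.
have w1 : w 1 != 0 by rewrite gt_eqF // absv_gt0 // oner_eq0.
by apply: (mulfI w1); rewrite -absvM !mulr1.
Qed.

Lemma absvX x n : w (x ^+ n) = w x ^+ n.
Proof. by elim: n => [|n IHn]; rewrite ?absv1 // !exprS absvM IHn. Qed.

Lemma absvN x : w (- x) = w x.
Proof.
suff wN1 : w (-1) = 1 by rewrite -mulN1r absvM wN1 mul1r.
have : w (-1) ^+ 2 == 1 by rewrite -absvX sqrrN expr1n absv1.
rewrite sqrf_eq1 => /orP[/eqP //|/eqP E].
by have := absv_ge0 w (-1); rewrite E oppr_ge0 ler10.
Qed.

Lemma absvV x : w x^-1 = (w x)^-1.
Proof.
have [->|x0] := eqVneq x 0; first by rewrite invr0 absv0 invr0.
have wx : w x != 0 by rewrite gt_eqF // absv_gt0.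
by apply: (mulfI wx); rewrite -absvM !mulfV // absv1.
Qed.

Lemma absv_nat n : w n%:R <= n%:R.
Proof.
elim: n => [|n IHn]; first by rewrite absv0.
by rewrite -!natr1 (le_trans (absvD _ _ _)) // absv1 lerD.
Qed.

Lemma absv_sum (I : Type) (r : seq I) (P : pred I) (F : I -> K) :
  w (\sum_(i <- r | P i) F i) <= \sum_(i <- r | P i) w (F i).
Proof.
elim/big_ind2: _ => [|u a v b ua vb|//]; first by rewrite absv0.
by rewrite (le_trans (absvD _ _ _)) // lerD.
Qed.

(* Expansion of N in base a. *)
Lemma absv_digits (a N t : nat) : (1 < a)%N -> (N < a ^ t.+1)%N ->
  w N%:R <= a%:R * t.+1%:R * Num.max 1 (w a%:R) ^+ t.
Proof.
move=> a1; set A := Num.max 1 _.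
have A1 : 1 <= A by rewrite le_max lexx.
have A0 : 0 <= A by apply: le_trans A1.
elim: t N => [|t IHt] N Na.
  by rewrite expr0 !mulr1 (le_trans (absv_nat _)) // ler_nat ltnW.
rewrite (divn_eq N a) natrD natrM (le_trans (absvD _ _ _)) // absvM.
have -> : a%:R * t.+2%:R * A ^+ t.+1 =
    (a%:R * t.+1%:R * A ^+ t) * A + a%:R * A ^+ t.+1 :> R.
  by rewrite exprS; ring.
apply: lerD.
  apply: ler_pM; [exact: absv_ge0 | exact: absv_ge0 | |].
    by apply: IHt; rewrite ltn_divLR -?expnSr // ltnW.
  by rewrite /A le_max lexx orbT.
rewrite (le_trans (absv_nat _)) // -[leLHS]mulr1 ler_pM ?exprn_ege1 //.
by rewrite ler_nat ltnW // ltn_pmod // ltnW.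
Qed.

(** Written in base [a], [b ^ k] has about [k * L] digits. By [absv_digits], the [k]-th power of the
    quotient of the two sides grows at most linearly in [k], so the quotient is at most 1. *)
Lemma absv_log (a b : nat) : (1 < a)%N -> (1 < b)%N ->
  w b%:R <= Num.max 1 (w a%:R) `^ (ln b%:R / ln a%:R).
Proof.
move=> a1 b1; set A := Num.max 1 _; set L := ln _ / _.
have A1 : 1 <= A by rewrite le_max lexx.
have A0 : 0 < A by apply: lt_le_trans A1.
have la : 0 < ln a%:R :> R by rewrite ln_gt0 // ltr1n.
have lb : 0 < ln b%:R :> R by rewrite ln_gt0 // ltr1n.
have L0 : 0 <= L by rewrite divr_ge0 // ltW.
have AL : 0 < A `^ L by rewrite powR_gt0.
rewrite -[leRHS]mul1r -ler_pdivrMr //.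
apply: (@le1_of_linear_growth _ _ (a%:R * L) a%:R).
  by rewrite divr_ge0 ?absv_ge0 // ltW.
move=> k; rewrite exprMn exprVn ler_pdivrMr ?exprn_gt0 //.
pose t := Num.truncn (k%:R * L).
have kL : 0 <= k%:R * L by rewrite mulr_ge0.
have /andP[tl tu] := truncn_itv kL.
have bk : (b ^ k < a ^ t.+1)%N.
  rewrite -(ltr_nat R) !natrX -ltr_ln ?posrE ?exprn_gt0 ?ltr0n ?(ltnW a1) ?(ltnW b1) //.
  rewrite !lnXn ?ltr0n ?(ltnW a1) ?(ltnW b1) // -(mulr_natl (ln b%:R)) -(mulr_natl (ln a%:R)).
  by rewrite -ltr_pdivrMr // -mulrA.
rewrite -absvX -natrX; apply: le_trans (absv_digits a1 bk) _.
apply: ler_pM; rewrite ?mulr_ge0 ?exprn_ge0 ?(ltW A0) //.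
  rewrite -natr1 mulrDr mulr1 lerD2r -mulrA ler_wpM2l // [L * _]mulrC.
  exact: tl.
rewrite -(powR_exp _ _ (ltW A0)) -(powR_mulrn k (ltW A0)) -powRrM.
by rewrite -/A -(powR_mulrn t (ltW A0)); apply: ler_powR.
Qed.

(** If one natural number has absolute value above 1, [absv_log] forces this for all natural numbers
    from 2 on. Exchanging [a] and [b] then shows that [ln (w a) / ln a] is independent of [a]; it is
    the exponent [s]. *)
Lemma absv_ostrowski :
  (forall n : nat, w n%:R <= 1) \/
  exists2 s : R, 0 < s & forall n : nat, w n%:R = n%:R `^ s.
Proof.
have [|/existsNP[n0 /negP]] := pselect (forall n : nat, w n%:R <= 1); first by left.
rewrite -ltNge => wn0; right.
have n01 : (1 < n0)%N.
  case: n0 wn0 => [|[|//]]; first by rewrite absv0 ltr10.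
  by rewrite absv1 ltxx.
have w1 a : (1 < a)%N -> 1 < w a%:R.
  move=> a1; rewrite ltNge; apply/negP => wa.
  have := absv_log a1 n01; rewrite (max_idPl _) // powR1 leNgt.
  by rewrite wn0.
have w0 a : (1 < a)%N -> 0 < w a%:R by move=> /w1; apply: lt_trans.
have lnp a : (1 < a)%N -> 0 < ln a%:R :> R by move=> a1; rewrite ln_gt0 // ltr1n.
have wlog a b : (1 < a)%N -> (1 < b)%N ->
    ln (w b%:R) / ln b%:R <= ln (w a%:R) / ln a%:R.
  move=> a1 b1; have := absv_log a1 b1; rewrite (max_idPr _) ?(ltW (w1 _ a1)) //.
  rewrite -ler_ln ?posrE ?w0 ?powR_gt0 ?w0 // ln_powR.
  rewrite ler_pdivrMr ?lnp // => H; apply: le_trans H _.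
  by rewrite le_eqVlt; apply/orP; left; apply/eqP; ring.
exists (ln (w 2%:R) / ln 2%:R); first by rewrite divr_gt0 ?lnp // ln_gt0 // w1.
have s0 : ln (w 2%:R) / ln 2%:R != 0 by rewrite gt_eqF // divr_gt0 ?lnp // ln_gt0 // w1.
case=> [|[|n]]; first by rewrite absv0 powR0.
  by rewrite absv1 powR1.
apply: ln_inj; rewrite ?posrE ?w0 ?powR_gt0 ?ltr0n //.
rewrite ln_powR; apply: (mulIf (x := (ln n.+2%:R)^-1)).
  by rewrite invr_eq0 gt_eqF // lnp.
rewrite mulfK ?gt_eqF ?lnp //.
by apply/eqP; rewrite eq_le !wlog.
Qed.

End AbsoluteValue.

Section NumberFieldAbsv.
Variables (R : realType) (K : fieldExtType rat).
Implicit Types (w : absolute_value R K) (sigma rho : {rmorphism K -> R[i]}).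
Local Notation isint := (integralOver (intr : int -> K)).

Lemma absv_int w (z : int) : w z%:~R = w `|z|%N%:R.
Proof.
have [z0|z0] := lerP 0 z; first by rewrite -{1}(gez0_abs z0).
by rewrite -{1}[z]opprK -(ltz0_abs z0) rmorphN absvN.
Qed.

(** All powers of [x] are integer combinations of finitely many of them, so they stay bounded under
    [w]. *)
Lemma absv_integral w (x : K) :
  (forall n : nat, w n%:R <= 1) -> isint x -> w x <= 1.
Proof.
move=> w1 /integral_powers[D powx].
apply: (@le1_of_bounded_powers _ _ (\sum_(i < D) w x ^+ i)); first exact: absv_ge0.
move=> n; rewrite -absvX; have [c ->] := powx n.
apply: le_trans (absv_sum _ _ _ _) _; apply: ler_sum => i _.
by rewrite absvM absvX absv_int ler_piMl // exprn_ge0 // absv_ge0.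
Qed.

Definition absv_arch w (s : R) := forall n : nat, w n%:R = n%:R `^ s.

Lemma absv_rat w s (q : rat) : absv_arch w s -> w q%:A = `|ratr q| `^ s.
Proof.
move=> ws; have -> : q%:A = (numq q)%:~R / (denq q)%:~R :> K.
  rewrite -[q in LHS]divq_num_den -mulr_algl mulr1 -[LHS]/(in_alg K _).
  by rewrite fmorph_div !rmorph_int.
rewrite absvM absvV !absv_int !ws -powR_inv1 ?powR_ge0 // powRAC.
rewrite -powRM ?powR_ge0 // powR_inv1 //; congr (_ `^ _).
rewrite -[in RHS](divq_num_den q) fmorph_div !rmorph_int normrM normfV -!intr_norm.
by rewrite -!pmulrn.
Qed.

(** Compares an absolute value known only on the integers with the embeddings: expand [x] in a
    rational basis and bound its coordinates by the conjugates. *)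
Lemma absv_conj_bound w s (tau : 'I_(\dim {:K}) -> {rmorphism K -> R[i]}) C :
  0 < s -> absv_arch w s -> 0 <= C ->
  (forall x i, `|ratr (coord (vbasis {:K}) i x)| <= C * \sum_j nc (tau j x)) ->
  exists2 D, 0 <= D & forall x, w x <= D * (\sum_j nc (tau j x)) `^ s.
Proof.
move=> s0 ws C0 tauC; pose e := vbasis {:K}.
exists (C `^ s * \sum_(i < \dim {:K}) w e`_i).
  by rewrite mulr_ge0 ?powR_ge0 // sumr_ge0 // => i _; exact: absv_ge0.
move=> x; rewrite [x in w x](coord_vbasis (memvf x)).
apply: le_trans (absv_sum _ _ _ _) _; rewrite mulrAC -mulrA mulr_sumr mulr_sumr.
apply: ler_sum => i _; rewrite -mulr_algl absvM (absv_rat _ ws).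
rewrite mulrA ler_wpM2r ?absv_ge0 // mulrC -powRM //.
  by rewrite mulrC; apply: powR_mono => //; exact: ltW.
by apply: sumr_ge0 => j _; exact: nc_ge0.
Qed.

End NumberFieldAbsv.

Section ArchimedeanPlaces.
Variables (R : realType) (K : fieldExtType rat) (sigma : {rmorphism K -> R[i]}).
Variables (theta : K) (genK : <<1%VS; theta>>%VS = fullv).
Implicit Types (w : absolute_value R K) (rho : {rmorphism K -> R[i]}).
Local Notation isint := (integralOver (intr : int -> K)).

(** An embedding is determined by its value at the generator [theta], so the condition says that
    [rho] is neither [sigma] nor its complex conjugate. *)
Definition away_from rho :=
  rho theta != sigma theta /\ rho theta != conjc (sigma theta).

Lemma nc_conj (z : R[i]) : nc (conjc z) = nc z.
Proof. by case: z => a b /=; rewrite sqrrN. Qed.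

Lemma nc_not_away rho : ~ away_from rho -> forall x, nc (rho x) = nc (sigma x).
Proof.
move=> /not_andP[] /negP; rewrite negbK => /eqP E x.
  by rewrite (rmorph_primitive_eq genK E).
have := @rmorph_primitive_eq R K theta rho (conjc \o sigma) genK E x.
by move=> ->; rewrite /= nc_conj.
Qed.

Section Dominated.
Variables (w : absolute_value R K) (s : R) (x : K).
Hypotheses (s0 : 0 < s) (ws : absv_arch w s) (wx1 : 1 < w x).
Hypothesis xaway : forall rho, away_from rho -> nc (rho x) <= 1.

Let r0 := nc (sigma x).

(* Multiplying by powers of x makes the conjugates away from sigma negligible.
   If w x were smaller than |sigma x|^s, this would apply to the values of the
   quadratic polynomials with rational coefficients close to those of the
   minimal polynomial of sigma (x ^ k) over R, on which w is bounded below. *)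
Lemma dominated_absv : forall y, w y = nc (sigma y) `^ s.
Proof.
have [tau [_ [C C0 tauC]]] := embeddings sigma genK.
have [D D0 wD] := absv_conj_bound s0 ws C0 tauC.
pose N y := \sum_j nc (tau j y); pose m : R := (\dim {:K})%:R.
have N0 y : 0 <= N y by apply: sumr_ge0 => j _; exact: nc_ge0.
have m0 : 0 <= m by [].
have r00 : 0 <= r0 := nc_ge0 _.
have s0' := ltW s0.
(* Conjugates of [x ^+ n * y] away from [sigma] are at most those of [y]; the others have the
   modulus of [sigma (x ^+ n * y)]. *)
have key n y : w x ^+ n * w y <= D * (m * (r0 ^+ n * nc (sigma y)) + N y) `^ s.
  rewrite -absvX -absvM (le_trans (wD _)) // ler_wpM2l // powR_mono //.
    by apply: sumr_ge0 => j _; exact: nc_ge0.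
  rewrite /m mulr_natl -[X in _ *+ X]card_ord -sumr_const -big_split.
  apply: ler_sum => j _ /=; rewrite rmorphM rmorphXn ncM ncX.
  have [aw|naw] := pselect (away_from (tau j)).
    rewrite -[leLHS]add0r lerD ?mulr_ge0 ?exprn_ge0 ?nc_ge0 //.
    by rewrite ler_piMl ?nc_ge0 // exprn_ile1 ?nc_ge0 // xaway.
  by rewrite !(nc_not_away naw) lerDl nc_ge0.
have wx0 : 0 < w x by apply: lt_trans wx1.
have r01 : 1 < r0.
  rewrite ltNge; apply/negP => r01; move: wx1; rewrite ltNge => /negP; apply.
  apply: (@le1_of_bounded_powers _ _ (D * (m + N 1) `^ s)); first exact: ltW.
  move=> n; have := key n 1; rewrite absv1 mulr1 rmorph1 nc1 mulr1 => H.
  apply: le_trans H _; rewrite ler_wpM2l // powR_mono ?addr_ge0 ?mulr_ge0 ?exprn_ge0 //.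
  by rewrite lerD2r ler_piMr // exprn_ile1.
have r0_gt0 : 0 < r0 by apply: lt_trans r01.
have p0 : 0 < r0 `^ s by rewrite powR_gt0.
have wxle : w x <= r0 `^ s.
  rewrite -[leRHS]mul1r -ler_pdivrMr //.
  apply: (@le1_of_bounded_powers _ _ (D * (m + N 1) `^ s)).
    by rewrite divr_ge0 // ltW.
  move=> n; rewrite exprMn exprVn ler_pdivrMr ?exprn_gt0 //.
  have := key n 1; rewrite absv1 mulr1 rmorph1 nc1 mulr1 => H.
  apply: le_trans H _; rewrite -mulrA ler_wpM2l // -powR_exp //.
  rewrite -powRM ?addr_ge0 ?exprn_ge0 // powR_mono ?addr_ge0 ?mulr_ge0 ?exprn_ge0 //.
  by rewrite mulrDl lerD2l ler_peMr // exprn_ege1 // ltW.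
have wxE : w x = r0 `^ s.
  apply/eqP; rewrite eq_le wxle /= leNgt; apply/negP => lt.
  (* Chosen so that [eps] times [3 ^ s + 1] is one half. The linear and quadratic terms of the
     polynomial then take at most half of [P ^+ 2], a lower bound for the value of its constant
     term. *)
  pose eps : R := (2 * (3 `^ s + 1))^-1.
  have e0 : 0 < eps by rewrite invr_gt0 mulr_gt0 // addr_gt0 ?powR_gt0.
  have e1 : eps <= 1.
    rewrite invf_le1 ?mulr_gt0 ?addr_gt0 ?powR_gt0 //.
    by have := powR_ge0 (3 : R) s; lra.
  have [k kE] : exists k, (w x / r0 `^ s) ^+ k < eps.
    by apply: expr_small => //; rewrite divr_ge0 ?ltr_pdivrMr ?mul1r // ltW.
  pose X := x ^+ k; pose z := sigma X; pose r := nc z.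
  have rE : r = r0 ^+ k by rewrite /r /z rmorphXn ncX.
  have r1 : 1 <= r by rewrite rE exprn_ege1 // ltW.
  have r_0 : 0 <= r by apply: le_trans r1.
  set P := r `^ s; have P0 : 0 < P by rewrite powR_gt0 // (lt_le_trans ltr01).
  have wX : w X <= eps * P.
    rewrite absvX /P rE powR_exp // -ler_pdivrMr ?exprn_gt0 //.
    by rewrite -exprVn -exprMn ltW.
  clear rE; clearbody X.
  pose M := \sum_j (nc (tau j X) ^+ 2 + 3 * r * nc (tau j X) + (r ^+ 2 + 1)).
  have quad eta : 0 < eta -> exists y,
      [/\ P ^+ 2 / 2 <= w y, N y <= M & nc (sigma y) <= eta].
    (* Errors below [eta / (r + 1)] in the trace and norm of [z] move the value at [z] by at most
       [eta]; errors below 1 keep the coefficients bounded, and so [N y] below [M], independently of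
       [eta]. *)
    move=> eta0; pose eta' := Num.min 1 (eta / (r + 1)).
    have r1_0 : 0 < r + 1 by rewrite ltr_wpDl.
    have eta'0 : 0 < eta' by rewrite lt_min ltr01 divr_gt0.
    have eta'1 : eta' <= 1 by rewrite ge_min lexx.
    have eta'2 : eta' * (r + 1) <= eta by rewrite -ler_pdivlMr // ge_min lexx orbT.
    have [a] : exists q : rat, ratr q \in `]2 * complex.Re z, 2 * complex.Re z + eta'[.
      by apply: rat_in_itvoo; rewrite ltrDl.
    rewrite in_itv /= => /andP[a_l a_u].
    have [b] : exists q : rat, ratr q \in `]r ^+ 2, r ^+ 2 + eta'[.
      by apply: rat_in_itvoo; rewrite ltrDl.
    rewrite in_itv /= => /andP[b_l b_u].
    have b0 : 0 < ratr b :> R by apply: le_lt_trans b_l; exact: sqr_ge0.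
    have aabs : `|ratr a : R| <= 3 * r.
      have := Re_le_nc z; rewrite -/r ler_norml => /andP[l u].
      by rewrite ler_norml; apply/andP; split; lra.
    exists (X ^+ 2 - a%:A * X + b%:A); split.
    - have : w b%:A <= w (X ^+ 2 - a%:A * X + b%:A) + w (a%:A * X) + w X ^+ 2.
        have -> : b%:A = (X ^+ 2 - a%:A * X + b%:A) + a%:A * X - X ^+ 2 by ring.
        rewrite (le_trans (absvD _ _ _)) // absvN absvX lerD2r.
        rewrite (le_trans (absvD _ _ _)) //.
        by have -> : X ^+ 2 - a%:A * X + ((X ^+ 2 - a%:A * X + b%:A) + a%:A * X - X ^+ 2)
          = X ^+ 2 - a%:A * X + b%:A by ring.
      rewrite (absv_rat b ws) absvM (absv_rat a ws) gtr0_norm // => H.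
      have Hb : P ^+ 2 <= ratr b `^ s.
        by rewrite /P -powR_exp // powR_mono // ?exprn_ge0 // ltW.
      have Ha : `|ratr a : R| `^ s * w X <= 3 `^ s * P * (eps * P).
        apply: ler_pM; rewrite ?powR_ge0 ?absv_ge0 //.
        by rewrite /P -powRM // powR_mono.
      have HX : w X ^+ 2 <= eps * P ^+ 2.
        apply: (@le_trans _ _ ((eps * P) ^+ 2)).
          by rewrite ler_sqr ?nnegrE ?absv_ge0 // mulr_ge0 // ltW.
        rewrite exprMn ler_wpM2r ?exprn_ge0 ?(ltW P0) // expr2 ler_piMl //.
        exact: ltW.
      have E : 3 `^ s * P * (eps * P) + eps * P ^+ 2 = P ^+ 2 / 2.
        have -> : 3 `^ s * P * (eps * P) + eps * P ^+ 2 = (3 `^ s + 1) * eps * P ^+ 2.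
          by ring.
        rewrite [RHS]mulrC; congr (_ * _); rewrite /eps.
        by field; rewrite gt_eqF // addr_gt0 // powR_gt0.
      by lra.
    - apply: ler_sum => j _; rewrite rmorphD rmorphB rmorphXn rmorphM !embed_rat.
      rewrite (le_trans (ncD _ _)) // lerD //; last first.
        by rewrite nc_rat gtr0_norm //; lra.
      rewrite (le_trans (ncB _ _)) // ncX ncM lerD2l nc_rat ler_wpM2r ?nc_ge0 //.
    rewrite rmorphD rmorphB rmorphXn rmorphM !embed_rat -/z.
    have -> : z ^+ 2 - ratr a * z + ratr b =
      real_complex R (2 * complex.Re z - ratr a) * z + real_complex R (ratr b - r ^+ 2).
      have : z ^+ 2 - real_complex R (2 * complex.Re z) * z + real_complex R (r ^+ 2) = 0.
        rewrite /r nc_sqr; case: (z) => u v; rewrite !expr2; apply/eqP.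
        by rewrite eq_complex /=; apply/andP; split; apply/eqP; ring.
      rewrite !rmorphB /= !fmorph_rat => zE; apply/eqP; rewrite -subr_eq0 -zE.
      by apply/eqP; ring.
    rewrite (le_trans (ncD _ _)) // ncM !nc_real -/r; apply: le_trans eta'2.
    rewrite mulrDr mulr1 lerD //.
      by rewrite ler_wpM2r // ler_norml; apply/andP; split; lra.
    by rewrite ler_norml; apply/andP; split; lra.
  move: wx1; rewrite ltNge => /negP; apply.
  have P2 : 0 < P ^+ 2 / 2 by rewrite divr_gt0 ?exprn_gt0.
  apply: (@le1_of_bounded_powers _ _ (D * (m + M) `^ s / (P ^+ 2 / 2))); first exact: ltW.
  (* The precision [r0 ^- n] cancels the growth of [sigma (x ^+ n)], so [key] bounds
     [w x ^+ n * w y] uniformly in [n], while [w y] stays at least [P ^+ 2 / 2]. *)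
  move=> n; have [|y [yP yN ys]] := quad (r0 ^- n); first by rewrite invr_gt0 exprn_gt0.
  rewrite ler_pdivlMr //; apply: (@le_trans _ _ (w x ^+ n * w y)).
    by rewrite ler_wpM2l // exprn_ge0 // ltW.
  apply: le_trans (key n y) _; rewrite ler_wpM2l // powR_mono //.
    by rewrite addr_ge0 // !mulr_ge0 ?exprn_ge0 ?nc_ge0.
  rewrite lerD // ler_piMr // -[leRHS](mulfV (x := r0 ^+ n)) ?gt_eqF ?exprn_gt0 //.
  by rewrite ler_wpM2l // exprn_ge0.
have nc0' y : y != 0 -> 0 < nc (sigma y).
  move=> y0; rewrite lt_neqAle nc_ge0 andbT eq_sym; apply: contra y0 => /eqP/nc_eq0/eqP.
  by rewrite fmorph_eq0.
(* For large [n] the term with [r0 ^+ n] in [key] dominates [N y], and by [wxE] the growth cancels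
   on both sides. *)
have bnd y : y != 0 -> w y <= D * (m + 1) `^ s * nc (sigma y) `^ s.
  move=> /nc0' y0; have [n nE] : exists n, r0^-1 ^+ n < nc (sigma y) / (N y + 1).
    apply: expr_small; first by rewrite invr_ge0 r00 invf_lt1.
    by rewrite divr_gt0 // ltr_wpDl.
  have Ny : N y <= r0 ^+ n * nc (sigma y).
    rewrite exprVn ltr_pdivlMr ?ltr_wpDl // mulrC ltr_pdivrMr ?exprn_gt0 // in nE.
    by apply: ltW; rewrite mulrC; apply: le_lt_trans nE; rewrite lerDl.
  have pn0 : 0 < w x ^+ n by rewrite exprn_gt0.
  rewrite -(ler_pM2l pn0); apply: le_trans (key n y) _.
  have -> : w x ^+ n * (D * (m + 1) `^ s * nc (sigma y) `^ s) =
      D * ((m + 1) `^ s * (w x ^+ n * nc (sigma y) `^ s)) by ring.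
  have r0n : 0 <= r0 ^+ n by rewrite exprn_ge0.
  rewrite ler_wpM2l // wxE -powR_exp // -powRM ?nc_ge0 //.
  have m1 : 0 <= m + 1 by rewrite addr_ge0.
  have r0y : 0 <= r0 ^+ n * nc (sigma y) by rewrite mulr_ge0 ?nc_ge0.
  rewrite -powRM //; apply: powR_mono => //.
    by rewrite addr_ge0 // mulr_ge0.
  by rewrite mulrDl mul1r lerD2l.
(* Applying [bnd] to the powers of [y] removes the constant. The inverse of [y] will give the
   opposite inequality. *)
have le y : y != 0 -> w y <= nc (sigma y) `^ s.
  move=> y0; have py : 0 < nc (sigma y) `^ s by rewrite powR_gt0 // nc0'.
  rewrite -[leRHS]mul1r -ler_pdivrMr //.
  apply: (@le1_of_bounded_powers _ _ (D * (m + 1) `^ s)).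
    by rewrite divr_ge0 ?absv_ge0 // ltW.
  move=> n; rewrite exprMn exprVn ler_pdivrMr ?exprn_gt0 // -absvX -powR_exp ?nc_ge0 //.
  by rewrite -ncX -rmorphXn bnd // expf_neq0.
move=> y; have [->|y0] := eqVneq y 0; first by rewrite absv0 rmorph0 nc0 powR0 // gt_eqF.
apply/eqP; rewrite eq_le le //=.
have := le y^-1; rewrite invr_eq0 => /(_ y0).
rewrite absvV fmorphV Normc.normcV.
have -> : (nc (sigma y))^-1 `^ s = (nc (sigma y) `^ s)^-1.
  by rewrite -(powR_inv1 (nc_ge0 _)) powRAC powR_inv1 ?powR_ge0.
by rewrite lef_pV2 // posrE ?absv_gt0 // powR_gt0 // nc0'.
Qed.

End Dominated.

End ArchimedeanPlaces.

Section OKv.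
Variables (R : realType) (K : fieldExtType rat) (sigma : {rmorphism K -> R[i]}).
Variables (theta : K) (genK : <<1%VS; theta>>%VS = fullv).
Implicit Types (w : absolute_value R K) (rho : {rmorphism K -> R[i]}).
Local Notation isint := (integralOver (intr : int -> K)).

Lemma embedding_nontrivial rho : exists2 x : K, x != 0 & nc (rho x) != 1.
Proof.
have two : nc (rho 2%:R) = 2 by rewrite rmorph_nat -(ratr_nat _ 2) nc_rat ratr_nat normr_nat.
exists 2%:R; last by rewrite two; apply/eqP; lra.
by apply/eqP => /(congr1 (fun x => nc (rho x))); rewrite two rmorph0 nc0; lra.
Qed.

Lemma embedding_eq0 rho (x : K) : nc (rho x) = 0 <-> x = 0.
Proof.
split=> [/nc_eq0/eqP|->]; last by rewrite rmorph0 nc0.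
by rewrite fmorph_eq0 => /eqP.
Qed.

Definition absv_of rho : absolute_value R K :=
  @AbsoluteValue R K (fun x => nc (rho x)) (fun x => nc_ge0 _)
    (embedding_eq0 rho)
    (fun x y => etrans (congr1 (@Normc.normc R) (rmorphM rho x y)) (ncM _ _))
    (fun x y => eq_ind_r (fun z => nc z <= _) (ncD _ _) (rmorphD rho x y))
    (embedding_nontrivial rho).

Lemma absv_of_archimedean rho : archimedean_place (absv_of rho).
Proof.
move=> /(_ 1 1) /=; rewrite rmorphD rmorph1 nc1 maxxx.
have -> : 1 + 1 = ratr 2%:R :> R[i] by rewrite ratr_nat.
by rewrite nc_rat ratr_nat normr_nat; lra.
Qed.

Lemma absv_of_induces rho : induces rho (absv_of rho).
Proof. by exists 1 => // x; rewrite powRr1 ?nc_ge0. Qed.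

(** The value at 2 forces the exponent to be 1. Equal moduli at [theta] and at [theta + 1] then give
    equal real parts, and imaginary parts equal up to sign. *)
Lemma away_not_equiv rho : away_from sigma theta rho ->
  ~ absv_equiv (absv_of rho) (absv_of sigma).
Proof.
move=> [/eqP ns /eqP nc_s] [s s0 E].
have two (q : rat) (f : {rmorphism K -> R[i]}) : nc (f q%:A) = `|ratr q|.
  by rewrite embed_rat nc_rat.
have s1 : s = 1.
  have := E 2%:R%:A; rewrite /= !two ratr_nat normr_nat => /(congr1 (@ln R)).
  rewrite ln_powR => /eqP; rewrite -{1}[ln 2]mul1r (inj_eq (mulIf _)).
    by move/eqP.
  by rewrite gt_eqF // ln_gt0 // ltr1n.
have {}E x : nc (rho x) = nc (sigma x) by have := E x; rewrite /= s1 powRr1 ?nc_ge0.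
have Re_eq : complex.Re (rho theta) = complex.Re (sigma theta).
  have := congr1 (fun a => a ^+ 2) (E (theta + 1)); have := congr1 (fun a => a ^+ 2) (E theta).
  rewrite !nc_sqr !rmorphD !rmorph1 !raddfD /= !addr0.
  by move=> H1 H2; lra.
have : (complex.Im (rho theta) - complex.Im (sigma theta)) *
    (complex.Im (rho theta) + complex.Im (sigma theta)) == 0.
  have := congr1 (fun a => a ^+ 2) (E theta); rewrite !nc_sqr Re_eq => H.
  by apply/eqP; rewrite -subr_sqr; lra.
rewrite mulf_eq0 subr_eq0 addr_eq0 => /orP[/eqP H|/eqP H].
  by apply: ns; apply/eqP; rewrite eq_complex Re_eq H !eqxx.
apply: nc_s; apply/eqP; rewrite eq_complex.
by case: (rho theta) (sigma theta) Re_eq H => a b [c d] /= -> ->; rewrite !eqxx.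
Qed.

Lemma OKv_away x rho : OKv (absv_of sigma) x -> away_from sigma theta rho -> nc (rho x) <= 1.
Proof. by move=> xO /away_not_equiv; exact: (xO (absv_of rho)). Qed.

(** By integrality, a place with [w x > 1] is unbounded on the natural numbers, so it follows a
    power law there, and [dominated_absv] identifies it with the place of [sigma]. *)
Lemma OKv_of_integral x : isint x ->
  (forall rho, away_from sigma theta rho -> nc (rho x) <= 1) -> OKv (absv_of sigma) x.
Proof.
move=> ix xaway w neq; have [wn|[s s0 ws]] := absv_ostrowski w.
  exact: absv_integral.
rewrite leNgt; apply/negP => wx; apply: neq; exists s => //.
exact: (dominated_absv genK s0 ws wx xaway).
Qed.

End OKv.

(** * Valuations at nonintegral elements *)

Section ValuationRing.
Variable K : fieldType.

Definition subring_set (V : set K) :=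
  [/\ V 1, forall a b, V a -> V b -> V (a - b) &
    forall a b, V a -> V b -> V (a * b)].

Section SubringTheory.
Variable V : set K.
Hypothesis subV : subring_set V.

Lemma subring0 : V 0.
Proof. by have [V1 VB _] := subV; rewrite -(subrr 1); exact: VB. Qed.

Lemma subringN a : V a -> V (- a).
Proof. by have [_ VB _] := subV; rewrite -sub0r => /(VB _ _ subring0). Qed.

Lemma subringD a b : V a -> V b -> V (a + b).
Proof.
by have [_ VB _] := subV; move=> Va /subringN Vb; rewrite -[b]opprK; exact: VB.
Qed.

Lemma subringX a n : V a -> V (a ^+ n).
Proof.
have [V1 _ VM] := subV; move=> Va; elim: n => // n IHn.
by rewrite exprS; exact: VM.
Qed.

Lemma subring_sum (I : Type) (r : seq I) (P : pred I) (F : I -> K) :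
  (forall i, P i -> V (F i)) -> V (\sum_(i <- r | P i) F i).
Proof. by move=> VF; elim/big_ind: _ => //; [exact: subring0 | exact: subringD]. Qed.

Lemma subring_nat n : V n%:R.
Proof.
elim: n => [|n IHn]; first exact: subring0.
by rewrite -natr1; apply: subringD => //; case: subV.
Qed.

Lemma subring_int (z : int) : V z%:~R.
Proof. by case: z => n; [exact: subring_nat | exact/subringN/subring_nat]. Qed.

Definition adjoin_set (z : K) : set K :=
  [set u | exists2 p : {poly K}, forall i, V p`_i & u = p.[z]].

Lemma adjoin_subring z : subring_set (adjoin_set z).
Proof.
have [V1 VB VM] := subV; split.
- exists 1; last by rewrite hornerC.
  by move=> i; rewrite coef1; case: eqP => _ //; exact: subring0.
- move=> _ _ [p Vp ->] [q Vq ->]; exists (p - q); last by rewrite hornerD hornerN.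
  by move=> i; rewrite coefB; exact: VB.
- move=> _ _ [p Vp ->] [q Vq ->]; exists (p * q); last by rewrite hornerM.
  by move=> i; rewrite coefM; apply: subring_sum => j _; exact: VM.
Qed.

Lemma sub_adjoin_set z : V `<=` adjoin_set z.
Proof.
move=> a Va; exists a%:P; last by rewrite hornerC.
by move=> i; rewrite coefC; case: eqP => _ //; exact: subring0.
Qed.

Lemma mem_adjoin_set z : adjoin_set z z.
Proof.
exists 'X; last by rewrite hornerX.
move=> i; rewrite coefX; case: eqP => _; last exact: subring0.
by case: subV.
Qed.

End SubringTheory.

Variables (V : set K) (x : K).
Hypotheses (subV : subring_set V) (x0 : x != 0) (Vy : V x^-1) (nVx : ~ V x).
Hypothesis maxV : forall W, subring_set W -> V `<=` W -> ~ W x -> W `<=` V.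

Let V0 := subring0 subV.
Let V1 : V 1. Proof. by case: subV. Qed.
Let VB a b : V a -> V b -> V (a - b). Proof. by case: subV => _ + _; apply. Qed.
Let VM a b : V a -> V b -> V (a * b). Proof. by case: subV => _ _; apply. Qed.

Lemma adjoin_max z : ~ V z -> adjoin_set V z x.
Proof.
move=> nVz; apply: contrapT => nx; apply: nVz.
apply: (maxV (adjoin_subring subV z) _ nx); last exact: mem_adjoin_set.
exact: sub_adjoin_set.
Qed.

(** Put [u = 1 - x^-1 * a]. If its inverse were outside [V], maximality would make [x] a polynomial
    in that inverse, and [x * u ^+ n] would lie in [V] for large [n]. But [u ^+ n] is 1 up to an
    element of [x^-1 * V], so [x] itself would lie in [V]. *)
Lemma valuation_unit a : V a -> V (1 - x^-1 * a)^-1.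
Proof.
move=> Va; apply: contrapT => /adjoin_max[p Vp xE].
set u := 1 - x^-1 * a in xE.
have Vu : V u by apply: VB => //; exact: VM.
have [u0|u0] := eqVneq u 0.
  apply: nVx; have : x^-1 * a = 1 by apply/eqP; rewrite eq_sym -subr_eq0 -/u u0.
  by move=> /(congr1 (fun t => x * t)); rewrite mulVKf // mulr1 => <-.
have un n : exists2 b, V b & u ^+ n = 1 - x^-1 * b.
  elim: n => [|n [b Vb E]]; first by exists 0; rewrite ?mulr0 ?subr0.
  exists (a + b - x^-1 * a * b).
    by apply: VB; [exact: subringD | exact/VM/Vb/VM].
  by rewrite exprS E /u; ring.
have [b Vb E] := un (size p).
apply: nVx; have -> : x = b + x * u ^+ size p.
    by rewrite E mulrBr mulr1 mulrA mulfV // mul1r addrC subrK.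
apply: subringD => //; rewrite {1}xE horner_coef mulr_suml; apply: subring_sum => // i _.
rewrite -mulrA; apply: VM => //.
have -> : u^-1 ^+ i * u ^+ size p = u ^+ (size p - i).
  by rewrite exprVn mulrC -expfB_cond // (negbTE u0) add0n ltnW.
exact: subringX.
Qed.

(** Multiplying [x = q(z^-1)] by [x^-1 * z ^+ m] gives [z ^+ m] the coefficient [1 - x^-1 * q_0]
    once its terms are collected. This is a unit of [V], so [z ^+ m] is a combination [r] of lower
    powers, which replaces it in the leading term of [p]. *)
Lemma valuation_reduce z (p q : {poly K}) : z != 0 ->
  (forall i, V p`_i) -> (forall i, V q`_i) -> x = p.[z] -> x = q.[z^-1] ->
  (1 < size q <= size p)%N ->
  exists2 p' : {poly K}, (forall i, V p'`_i) /\ x = p'.[z] & (size p' < size p)%N.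
Proof.
move=> z0 Vp Vq xp xq /andP[q1 qp].
set n := (size p).-1; set m := (size q).-1.
have sp : size p = n.+1 by rewrite prednK // (leq_trans _ qp) // ltnW.
have sq : size q = m.+1 by rewrite prednK // ltnW.
have m0 : (0 < m)%N by rewrite -ltnS -sq.
have mn : (m <= n)%N by rewrite -ltnS -sp -sq.
pose v := (1 - x^-1 * q`_0)^-1.
have Vv : V v by exact: valuation_unit.
pose r : {poly K} := \poly_(k < m) (x^-1 * v * q`_(m - k)).
have Vr i : V r`_i.
  by rewrite coef_poly; case: ifP => // _; apply: VM => //; exact: VM.
have rz : r.[z] = z ^+ m.
  rewrite horner_poly; have u0 : 1 - x^-1 * q`_0 != 0.
    apply/eqP => E; apply: nVx; have : x^-1 * q`_0 = 1.
      by apply/eqP; rewrite eq_sym -subr_eq0 E.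
    by move=> /(congr1 (fun t => x * t)); rewrite mulVKf // mulr1 => <-.
  apply: (mulfI u0); rewrite mulr_sumr mulrBl mul1r.
  have xq' : x = q`_0 + \sum_(i < m) q`_i.+1 * z^-1 ^+ i.+1.
    by rewrite {1}xq horner_coef sq big_ord_recl expr0 mulr1.
  have E : x^-1 * q`_0 * z ^+ m +
      x^-1 * ((\sum_(i < m) q`_i.+1 * z^-1 ^+ i.+1) * z ^+ m) = z ^+ m.
    by rewrite -mulrA -mulrDr -mulrDl -xq' mulKf.
  have -> : z ^+ m - x^-1 * q`_0 * z ^+ m =
      x^-1 * ((\sum_(i < m) q`_i.+1 * z^-1 ^+ i.+1) * z ^+ m).
    by rewrite -[X in X - _]E addrC addKr.
  rewrite mulr_suml mulr_sumr (reindex_inj rev_ord_inj) /=.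
  apply: eq_bigr => i _; rewrite subKn //.
  have -> : z ^+ m = z ^+ i.+1 * z ^+ (m - i.+1) by rewrite -exprD subnKC.
  rewrite -!mulrA [z^-1 ^+ _ * _]mulrA exprVn mulVf ?expf_neq0 // mul1r /v.
  by rewrite [_ * (x^-1 * _)]mulrCA mulVKf.
pose p' := \poly_(i < n) p`_i + p`_n *: ('X^(n - m) * r).
exists p'; first split.
- move=> i; rewrite coefD coefZ coefXnM coef_poly; apply: subringD => //.
    by case: ifP.
  by apply: VM => //; case: ifP.
- rewrite /p' hornerD hornerZ hornerM hornerXn rz -exprD subnK // xp.
  by rewrite horner_poly horner_coef sp big_ord_recr.
rewrite sp ltnS (leq_trans (size_polyD _ _)) // geq_max size_poly /=.
rewrite (leq_trans (size_scale_leq _ _)) // (leq_trans (size_polyMleq _ _)) //.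
rewrite size_polyXn /= (leq_trans (leq_add (leqnn _) (size_poly _ _))) //.
by rewrite subnK.
Qed.

(** Otherwise [x] is a polynomial over [V] both in [z] and in [z^-1], and the longer of the two
    expressions could be shortened forever. *)
Lemma valuation_ring z : z != 0 -> V z \/ V z^-1.
Proof.
move=> z0; have [Vz|nVz] := pselect (V z); first by left.
right; apply: contrapT => nVz'.
have [p Vp xp] := adjoin_max nVz; have [q Vq xq] := adjoin_max nVz'.
have [N] := ubnP (size p + size q).
elim: N z z0 nVz nVz' p Vp xp q Vq xq => // N IHN z z0 nVz nVz' p Vp xp q Vq xq.
rewrite ltnS => lt.
have large (t : K) (s : {poly K}) : (forall i, V s`_i) -> x = s.[t] -> (1 < size s)%N.
  move=> Vs xs; rewrite ltnNge; apply/negP => /size1_polyC sE.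
  by apply: nVx; rewrite xs sE hornerC.
have [qp|pq] := leqP (size q) (size p).
  have [|p' [Vp' xp'] sp'] := valuation_reduce z0 Vp Vq xp xq.
    by rewrite qp (large _ _ Vq xq).
  by apply: (IHN z z0 nVz nVz' p' Vp' xp' q Vq xq); lia.
have zz : x = p.[z^-1^-1] by rewrite invrK.
have [||q' [Vq' xq'] sq'] := valuation_reduce _ Vq Vp xq zz.
- by rewrite invr_eq0.
- by apply/andP; split; [exact: (large _ _ Vp xp) | exact: ltnW].
by apply: (IHN z z0 nVz nVz' p Vp xp q' Vq' xq'); lia.
Qed.

Definition nonunit u := V u /\ ~ exists2 v, V v & u * v = 1.

Lemma nonunitM u v : nonunit u -> V v -> nonunit (u * v).
Proof.
move=> [Vu nu] Vv; split; first exact: VM.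
by move=> [t Vt E]; apply: nu; exists (v * t); rewrite ?mulrA //; exact: VM.
Qed.

Lemma nonunitD u v : nonunit u -> nonunit v -> nonunit (u + v).
Proof.
move=> Mu Mv; have [->|u0] := eqVneq u 0; first by rewrite add0r.
have [->|v0] := eqVneq v 0; first by rewrite addr0.
have [H|H] := @valuation_ring (v / u) ltac:(by rewrite mulf_neq0 ?invr_eq0).
  have -> : u + v = u * (1 + v / u) by rewrite mulrDr mulr1 mulrC divfK // addrC.
  by apply: nonunitM => //; exact: subringD.
have -> : u + v = v * (1 + (v / u)^-1) by rewrite invf_div mulrDr mulr1 mulrC divfK // addrC.
by apply: nonunitM => //; exact: subringD.
Qed.

Lemma nonunitN u : nonunit u -> nonunit (- u).
Proof. by move=> Mu; rewrite -mulrN1; apply: nonunitM => //; exact: subringN. Qed.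

Lemma nonunit_y : nonunit x^-1.
Proof.
split=> // -[v Vv E]; apply: nVx.
by move: E => /(congr1 (fun t => x * t)); rewrite mulVKf // mulr1 => <-.
Qed.

End ValuationRing.

(** Zorn's lemma starting from the subring generated by [x^-1]. It does not contain [x], since an
    equation [x = p(x^-1)] multiplied by a power of [x] becomes monic and integral. *)
Lemma exists_maximal_subring (K : fieldType) (x : K) : x != 0 ->
  ~ integralOver (intr : int -> K) x ->
  exists V : set K, [/\ subring_set V, V x^-1, ~ V x &
    forall W, subring_set W -> V `<=` W -> ~ W x -> W `<=` V].
Proof.
move=> x0 nix; set y := x^-1.
pose good V := [/\ subring_set V, V y & ~ V x].
pose V0 : set K := [set u | exists p : {poly int}, u = (map_poly intr p).[y]].
have goodV0 : good V0.
  split.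
  - split; first by exists 1; rewrite rmorph1 hornerC.
      by move=> _ _ [p ->] [q ->]; exists (p - q); rewrite rmorphB hornerD hornerN.
    by move=> _ _ [p ->] [q ->]; exists (p * q); rewrite rmorphM hornerM.
  - by exists 'X; rewrite map_polyX hornerX.
  move=> [p xE]; apply: nix; pose n := size p.
  pose P : {poly int} := 'X^(n.+1) - \poly_(j < n.+1) p`_(n - j).
  exists P.
    rewrite /P monicE lead_coefDl ?lead_coefXn // size_polyN size_polyXn ltnS.
    exact: size_poly.
  rewrite /root /P rmorphB /= map_polyXn hornerD hornerN hornerXn subr_eq0; apply/eqP.
  have -> : map_poly (intr : int -> K) (\poly_(j < n.+1) p`_(n - j)) =
      \poly_(j < n.+1) (p`_(n - j))%:~R.
    by apply/polyP => i; rewrite coef_map !coef_poly /=; case: ifP.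
  rewrite exprSr {2}xE horner_poly (horner_coef_wide (n := n.+1)); last first.
    by rewrite ltnW // ltnS size_poly.
  rewrite mulr_sumr (reindex_inj rev_ord_inj) /=; apply: eq_bigr => i _.
  rewrite subSS coef_map /= mulrCA; congr (_ * _).
  have iN : (i <= n)%N by rewrite -ltnS.
  rewrite -[n in x ^+ n](subnK iN) addnC exprD exprVn -mulrA mulfV ?mulr1 //.
  by rewrite expf_neq0.
have [|V [[VE|goodV] maxV]] := @Zorn_bigcup K [set V | V = set0 \/ good V].
- move=> F FP totF.
  have [[U FU goodU]|no] := pselect (exists2 U, F U & good U); last first.
    left; rewrite -subset0 => a [U FU Ua]; case: (FP U FU) => [UE|gU].
      by rewrite UE in Ua.
    by case: no; exists U.
  right; have [[U1 UB UM] Uy nUx] := goodU.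
  have pick2 a b : (\bigcup_(X in F) X) a -> (\bigcup_(X in F) X) b ->
      exists W, [/\ F W, good W, W a & W b].
    move=> [A FA Aa] [B FB Bb]; have [AB|BA] := totF A B FA FB.
      by exists B; split=> //; [case: (FP B FB) => // BE; rewrite BE in Bb | exact: AB].
    by exists A; split=> //; [case: (FP A FA) => // AE; rewrite AE in Aa | exact: BA].
  split; first split.
  - by exists U.
  - move=> a b /pick2 H /H[W [FW [[W1 WB WM] _ _] Wa Wb]].
    by exists W => //; exact: WB.
  - move=> a b /pick2 H /H[W [FW [[W1 WB WM] _ _] Wa Wb]].
    by exists W => //; exact: WM.
  - by exists U.
  by move=> [W FW Wx]; case: (FP W FW) => [WE|[_ _ //]]; rewrite WE in Wx.
- case: (maxV V0); last by right.
  rewrite VE; split; first exact: sub0set.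
  by move=> /(_ 1); apply; have [[]] := goodV0.
have [subV Vy nVx] := goodV; exists V; split=> // W subW VW nWx.
apply: contrapT => nWV; apply: (maxV W); first by split.
by right; split=> //; exact: VW.
Qed.

Section RankOneValuation.
Variables (R : realType) (K : fieldExtType rat) (V : set K) (x : K).
Hypotheses (subV : subring_set V) (x0 : x != 0) (Vy : V x^-1) (nVx : ~ V x).
Hypothesis maxV : forall W, subring_set W -> V `<=` W -> ~ W x -> W `<=` V.

Let V0 := subring0 subV.
Let V1 : V 1. Proof. by case: subV. Qed.
Let VM a b : V a -> V b -> V (a * b). Proof. by case: subV => _ _; apply. Qed.
Let val z : z != 0 -> V z \/ V z^-1.
Proof. exact: valuation_ring subV x0 Vy nVx maxV z. Qed.
Let MM u v : nonunit V u -> V v -> nonunit V (u * v).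
Proof. exact: nonunitM subV u v. Qed.
Let MD u v : nonunit V u -> nonunit V v -> nonunit V (u + v).
Proof. exact: nonunitD subV x0 Vy nVx maxV u v. Qed.
Let My : nonunit V x^-1. Proof. exact: nonunit_y x0 Vy nVx. Qed.

Lemma not_nonunit u : V u -> ~ nonunit V u -> exists2 v, V v & u * v = 1.
Proof. by move=> Vu nM; apply: contrapT => ?; apply: nM. Qed.

Lemma nonunit1 : ~ nonunit V 1.
Proof. by move=> [_]; apply; exists 1; rewrite ?mulr1. Qed.

Lemma nonunit0 : nonunit V 0.
Proof. by split=> // -[v _]; rewrite mul0r => /esym/eqP; rewrite oner_eq0. Qed.

(** A primitive integral polynomial vanishing at [x], divided by a power of [x]. In terms of [x^-1]
    the relation takes place inside [V]. *)
Lemma primitive_relation : exists d (a : nat -> int),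
  [/\ a d != 0, \sum_(i < d.+1) (a i)%:~R * x^-1 ^+ (d - i) = 0 &
   forall p : nat, (1 < p)%N -> exists i : 'I_d.+1, ~~ (p%:Z %| a i)%Z].
Proof.
have [q qE q_monic] := minPoly_rat x.
have [f [c c0 fE]] := rat_poly_scale q.
have f0 : f != 0.
  by apply: contraNneq (monic_neq0 q_monic) => fz; rewrite fE fz rmorph0 scaler0.
have fx : (map_poly (intr : int -> K) f).[x] = 0.
  have := minPolyxx 1%AS x; rewrite qE fE linearZ /= hornerZ => /eqP.
  rewrite mulf_eq0 scaler_eq0 oner_eq0 orbF invr_eq0 intr_eq0 (negbTE c0) /=.
  rewrite -map_poly_comp => /eqP E; rewrite -[RHS]E; congr _.[_].
  by apply: eq_map_poly => e /=; rewrite scaler_int.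
set g := zprimitive f; have g0 : g != 0 by rewrite zprimitive_eq0.
have gx : (map_poly (intr : int -> K) g).[x] = 0.
  have : (map_poly (intr : int -> K) (zcontents f *: g)).[x] = 0 by rewrite -zpolyEprim.
  rewrite map_polyZ hornerZ => /eqP; rewrite mulf_eq0 intr_alg_eq0 zcontents_eq0.
  by rewrite (negbTE f0) => /eqP.
have sg : size g = (size g).-1.+1 by rewrite prednK // size_poly_gt0.
exists (size g).-1, (fun i => g`_i); split.
- by rewrite -lead_coefE lead_coef_eq0.
- apply: (mulIf (expf_neq0 (size g).-1 x0)); rewrite mul0r -[RHS]gx mulr_suml.
  rewrite (horner_coef_wide (n := (size g).-1.+1)); last by rewrite -sg size_poly.
  apply: eq_bigr => i _; rewrite coef_map /= -mulrA; congr (_ * _).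
  have iN : (i <= (size g).-1)%N by rewrite -ltnS.
  have -> : x ^+ (size g).-1 = x ^+ ((size g).-1 - i) * x ^+ i.
    by rewrite -exprD subnK.
  by rewrite mulrA -exprMn mulVf // expr1n mul1r.
move=> p p1; apply: contrapT => no.
have : (p%:Z %| zcontents g)%Z.
  rewrite dvdz_contents; apply/polyOverP => i.
  have [ilt|ige] := ltnP i (size g).-1.+1; last first.
    by rewrite nth_default ?dvdz0 // sg.
  apply: contrapT => /negP ndv; apply: no; exists (Ordinal ilt) => //.
rewrite zcontents_primitive f0 dvdz1 /= => /eqP pE.
by rewrite pE in p1.
Qed.

(** The relation makes [a d] a nonunit, being a multiple of [x^-1], so some positive integer is a
    nonunit. The least one divides every integer that is a nonunit, by division with remainder. *)
Lemma exists_residue_characteristic : exists p : nat,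
  [/\ (1 < p)%N, nonunit V p%:R &
   forall z : int, nonunit V z%:~R -> (p%:Z %| z)%Z].
Proof.
have [d [a [ad0 aE _]]] := primitive_relation.
have Mad : nonunit V (a d)%:~R.
  have [d0|d0] := posnP d.
    move: aE; rewrite d0 big_ord_recl big_ord0 addr0 subnn mulr1 => ->.
    exact: nonunit0.
  move: aE; rewrite big_ord_recr /= subnn mulr1 addrC => /eqP; rewrite addr_eq0 => /eqP ->.
  have -> : - \sum_(i < d) (a i)%:~R * x^-1 ^+ (d - i) =
      x^-1 * (- \sum_(i < d) (a i)%:~R * x^-1 ^+ (d - i.+1)).
    rewrite mulrN mulr_sumr; congr (- _); apply: eq_bigr => i _.
    by rewrite mulrCA -exprS subnSK.
  apply: MM => //; apply: subringN => //; apply: subring_sum => // i _.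
  by apply: VM; [exact: subring_int | exact: subringX].
pose Q (n : nat) := `[< (0 < n)%N /\ nonunit V n%:R >].
have exQ : exists n, Q n.
  exists `|a d|%N; apply/asboolP; split; first by rewrite absz_gt0.
  have [ap|an] := lerP 0 (a d).
    by have -> : `|a d|%N%:R = (a d)%:~R :> K by rewrite -{2}(gez0_abs ap).
  have -> : `|a d|%N%:R = - (a d)%:~R :> K.
    by rewrite -{2}(opprK (a d)) -(ltz0_abs an) rmorphN opprK.
  exact: nonunitN.
case: (ex_minnP exQ) => p /asboolP[p0 Mp] pmin; exists p.
have p1 : (1 < p)%N by case: p p0 Mp {pmin} => [//|[|//]] _ /nonunit1.
split=> // z Mz; apply: contrapT => /negP ndv.
have pz0 : p%:Z != 0 by rewrite eqz_nat gtn_eqF.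
pose r := (z %% p%:Z)%Z; have r0 : 0 <= r by rewrite modz_ge0.
have rp : r < p%:Z by have := ltz_mod z pz0; rewrite -/r gtr0_norm ?ltz_nat.
have Mr : nonunit V r%:~R.
  have -> : r%:~R = z%:~R - p%:R * (z %/ p%:Z)%Z%:~R :> K.
    have E : z%:~R = (z %/ p%:Z)%Z%:~R * p%:R + r%:~R :> K.
      by rewrite {1}(divz_eq z p%:Z) intrD intrM.
    by rewrite E mulrC addrC addKr.
  apply: MD => //; apply: nonunitN => //; apply: MM => //; exact: subring_int.
have : (p <= `|r|)%N.
  apply: pmin; apply/asboolP; split.
    by rewrite absz_gt0; apply: contra ndv => /eqP rE; apply/dvdz_mod0P.
  by have -> : `|r|%N%:R = r%:~R :> K by rewrite -{2}(gez0_abs r0).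
by rewrite leqNgt -ltz_nat gez0_abs // rp.
Qed.

Variable p : nat.
Hypotheses (p1 : (1 < p)%N) (Mp : nonunit V p%:R).
Hypothesis pP : forall z : int, nonunit V z%:~R -> (p%:Z %| z)%Z.

Let p0 : p%:R != 0 :> K.
Proof. by rewrite (_ : p%:R = p%:Z%:~R) // intr_alg_eq0 eqz_nat gtn_eqF // ltnW. Qed.

(** If [z^-1] lies in [V], multiplying the integral expression of [z ^+ D] by a power of [z^-1] puts
    [z] in [V]. *)
Lemma integral_valuation z : integralOver (intr : int -> K) z -> V z.
Proof.
have [->|z0] := eqVneq z 0; first by [].
move=> /integral_powers[D powz]; have [//|Vz'] := val z0.
have [c cE] := powz D; have [D0|D0] := posnP D.
  have [c' ] := powz 0%N; rewrite big1 ?expr0; last by case=> l ll _; exfalso; rewrite D0 in ll.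
  by move=> /eqP; rewrite oner_eq0.
have -> : z = z^-1 ^+ D.-1 * z ^+ D.
  by rewrite -{2}(prednK D0) exprSr mulrA -exprMn mulVf // expr1n mul1r.
rewrite cE mulr_sumr; apply: subring_sum => // i _; rewrite mulrCA.
apply: VM; first exact: subring_int.
have iD : (i <= D.-1)%N by rewrite -ltnS prednK.
have -> : z^-1 ^+ D.-1 = z^-1 ^+ (D.-1 - i) * z^-1 ^+ i by rewrite -exprD subnK.
rewrite -mulrA -exprMn mulVf // expr1n mulr1.
exact: subringX.
Qed.

(** An integral multiple [c * z] exists, and the part of [c] prime to [p] is a unit of [V]. Hence
    every element can be compared with powers of [p], which is what makes the valuation
    real-valued. *)
Lemma archimedean_valuation z : exists k : nat, V (p%:R ^+ k * z).
Proof.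
have [c c0 /integral_valuation] := integral_multiple z.
have [n] := ubnP c; elim: n c c0 z => // n IHn c c0 z cn Vcz.
have [/dvdnP[c1 cE]|ndv] := boolP (p %| c)%N; last first.
  have [v Vv cv] : exists2 v, V v & c%:R * v = 1.
    apply: not_nonunit; first exact: subring_nat.
    by move=> /(pP (z := c%:Z)); rewrite dvdzE /= (negbTE ndv).
  exists 0%N; rewrite expr0 mul1r -[z]mul1r -cv mulrAC; exact: VM.
have c10 : (0 < c1)%N by move: c0; rewrite cE muln_gt0 => /andP[].
have [||k Vk] := IHn c1 c10 (p%:R * z).
- by rewrite -ltnS; apply: leq_trans cn; rewrite ltnS cE ltn_Pmulr.
- by rewrite mulrA -natrM -cE.
by exists k.+1; rewrite exprSr -mulrA.
Qed.

(** The normalisation gives [p] absolute value [expR (-1)], so that membership of [z ^ b * p ^ a] in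
    [V] reads [|z| <= expR (a / b)]. The infimum of these bounds avoids constructing a value
    group. *)
Definition valuation_bounds (z : K) : set R :=
  [set r | exists (a : int) (b : nat),
    [/\ (0 < b)%N, r = expR (a%:~R / b%:R) & V (z ^+ b * p%:R ^ a)]].

Definition valuation_abs (z : K) : R :=
  if z == 0 then 0 else inf (valuation_bounds z).
Let w := valuation_abs.

Lemma valuation_bounds_gt0 z r : valuation_bounds z r -> 0 < r.
Proof. by move=> [a [b [_ -> _]]]; exact: expR_gt0. Qed.

Lemma valuation_abs_le z r : z != 0 -> valuation_bounds z r -> w z <= r.
Proof.
rewrite /w /valuation_abs => /negbTE -> zr; apply: ge_inf => //.
by exists 0 => s /valuation_bounds_gt0/ltW.
Qed.

Lemma valuation_abs_ge z c : z != 0 ->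
  (forall r, valuation_bounds z r -> c <= r) -> c <= w z.
Proof.
rewrite /w /valuation_abs => /negbTE -> zc; apply: lb_le_inf => //.
have [k Vk] := archimedean_valuation z.
by exists (expR (k%:Z%:~R / 1%:R)), k%:Z, 1%N; split=> //; rewrite expr1 mulrC.
Qed.

Lemma valuation_abs_ge0 z : 0 <= w z.
Proof.
have [->|z0] := eqVneq z 0; first by rewrite /w /valuation_abs eqxx.
by apply: valuation_abs_ge => // r /valuation_bounds_gt0/ltW.
Qed.

Lemma valuation_absM_le z t : w (z * t) <= w z * w t.
Proof.
have [->|z0] := eqVneq z 0; first by rewrite mul0r /w /valuation_abs eqxx mul0r.
have [->|t0] := eqVneq t 0; first by rewrite mulr0 /w /valuation_abs eqxx mulr0.
have prod r s : valuation_bounds z r -> valuation_bounds t s -> w (z * t) <= r * s.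
  move=> [a [b [b0 -> Va]]] [c [d [d0 -> Vc]]].
  apply: valuation_abs_le; first by rewrite mulf_neq0.
  exists (a * d%:Z + c * b%:Z), (b * d)%N; split.
  - by rewrite muln_gt0 b0.
  - rewrite -expRD; congr expR; rewrite rmorphD !rmorphM /= -!pmulrn.
    by field; rewrite !pnatr_eq0 !gtn_eqF.
  - have -> : (z * t) ^+ (b * d) * p%:R ^ (a * d%:Z + c * b%:Z) =
      (z ^+ b * p%:R ^ a) ^+ d * (t ^+ d * p%:R ^ c) ^+ b.
      have -> : (z * t) ^+ (b * d) = (z ^+ b) ^+ d * (t ^+ d) ^+ b.
        by rewrite exprMn exprM mulnC exprM.
      rewrite expfzDr // !exprMn mulrACA; congr (_ * _ * (_ * _)).
        by rewrite -exprz_exp.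
      by rewrite -exprz_exp.
    by apply: VM; exact: subringX.
have le1 s : valuation_bounds t s -> w (z * t) <= w z * s.
  move=> ts; have s0 := valuation_bounds_gt0 ts; rewrite -ler_pdivrMr //.
  by apply: valuation_abs_ge => // r zr; rewrite ler_pdivrMr // prod.
have [wz|wz] := eqVneq (w z) 0.
  rewrite wz mul0r; have [k Vk] := archimedean_valuation t.
  have /le1 : valuation_bounds t (expR (k%:Z%:~R / 1%:R)).
    by exists k%:Z, 1%N; split=> //; rewrite expr1 mulrC.
  by rewrite wz mul0r.
have wz0 : 0 < w z by rewrite lt_neqAle eq_sym wz valuation_abs_ge0.
rewrite [leRHS]mulrC -ler_pdivrMr //; apply: valuation_abs_ge => // s ts.
by rewrite ler_pdivrMr // [leRHS]mulrC le1.
Qed.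

Lemma valuation_abs1 : w 1 = 1.
Proof.
apply/eqP; rewrite eq_le valuation_abs_le ?oner_eq0 //=; last first.
  by exists 0, 1%N; split=> //; rewrite ?mul0r ?expR0 // expr1 expr0z mulr1.
apply: valuation_abs_ge => [|r [a [b [b0 -> ]]]]; first exact: oner_neq0.
rewrite expr1n mul1r; case: a => n Vn.
  by rewrite -expR0 ler_expR divr_ge0 // ler0n.
case: Mp => _ []; exists (p%:R ^+ n * p%:R ^ Negz n).
  by apply: VM => //; apply: subringX => //; exact: subring_nat.
by rewrite mulrA -exprS NegzE -exprnN mulfV // expf_neq0.
Qed.

Lemma valuation_abs_gt0 z : z != 0 -> 0 < w z.
Proof.
move=> z0; have := valuation_absM_le z z^-1; rewrite mulfV // valuation_abs1.
rewrite lt_neqAle valuation_abs_ge0 andbT; move=> H; apply/eqP => wz.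
by move: H; rewrite -wz mul0r ler10.
Qed.

(** Infima alone give submultiplicativity; equality comes from here. If the product exceeded 1, a
    rational [a / b] would lie strictly between [- ln (w z^-1)] and [ln (w z)], and neither
    [z ^+ b * p ^ a] nor its inverse could be in [V]. *)
Lemma valuation_absV z : z != 0 -> w z * w z^-1 <= 1.
Proof.
move=> z0; rewrite leNgt; apply/negP => lt.
have z'0 : z^-1 != 0 by rewrite invr_eq0.
have wz := valuation_abs_gt0 z0; have wz' := valuation_abs_gt0 z'0.
have : - ln (w z^-1) < ln (w z).
  by rewrite -subr_gt0 opprK -lnM ?posrE // ln_gt0.
move=> /rat_in_itvoo[q]; rewrite in_itv /= => /andP[q1 q2].
pose a := numq q; pose b := `|denq q|%N.
have b0 : (0 < b)%N by rewrite absz_gt0 denq_neq0.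
have qE : ratr q = a%:~R / b%:R :> R.
  rewrite /ratr -/a; congr (_ / _); rewrite /b.
  by rewrite -[denq q in LHS]gez0_abs // denq_ge0.
have nV : ~ V (z ^+ b * p%:R ^ a).
  move=> Va; have /(valuation_abs_le z0) : valuation_bounds z (expR (ratr q)).
    by exists a, b; rewrite qE.
  by rewrite leNgt => /negP; apply; rewrite -ltr_ln ?posrE ?expR_gt0 // expRK.
have [|//|V'] := val (z := z ^+ b * p%:R ^ a).
  by rewrite mulf_neq0 ?expf_neq0 // expfz_neq0.
have /(valuation_abs_le z'0) : valuation_bounds z^-1 (expR (- ratr q)).
  exists (- a), b; split=> //; first by rewrite qE rmorphN mulNr.
  by rewrite exprVn -invr_expz -invfM.
rewrite leNgt => /negP; apply; rewrite -ltr_ln ?posrE ?expR_gt0 // expRK.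
by rewrite ltrNl.
Qed.

Lemma valuation_absM : {morph w : z t / z * t}.
Proof.
move=> z t; apply/eqP; rewrite eq_le valuation_absM_le /=.
have [->|z0] := eqVneq z 0; first by rewrite /w /valuation_abs eqxx mul0r valuation_abs_ge0.
have := valuation_absM_le z^-1 (z * t); rewrite mulKf // => H.
apply: le_trans (ler_wpM2l (valuation_abs_ge0 z) H) _.
rewrite mulrA -[leRHS]mul1r ler_wpM2r ?valuation_abs_ge0 //.
exact: valuation_absV.
Qed.

Lemma valuation_abs_le1 z : V z -> w z <= 1.
Proof.
have [->|z0] := eqVneq z 0; first by rewrite /w /valuation_abs eqxx.
move=> Vz; apply: valuation_abs_le => //.
by exists 0, 1%N; split=> //; rewrite ?mul0r ?expR0 // expr1 expr0z mulr1.
Qed.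

Lemma valuation_absD z t : w (z + t) <= w z + w t.
Proof.
have [->|z0] := eqVneq z 0; first by rewrite add0r lerDr valuation_abs_ge0.
have [->|t0] := eqVneq t 0; first by rewrite addr0 lerDl valuation_abs_ge0.
have half u v : u != 0 -> V (v / u) -> w (u + v) <= w u.
  move=> u0 Vuv; have -> : u + v = u * (1 + v / u).
    by rewrite mulrDr mulr1 mulrC divfK // addrC.
  rewrite valuation_absM ler_piMr ?valuation_abs_ge0 // valuation_abs_le1 //.
  exact: subringD.
have tz0 : t / z != 0 by rewrite mulf_neq0 ?invr_eq0.
case: (val tz0) => H.
  by apply: le_trans (half _ _ z0 H) _; rewrite lerDl valuation_abs_ge0.
rewrite invf_div in H; rewrite addrC.
by apply: le_trans (half _ _ t0 H) _; rewrite lerDr valuation_abs_ge0.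
Qed.

Lemma valuation_abs_eq0 z : w z = 0 <-> z = 0.
Proof.
split=> [wz|->]; last by rewrite /w /valuation_abs eqxx.
apply/eqP/negP => /negP z0; have := valuation_abs_gt0 z0.
by rewrite -/w wz ltxx.
Qed.

Lemma valuation_abs_small z e : z != 0 -> V (z ^+ e * p%:R^-1) -> (0 < e)%N -> w z < 1.
Proof.
move=> z0 Vz e0; have : w z <= expR ((-1)%:~R / e%:R).
  apply: valuation_abs_le => //; exists (-1), e; split=> //.
move=> /le_lt_trans; apply; rewrite -[ltRHS]expR0 ltr_expR mulrN1z.
by rewrite mulN1r oppr_lt0 invr_gt0 ltr0n.
Qed.

(* In a relation of x with coefficients prime to p as a whole, the terms above
   the last one prime to p are divisible by p. *)
Lemma valuation_abs_y : w x^-1 < 1.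
Proof.
have [d [a [ad0 aE prim]]] := primitive_relation.
have [i0 ni0] := prim p p1.
pose P (i : 'I_d.+1) := ~~ (p%:Z %| a i)%Z.
case: (@arg_maxnP _ i0 P (fun i : 'I_d.+1 => i : nat) ni0) => r nr rmax.
pose U := \sum_(i < d.+1 | (i <= r)%N) (a i)%:~R * x^-1 ^+ (r - i).
pose T := \sum_(i < d.+1 | ~~ (i <= r)%N) (a i %/ p%:Z)%Z%:~R * x^-1 ^+ (d - i).
have VT : V T.
  apply: subring_sum => // i _.
  by apply: VM; [exact: subring_int | exact: subringX].
have VU : V U.
  apply: subring_sum => // i _.
  by apply: VM; [exact: subring_int | exact: subringX].
have rd : (r <= d)%N by rewrite -ltnS.
have E : x^-1 ^+ (d - r) * U = - (p%:R * T).
  apply/eqP; rewrite -addr_eq0 -[X in _ == X]aE (bigID (fun i : 'I_d.+1 => (i <= r)%N)) /=.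
  apply/eqP; congr (_ + _); rewrite mulr_sumr; apply: eq_bigr => i ir.
    rewrite mulrCA -exprD; congr (_ * _ ^+ _).
    by rewrite addnBA // subnK.
  rewrite mulrA; congr (_ * _); rewrite -[in RHS](divzK (d := p%:Z) (m := a i)).
    by rewrite intrM mulrC.
  by apply: contraNT ir => /rmax.
(* Modulo the maximal ideal [U] equals [a r], which [p] does not divide. So [U] is a unit, and
   [x^-1 ^+ (d - r)] is [p] times an element of [V]. *)
have nMU : ~ nonunit V U.
  move=> MU; move/negP: nr; apply; apply: pP.
  have -> : (a r)%:~R = U - x^-1 * \sum_(i < d.+1 | (i < r)%N) (a i)%:~R * x^-1 ^+ (r - i.+1).
    rewrite /U (bigD1 r) //= subnn mulr1 mulr_sumr -addrA.
    rewrite [X in _ + (X - _)](_ : _ =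
      \sum_(i < d.+1 | (i < r)%N) x^-1 * ((a i)%:~R * x^-1 ^+ (r - i.+1))).
      by rewrite subrr addr0.
    apply: eq_big => [i|i /andP[ir neq]]; first by rewrite ltn_neqAle andbC.
    rewrite mulrCA -exprS subnSK // ltn_neqAle ir andbT.
    by apply: contra neq => /eqP/val_inj ->.
  apply: MD => //; apply: nonunitN => //; apply: MM => //.
  apply: subring_sum => // i _.
  by apply: VM; [exact: subring_int | exact: subringX].
have [v Vv Uv] := not_nonunit VU nMU.
have E' : x^-1 ^+ (d - r) = p%:R * (- T * v).
  transitivity (x^-1 ^+ (d - r) * U * v); first by rewrite -mulrA Uv mulr1.
  by rewrite E; ring.
have y0 : x^-1 != 0 by rewrite invr_eq0.
apply: (@valuation_abs_small _ (d - r)) => //.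
  rewrite E' mulrC mulKf //; apply: VM => //; exact: subringN.
rewrite lt0n; apply/negP => /eqP dr; case: nMU.
move: E; rewrite dr expr0 mul1r => ->; apply: nonunitN => //; exact: MM.
Qed.

Definition valuation_absv : absolute_value R K.
Proof.
apply: (@AbsoluteValue R K w valuation_abs_ge0 valuation_abs_eq0 valuation_absM
  valuation_absD).
exists x^-1; first by rewrite invr_eq0.
by rewrite lt_eqF // valuation_abs_y.
Defined.

Lemma valuation_absv_nat n : valuation_absv n%:R <= 1.
Proof. by apply: valuation_abs_le1; exact: subring_nat. Qed.

Lemma valuation_absv_gt1 : 1 < valuation_absv x.
Proof.
have w0 : 0 < valuation_absv x by exact: valuation_abs_gt0.
by rewrite -invf_lt1 // -absvV; exact: valuation_abs_y.
Qed.

End RankOneValuation.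

Lemma nonintegral_absv (R : realType) (K : fieldExtType rat) (x : K) :
  ~ integralOver (intr : int -> K) x ->
  exists w : absolute_value R K, (forall n : nat, w n%:R <= 1) /\ 1 < w x.
Proof.
move=> nix; have x0 : x != 0.
  by apply: contra_notN nix => /eqP ->; exact: mxpoly.integral0.
have [V [subV Vy nVx maxV]] := exists_maximal_subring x0 nix.
have [p [p1 Mp pP]] := exists_residue_characteristic subV x0 Vy nVx maxV.
exists (valuation_absv R subV x0 Vy nVx maxV p1 Mp pP); split.
  by move=> n; exact: valuation_absv_nat.
exact: valuation_absv_gt1.
Qed.

(** * Pisot-Salem numbers *)

Section PisotSalem.
Variables (R : realType) (K : fieldExtType rat) (sigma : {rmorphism K -> R[i]}).
Local Notation isint := (integralOver (intr : int -> K)).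
Local Notation O := (OKv (absv_of sigma)).

(** A nonintegral element is large at an absolute value bounded by 1 on the natural numbers. That
    one cannot be equivalent to the absolute value of [sigma], where 2 is large. *)
Lemma OKv_integral (x : K) : O x -> isint x.
Proof.
move=> Ox; apply: contrapT => /(nonintegral_absv R)[w [wn wx]].
move: wx; rewrite ltNge => /negP; apply; apply: Ox => -[s s0 E].
have two : nc (2%:R : R[i]) = 2 by rewrite -(ratr_nat R[i] 2) nc_rat ratr_nat normr_nat.
have := E 2%:R; rewrite /= rmorph_nat two => E2.
have := wn 2%N; rewrite E2 leNgt => /negP; apply.
by rewrite /powR gt_eqF //= -[ltLHS]expR0 ltr_expR mulr_gt0 // ln_gt0 // ltr1n.
Qed.

Lemma OKvN (x : K) : O x -> O (- x).
Proof. by move=> Ox w nw; rewrite absvN; exact: Ox. Qed.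

Hypothesis sigma_real : forall x, complex.Im (sigma x) = 0.

Let conj_sigma x : conjc (sigma x) = sigma x.
Proof. by have := sigma_real x; case: (sigma x) => a b /= ->; rewrite oppr0. Qed.

(** Kronecker's argument: all conjugates are at most 1, so the powers of [x] stay in a finite set
    and [x] is 0 or a root of unity; since [sigma x] is real, its square is then 1. *)
Lemma OKv_root_of_unity (x : K) : O x -> nc (sigma x) <= 1 ->
  x \in [:: 0; 1; -1].
Proof.
move=> Ox sx1; have [theta genK] := primitive_element_exists K.
have ix := OKv_integral Ox.
have conj1 (rho : {rmorphism K -> R[i]}) : nc (rho x) <= 1.
  have [aw|naw] := pselect (away_from sigma theta rho).
    exact: (OKv_away Ox aw).
  by rewrite (nc_not_away genK naw).
have [n [m [nm E]]] : exists n m, (n < m)%N /\ x ^+ n = x ^+ m.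
  apply: contrapT => inj; apply: infinite_nat.
  have injx : injective (fun n => x ^+ n).
    move=> n m /= E; have [lt|lt|//] := ltngtP n m; case: inj.
      by exists n, m.
    by exists m, n.
  have := @finite_preimage _ _ _ (fun n => x ^+ n) (in2W injx) (finite_integral sigma 1).
  apply: sub_finite_set => n _; split.
    elim: n => [|n IHn]; first exact: mxpoly.integral1.
    by rewrite /= exprS; exact: mxpoly.integral_mul.
  by move=> rho; rewrite rmorphXn ncX exprn_ile1 // nc_ge0.
rewrite !inE; have [//|x0 /=] := eqVneq x 0.
have xk : x ^+ (m - n) = 1.
  by rewrite expfB // -E mulfV // expf_neq0.
have : nc (sigma x) ^+ (m - n) == 1 by rewrite -ncX -rmorphXn xk rmorph1 nc1.
rewrite pexpr_eq1 ?nc_ge0 ?subn_gt0 // => /eqP nx1.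
have : (sigma x) ^+ 2 == 1.
  have := nc_sqr (sigma x); rewrite nx1 sigma_real expr1n expr0n addr0 => H.
  have -> : sigma x = real_complex R (complex.Re (sigma x)).
    by have := sigma_real x; case: (sigma x) => a b /= ->.
  by rewrite -rmorphXn -H rmorph1.
by rewrite -rmorphXn -[1](rmorph1 sigma) (inj_eq (fmorph_inj sigma)) sqrf_eq1.
Qed.

(* Any conjugate of theta over Q(x) comes from an embedding that agrees with
   sigma on x; since |sigma x| > 1, that embedding is sigma. *)
Lemma OKv_primitive (x : K) : O x -> 1 < nc (sigma x) ->
  <<1%VS; x>>%VS = fullv.
Proof.
move=> Ox sx1; have [theta genK] := primitive_element_exists K.
suff tE : theta \in <<1%AS; x>>%AS.
  apply/eqP; rewrite eqEsubv subvf /= -genK; apply/FadjoinP; split=> //.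
  exact: subv_adjoin.
pose E := <<1%AS; x>>%AS; pose mu := minPoly E theta.
have sep : separable_poly mu.
  apply: (@pcharf0_separable _ K E).
  exact: (ftrans (pchar_lalg K) (pchar_num _)).
have [r rE] := closed_field_poly_normal (map_poly sigma mu).
have lc1 : lead_coef (map_poly sigma mu) = 1.
  by apply/eqP; rewrite -[_ == 1]/(_ \is monic) map_monic monic_minPoly.
rewrite lc1 scale1r in rE.
have ur : uniq r by rewrite -separable_prod_XsubC -rE separable_map.
have rs z : z \in r -> z = sigma theta.
  rewrite -root_prod_XsubC -rE => rz.
  have [rho rhoz] : exists rho : {rmorphism K -> R[i]}, rho theta = z.
    apply: (embedding_of_root genK (sigma := sigma)).
    have := @minPolyS _ _ 1%AS E theta (subv_adjoin 1%AS x); rewrite -(dvdp_map sigma).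
    by move=> /dvdpP[g ->]; rewrite rootM rz orbT.
  have [g gE] := primitive_horner x genK.
  have rhox : rho x = sigma x.
    have : mu %| map_poly (in_alg K) g - x%:P.
      apply: minPoly_dvdp.
        apply: rpredB; last by rewrite polyOverC memv_adjoin.
        apply: (polyOverSv (subv_adjoin 1%AS x)).
        by apply/polyOver1P; exists g.
      by rewrite /root hornerD hornerN hornerC -gE subrr.
    rewrite -(dvdp_map sigma) => /dvdpP[h hE].
    have : root (map_poly sigma (map_poly (in_alg K) g - x%:P)) z.
      by rewrite hE rootM rz orbT.
    rewrite rmorphB /= map_polyC /= map_poly_alg /root hornerD hornerN hornerC subr_eq0.
    move=> /eqP <-; rewrite {1}gE -horner_map map_poly_alg rhoz //.
  have : ~ away_from sigma theta rho.
    by move=> /(OKv_away Ox); rewrite rhox leNgt sx1.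
  move=> /not_andP[] /negP; rewrite negbK => /eqP; rewrite rhoz // => ->.
  exact: conj_sigma.
have sr : (size r <= 1)%N.
  apply: (uniq_leq_size ur (s2 := [:: sigma theta])) => z /rs ->.
  by rewrite inE.
have := size_minPoly E theta; rewrite -/mu -(size_map_poly sigma) rE size_prod_XsubC.
move=> [srE]; rewrite -adjoin_deg_eq1 eqn_leq; apply/andP; split.
  by rewrite -srE.
by rewrite adjoin_degreeE divn_gt0 ?adim_gt0 // dimvS // subv_adjoin.
Qed.

Lemma OKv_pisot_salem (x : K) : O x -> 1 < complex.Re (sigma x) ->
  pisot_salem sigma x.
Proof.
move=> Ox sx1; have sx : sigma x = real_complex R (complex.Re (sigma x)).
  by have := sigma_real x; case: (sigma x) => a b /= ->.
have nx1 : 1 < nc (sigma x) by rewrite (lt_le_trans sx1) // (le_trans (ler_norm _)) ?Re_le_nc.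
have genx := OKv_primitive Ox nx1; split=> //.
- exact: OKv_integral.
- by rewrite sx -[1](rmorph1 (real_complex R)) ltcR.
move=> b rb bs; have [rho rhob] := embedding_of_root genx rb.
rewrite normC_nc -[1](rmorph1 (real_complex R)) lecR -rhob.
(* The element [x] itself serves as the generator in [away_from]. As [sigma] is real, both
   conditions there reduce to [rho x != sigma x]. *)
by apply: (@OKv_away _ _ sigma x x rho Ox); split; rewrite rhob // conj_sigma.
Qed.

Lemma OKv_PK : O = PK sigma.
Proof.
apply/seteqP; split=> x.
  move=> Ox; have [sx1|sx1] := lerP (nc (sigma x)) 1.
    by constructor 1; exact: OKv_root_of_unity.
  have nE : nc (sigma x) = `|complex.Re (sigma x)|.
    rewrite -nc_real; congr nc.
    by have := sigma_real x; case: (sigma x) => a b /= ->.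
  have [p|n] := lerP 0 (complex.Re (sigma x)).
    by constructor 2; apply: OKv_pisot_salem; rewrite // -(ger0_norm p) -nE.
  constructor 3; apply: OKv_pisot_salem; first exact: OKvN.
  by rewrite rmorphN raddfN -(ltr0_norm n) -nE.
have pisot y : pisot_salem sigma y -> O y.
  move=> [iy _ geny rooty]; apply: (OKv_of_integral geny iy) => rho [ns _].
  rewrite -lecR rmorph1 -normC_nc; apply: rooty => //.
  have [q qE _] := minPoly_rat y.
  rewrite qE map_poly_alg -(map_poly_alg rho) -qE /root horner_map.
  by rewrite minPolyxx rmorph0.
move=> [|/pisot //|/pisot/OKvN]; last by rewrite opprK.
rewrite !inE => /or3P[] /eqP -> w _; first by rewrite absv0.
  by rewrite absv1.
by rewrite absvN absv1.
Qed.

End PisotSalem.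

(** * Number fields inside the algebra *)

Record rational_subfield (R : realType) (A : algType R) := RationalSubfield {
  rsf_dim : nat;
  rsf_gen : 'I_rsf_dim -> A;
  rsf_inj : injective (qcomb rsf_gen);
  rsf1 : qspan rsf_gen 1;
  rsfM : forall x y, qspan rsf_gen x -> qspan rsf_gen y -> qspan rsf_gen (x * y);
  rsfC : forall x y, qspan rsf_gen x -> qspan rsf_gen y -> x * y = y * x;
  rsfV : forall x, qspan rsf_gen x -> x != 0 ->
    exists2 y, qspan rsf_gen y & x * y = 1
}.

Arguments rsf_gen {R A} _ _.

(** Elements are rows of rational coefficients, so the finite-dimensional space over [rat] is the
    one of rows, and only multiplication and inverses are transported from [A]. *)
Definition rsf_type (R : realType) (A : algType R) (S : rational_subfield A) :
  Type := 'rV[rat]_(rsf_dim S).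

Section RationalSubfieldType.
Variables (R : realType) (A : algType R) (S : rational_subfield A).
Local Notation T := (rsf_type S).

HB.instance Definition _ := Vector.copy T 'rV[rat]_(rsf_dim S).

Definition rsf_val (x : T) : A := qcomb (rsf_gen S) x.

Lemma rsf_val_inj : injective rsf_val.
Proof. exact: rsf_inj. Qed.

Lemma rsf_val_span (x : T) : qspan (rsf_gen S) (rsf_val x).
Proof. by exists x. Qed.

Lemma rsf_valD (x y : T) : rsf_val (x + y) = rsf_val x + rsf_val y.
Proof. exact: qcombD. Qed.

Lemma rsf_valZ q (x : T) : rsf_val (q *: x) = ratr q *: rsf_val x.
Proof. exact: qcombZ. Qed.

Lemma rsf_val0 : rsf_val 0 = 0.
Proof. exact: qcomb0. Qed.

Lemma rsf_lift_subproof (a : A) : exists x : T,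
  qspan (rsf_gen S) a -> rsf_val x = a.
Proof.
have [[x _ <-]|nSa] := pselect (qspan (rsf_gen S) a); first by exists x.
by exists 0.
Qed.

Definition rsf_lift (a : A) : T := projT1 (cid (rsf_lift_subproof a)).

Lemma rsf_liftK a : qspan (rsf_gen S) a -> rsf_val (rsf_lift a) = a.
Proof. by rewrite /rsf_lift; case: cid. Qed.

Definition rsf_one : T := rsf_lift 1.
Definition rsf_mul (x y : T) : T := rsf_lift (rsf_val x * rsf_val y).

Lemma rsf_val1 : rsf_val rsf_one = 1.
Proof. exact/rsf_liftK/rsf1. Qed.

Lemma rsf_valM x y : rsf_val (rsf_mul x y) = rsf_val x * rsf_val y.
Proof. by apply: rsf_liftK; apply: rsfM; exact: rsf_val_span. Qed.

Lemma rsf_mulA : associative rsf_mul.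
Proof. by move=> x y z; apply: rsf_val_inj; rewrite !rsf_valM mulrA. Qed.

Lemma rsf_mulC : commutative rsf_mul.
Proof.
move=> x y; apply: rsf_val_inj; rewrite !rsf_valM.
by apply: (rsfC (r := S)); exact: rsf_val_span.
Qed.

Lemma rsf_mul1 : left_id rsf_one rsf_mul.
Proof. by move=> x; apply: rsf_val_inj; rewrite rsf_valM rsf_val1 mul1r. Qed.

Lemma rsf_mulDl : left_distributive rsf_mul +%R.
Proof.
move=> x y z; apply: rsf_val_inj.
by rewrite rsf_valD !rsf_valM rsf_valD mulrDl.
Qed.

Lemma rsf_one_neq0 : rsf_one != 0.
Proof.
apply/eqP => /(congr1 rsf_val); rewrite rsf_val1 rsf_val0 => /eqP.
by rewrite oner_eq0.
Qed.

HB.instance Definition _ := GRing.Zmodule_isComNzRing.Build T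
  rsf_mulA rsf_mulC rsf_mul1 rsf_mulDl rsf_one_neq0.

Lemma rsf_inv_subproof (x : T) : exists y : T,
  (x != 0 -> rsf_val x * rsf_val y = 1) /\ (x = 0 -> y = 0).
Proof.
have [->|x0] := eqVneq x 0; first by exists 0; split.
have vx0 : rsf_val x != 0.
  by apply: contra x0 => /eqP; rewrite -rsf_val0 => /rsf_val_inj ->.
have [a Sa xa] := rsfV (rsf_val_span x) vx0.
by exists (rsf_lift a); split=> [_|/eqP]; rewrite ?rsf_liftK // (negbTE x0).
Qed.

Definition rsf_inv (x : T) : T := projT1 (cid (rsf_inv_subproof x)).

Lemma rsf_mulV (x : T) : x != 0 -> rsf_inv x * x = 1.
Proof.
move=> x0; rewrite mulrC; apply: rsf_val_inj.
rewrite [LHS]rsf_valM [RHS]rsf_val1 /rsf_inv.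
by case: cid => y [xy _] /=; exact: xy.
Qed.

Lemma rsf_inv0 : rsf_inv 0 = 0.
Proof. by rewrite /rsf_inv; case: cid => y [_ y0] /=; exact: y0. Qed.

HB.instance Definition _ := GRing.ComNzRing_isField.Build T rsf_mulV rsf_inv0.

Lemma rsf_scaleAl q (x y : T) : q *: (x * y) = (q *: x) * y.
Proof.
apply: rsf_val_inj; rewrite rsf_valZ [rsf_val (x * y)]rsf_valM.
by rewrite [RHS]rsf_valM rsf_valZ scalerAl.
Qed.

HB.instance Definition _ := GRing.Lmodule_isLalgebra.Build rat T rsf_scaleAl.

Lemma rsf_scaleAr q (x y : T) : q *: (x * y) = x * (q *: y).
Proof. by rewrite mulrC rsf_scaleAl mulrC. Qed.

HB.instance Definition _ := GRing.Lalgebra_isAlgebra.Build rat T rsf_scaleAr.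

Lemma rsf_val_zmod_morphism : zmod_morphism rsf_val.
Proof.
by move=> x y; rewrite -scaleN1r rsf_valD rsf_valZ rmorphN1 scaleN1r.
Qed.

Lemma rsf_val_monoid_morphism : monoid_morphism rsf_val.
Proof. by split; [exact: rsf_val1 | move=> x y; exact: rsf_valM]. Qed.

HB.instance Definition _ := GRing.isZmodMorphism.Build T A rsf_val
  rsf_val_zmod_morphism.
HB.instance Definition _ := GRing.isMonoidMorphism.Build T A rsf_val
  rsf_val_monoid_morphism.

Definition rsf_field : fieldExtType rat := T.

End RationalSubfieldType.

Lemma number_field_of_center (R : realType) (A : algType R) (P : set A) N (b : 'I_N -> A) :
  qsubspace P -> P `<=` qspan b -> P 1 ->
  (forall x y, P x -> P y -> P (x * y)) ->
  (forall x y, P x -> P y -> x * y = y * x) ->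
  (forall x, P x -> x != 0 -> exists2 y, P y & x * y = 1) ->
  exists (K : fieldExtType rat) (j : {rmorphism K -> A}), range j = P.
Proof.
move=> subP Pb P1 PM PC PV.
have [m [k [_ injk kP _]]] := qsubspace_basis subP Pb.
rewrite -kP in P1 PM PC PV.
pose S := RationalSubfield injk P1 PM PC PV.
by exists (rsf_field S), (rsf_val (S := S)); exact: kP.
Qed.

(** * The center and the completion *)

Section FieldSpan.
Variables (K : fieldType) (A : nzRingType) (j : {rmorphism K -> A}).

Definition kspan N (b : 'I_N -> A) : set A :=
  [set a | exists c : 'I_N -> K, a = \sum_i j (c i) * b i].

Lemma kspan_trans N (b : 'I_N -> A) m (s : 'I_m -> A) a :
  (forall i, kspan s (b i)) -> kspan b a -> kspan s a.
Proof.
move=> /choice[c cE] [d ->]; exists (fun k => \sum_i d i * c i k).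
under [RHS]eq_bigr do rewrite rmorph_sum mulr_suml.
rewrite exchange_big; apply: eq_bigr => i _; rewrite cE mulr_sumr.
by apply: eq_bigr => k _; rewrite rmorphM mulrA.
Qed.

Lemma kspan_gen N (b : 'I_N -> A) i : kspan b (b i).
Proof.
exists (fun k => (k == i)%:R); rewrite (bigD1 i) //= eqxx rmorph1 mul1r big1 ?addr0 //.
by move=> k /negbTE ->; rewrite rmorph0 mul0r.
Qed.

(* A generating family of minimal size is independent. *)
Lemma kspan_basis N (b : 'I_N -> A) : exists m (s : 'I_m -> A),
  [/\ forall i, kspan b (s i), forall i, kspan s (b i) &
   forall c : 'I_m -> K, \sum_i j (c i) * s i = 0 -> forall i, c i = 0].
Proof.
pose Q m := `[< exists s : 'I_m -> A,
  (forall i, kspan b (s i)) /\ (forall i, kspan s (b i)) >].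
have exQ : exists m, Q m.
  by exists N; apply/asboolP; exists b; split; exact: kspan_gen.
case: (ex_minnP exQ) => m /asboolP[s [sb bs]] mmin.
exists m, s; split=> // c cE i; apply: contrapT => /eqP ci.
case: m s sb bs mmin c cE i ci => [|m] s sb bs mmin c cE i ci; first by case: i ci.
suff : (m.+1 <= m)%N by rewrite ltnn.
apply: mmin; apply/asboolP; exists (fun k => s (lift i k)); split=> // l.
apply: kspan_trans (bs l) => k; case: (unliftP i k) => [k' ->|->].
  exact: (kspan_gen (fun k => s (lift i k))).
exists (fun k => - (c (lift i k) / c i)).
have -> : s i = j (c i)^-1 * (j (c i) * s i).
  by rewrite mulrA -rmorphM mulVf // rmorph1 mul1r.
move: cE; rewrite (bigD1_ord i) //= => /eqP; rewrite addr_eq0 => /eqP ->.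
rewrite mulrN mulr_sumr -sumrN; apply: eq_bigr => k' _.
by rewrite rmorphN mulNr mulrA -rmorphM mulrC.
Qed.

End FieldSpan.

Section ComplexAction.
Variables (R : realType) (A : algType R) (io : A).
Hypothesis ioC : forall a, io * a = a * io.

Definition cact (z : R[i]) : A := (complex.Re z)%:A + complex.Im z *: io.

Lemma cactB z w : cact (z - w) = cact z - cact w.
Proof.
by rewrite /cact !raddfB /= !scalerBl opprD addrACA.
Qed.

Lemma cactD z w : cact (z + w) = cact z + cact w.
Proof. by rewrite /cact !raddfD /= !scalerDl addrACA. Qed.

Lemma cact_real r : cact (real_complex R r) = r%:A.
Proof. by rewrite /cact /= scale0r addr0. Qed.

Lemma cactC z a : cact z * a = a * cact z.
Proof.
by rewrite /cact mulrDl mulrDr mulr_algl mulr_algr -scalerAl ioC scalerAr.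
Qed.

(** Treats the real and complex cases at once: unless [io] is a square root of -1, only real numbers
    may act. On this domain [cact] is multiplicative and has trivial kernel. *)
Definition cact_dom (z : R[i]) := io * io = -1 \/ complex.Im z = 0.

Lemma cactM z w : cact_dom z -> cact_dom w -> cact (z * w) = cact z * cact w.
Proof.
move=> dz dw; case: z w dz dw => a b [c d] dz dw; rewrite /cact /=.
have E : (b * d) *: (io * io) = (- (b * d))%:A.
  have [->|b0] := eqVneq b 0; first by rewrite mul0r !scale0r oppr0 scale0r.
  have [->|d0] := eqVneq d 0; first by rewrite mulr0 !scale0r oppr0 scale0r.
  case: dz => [->|/= b00]; first by rewrite scaleNr scalerN.
  by rewrite b00 eqxx in b0.
rewrite mulrDl !mulrDr mulr_algl mulr_algr -!scalerAl -!scalerAr !scalerA E mul1r.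
rewrite !scalerDl [b * c]mulrC addrACA; congr (_ + _).
by rewrite addrC.
Qed.

Lemma cact_inj z : cact_dom z -> cact z = 0 -> z = 0.
Proof.
case: z => a b dz; rewrite /cact /= => E.
have b0 : b = 0.
  apply/eqP/negP => /negP b0; case: dz => [io2|/= b00]; last by rewrite b00 eqxx in b0.
  have ioE : io = (- (b^-1 * a))%:A.
    apply: (scalerI b0); rewrite scalerA mulrN mulrA mulfV // mul1r scaleNr.
    by apply/eqP; rewrite -addr_eq0 addrC E.
  move: io2; rewrite {1}ioE mulr_algl ioE scalerA mulrNN -expr2 => /eqP.
  rewrite -addr_eq0 -[X in _ + X]scale1r -scalerDl scaler_eq0 oner_eq0 orbF.
  by rewrite gt_eqF // ltr_wpDl // sqr_ge0.
by move: E; rewrite b0 scale0r addr0 => /eqP; rewrite scaler_eq0 oner_eq0 orbF => /eqP ->.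
Qed.

End ComplexAction.

Section CentralElement.
Variables (R : realType) (A : falgType R).
Hypothesis simpleA : simple_algebra A.

(** The annihilator of a central element is a two-sided ideal, so it is zero or contains 1. *)
Lemma central_mul_eq0 (c d : A) : (forall a, c * a = a * c) -> c * d = 0 ->
  c = 0 \/ d = 0.
Proof.
move=> cC cd; have [||a x ca|P0|PT] := @simple_ideal _ _ simpleA [set a | c * a = 0].
- by rewrite /= mulr0.
- by move=> x y /= cx cy; rewrite mulrDr cx cy addr0.
- by rewrite /= mulrA cC -mulrA ca mulr0 mulrA ca mul0r.
- by right; apply: P0.
by left; rewrite -[c]mulr1; apply: PT.
Qed.

Lemma horner_alg_central (c : A) (p : {poly R}) : (forall a, c * a = a * c) ->
  forall a, horner_alg c p * a = a * horner_alg c p.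
Proof.
move=> cC a; elim/poly_ind: p => [|p k IHp]; first by rewrite rmorph0 mul0r mulr0.
rewrite rmorphD rmorphM /= horner_algX horner_algC mulrDl mulrDr.
rewrite mulr_algl mulr_algr; congr (_ + _). by rewrite -mulrA cC [LHS]mulrA IHp mulrA.
Qed.

(* Over the complex numbers, p ^ 2 is the product of the quadratic polynomials
   (X - z) (X - conj z), z running over the roots of p. *)
Lemma central_quadratic (c : A) (p : {poly R}) : (forall a, c * a = a * c) ->
  p \is monic -> horner_alg c p = 0 ->
  exists2 z : R[i], root (map_poly (real_complex R) p) z &
    c * c = (2 * complex.Re z) *: c - (nc z ^+ 2)%:A.
Proof.
move=> cC p_monic pc; set pC := map_poly _ p.
have [r rE] := closed_field_poly_normal pC.
have lc1 : lead_coef pC = 1 by apply/eqP; rewrite -[_ == 1]/(_ \is monic) map_monic.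
rewrite lc1 scale1r in rE.
pose Q (z : R[i]) : {poly R} := 'X * 'X - (2 * complex.Re z) *: 'X + (nc z ^+ 2)%:P.
have QE z : map_poly (real_complex R) (Q z) = ('X - z%:P) * ('X - (conjc z)%:P).
  rewrite /Q rmorphD rmorphB rmorphM /= map_polyZ map_polyX map_polyC /=.
  by rewrite trace_conjc norm_conjc scalerDl polyCM -!mul_polyC; ring.
have prodQ : \prod_(z <- r) Q z = p * p.
  apply: (map_poly_inj (real_complex R)); rewrite rmorph_prod rmorphM /= -/pC.
  under eq_bigr do rewrite QE.
  rewrite big_split /= -rE; congr (_ * _).
  have -> : \prod_(z <- r) ('X - (conjc z)%:P) = map_poly conjc pC.
    rewrite rE rmorph_prod; apply: eq_bigr => z _.
    by rewrite rmorphB /= map_polyX map_polyC.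
  rewrite /pC -map_poly_comp; apply: eq_map_poly => a /=.
  by rewrite oppr0.
have prod0 : \prod_(z <- r) horner_alg c (Q z) = 0.
  by rewrite -rmorph_prod prodQ rmorphM /= pc mul0r.
have [z zr zQ] : exists2 z, z \in r & horner_alg c (Q z) = 0.
  elim: r prod0 {rE prodQ} => [|z r IHr].
    by rewrite big_nil => /eqP; rewrite oner_eq0.
  rewrite big_cons => /(central_mul_eq0 (horner_alg_central _ cC))[z0|/IHr[t tr t0]].
    by exists z; rewrite ?mem_head.
  by exists t; rewrite ?inE ?tr ?orbT.
exists z; first by rewrite rE root_prod_XsubC.
move: zQ; rewrite /Q rmorphD rmorphB rmorphM /= linearZ /= horner_algX horner_algC.
by move=> /eqP; rewrite mulr_algl -addrA addr_eq0 opprD opprK => /eqP.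
Qed.

Lemma rmorph_rat_alg (K : fieldExtType rat) (j : {rmorphism K -> A}) (q : rat) :
  j q%:A = (ratr q)%:A.
Proof.
have E1 := fmorph_eq_rat (j \o in_alg K) q.
have E2 := fmorph_eq_rat (in_alg A \o (ratr : {rmorphism rat -> R})) q.
by rewrite -[LHS]/((j \o in_alg K) q) E1 -E2.
Qed.

(* The real subalgebra generated by a central element is R or C. *)
Lemma central_embedding (K : fieldExtType rat) (j : {rmorphism K -> A}) :
  (forall k a, j k * a = a * j k) ->
  exists (io : A) (sigma : {rmorphism K -> R[i]}),
    [/\ forall a, io * a = a * io,
     forall k, j k = cact io (sigma k) &
     io * io = -1 \/ forall k, complex.Im (sigma k) = 0].
Proof.
move=> jC; have [theta genK] := primitive_element_exists K.
have [mu muE mu_monic] := minPoly_rat theta.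
have jrat := rmorph_rat_alg j.
have jpoly (q : {poly rat}) :
    j (map_poly (in_alg K) q).[theta] = horner_alg (j theta) (map_poly ratr q).
  elim/poly_ind: q => [|q k IHq]; first by rewrite !rmorph0 horner0 rmorph0.
  rewrite !rmorphD !rmorphM /= !map_polyX !map_polyC /= hornerMXaddC.
  by rewrite rmorphD rmorphM /= IHq horner_algX horner_algC -jrat.
have [||z rz zE] := @central_quadratic (j theta) (map_poly ratr mu) (jC theta).
- by rewrite map_monic.
- by rewrite -jpoly -muE minPolyxx rmorph0.
rewrite -map_poly_comp in rz.
have {}rz : root (map_poly ratr mu) z.
  move: rz; congr (root _ z); apply: eq_map_poly => a /=; exact: fmorph_rat.
have [sigma sz] := embedding_of_rat_root genK muE rz.
have [io [ioC jt dz]] : exists io : A, [/\ forall a, io * a = a * io,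
    j theta = cact io z & cact_dom io z].
  (* Completing the square: [j theta] minus its real part squares to minus the square of [Im z]. If
     [Im z] is 0 this difference vanishes and [io] may be 0; otherwise dividing it by [Im z] gives a
     central square root of -1. *)
  have sqE : (j theta - (complex.Re z)%:A) * (j theta - (complex.Re z)%:A) =
      (- complex.Im z ^+ 2)%:A.
    set a := complex.Re z; set t := j theta.
    rewrite mulrBl !mulrBr zE nc_sqr !mulr_algl !mulr_algr -/t -/a scalerA -expr2.
    rewrite [2 * a]mulrDl !mul1r !scalerDl scaleNr.
    rewrite opprB [_ *: t + _ *: t - _]addrAC addrK [LHS]addrC addrA subrK.
    by rewrite opprD addrA subrr add0r.
  have tC := jC theta.
  have [im0|im0] := eqVneq (complex.Im z) 0.
    exists 0; split; [by move=> a; rewrite mul0r mulr0 | | by right].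
    move: sqE; rewrite im0 expr0n oppr0 scale0r => sq0.
    have : j theta - (complex.Re z)%:A = 0.
      have cC a : (j theta - (complex.Re z)%:A) * a = a * (j theta - (complex.Re z)%:A).
        by rewrite mulrBl mulrBr tC mulr_algl mulr_algr.
      by case: (central_mul_eq0 cC sq0).
    by rewrite /cact im0 scaler0 addr0 => /eqP; rewrite subr_eq0 => /eqP.
  exists ((complex.Im z)^-1 *: (j theta - (complex.Re z)%:A)); split.
  - move=> a; rewrite -scalerAl -scalerAr; congr (_ *: _).
    by rewrite mulrBl mulrBr tC mulr_algl mulr_algr.
  - by rewrite /cact scalerA mulfV // scale1r addrC subrK.
  left; rewrite -scalerAl -scalerAr sqE !scalerA -[RHS]scaleN1r.
  by congr (_ *: _); field.
have jE (q : {poly rat}) : cact_dom io (map_poly ratr q).[z] /\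
    j (map_poly (in_alg K) q).[theta] = cact io (map_poly ratr q).[z].
  elim/poly_ind: q => [|q k [dq IHq]].
    rewrite !rmorph0 !horner0 rmorph0; split; first by right.
    by rewrite -[0 in RHS](rmorph0 (real_complex R)) cact_real scale0r.
  rewrite !rmorphD !rmorphM /= !map_polyX !map_polyC /= !hornerMXaddC.
  have rk : ratr k = real_complex R (ratr k) by rewrite fmorph_rat.
  split; last first.
    rewrite rmorphD rmorphM /= IHq jt cactD cactM // rk cact_real; congr (_ + _).
    by rewrite jrat.
  case: (dz) dq => [io2|imz] [io2'|imq]; try by left.
  right; rewrite rk raddfD /= addr0.
  move: imq imz; move: (_.[z]) => u; case: u (z) => a b [c d] /= -> ->.
  by rewrite mulr0 mul0r addr0.
exists io, sigma.
have sE k : exists q : {poly rat}, k = (map_poly (in_alg K) q).[theta] /\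
    sigma k = (map_poly ratr q).[z].
  have [q kE] := primitive_horner k genK; exists q; split=> //.
  by rewrite kE -horner_map map_poly_alg sz.
split=> // [k|].
  by have [q [kE sk]] := sE k; rewrite sk kE; case: (jE q).
have [io2|nio2] := pselect (io * io = -1); first by left.
right=> k; have [q [_ ->]] := sE k.
by case: (jE q) => -[/nio2|].
Qed.

End CentralElement.

Section CompletionAction.
Variables (R : realType) (A : falgType R) (K : fieldExtType rat).
Variables (sigma : {rmorphism K -> R[i]}) (io : A).
Hypothesis ioC : forall a, io * a = a * io.
Hypothesis domK : io * io = -1 \/ forall k, complex.Im (sigma k) = 0.
Local Notation C := (completion sigma).

Lemma completion_set_real : (forall k, complex.Im (sigma k) = 0) ->
  completion_set sigma `<=` range (real_complex R).
Proof.
move=> sreal c cc.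
suff im0 : complex.Im c = 0.
  by exists (complex.Re c) => //; move: im0; case: (c) => a b /= ->.
apply/eqP/negP => /negP im0.
have e0 : 0 < `|complex.Im c| by rewrite normr_gt0.
have [|_ [[k _ <-] /=]] := cc (ball (c : R[i]^o) (real_complex R `|complex.Im c|)).
  by apply: nbhsx_ballx; rewrite -[0](rmorph0 (real_complex R)) ltcR.
rewrite -ball_normE /ball_ /= normC_nc ltcR ltNge => /negP; apply.
by have := Im_le_nc (c - sigma k); rewrite raddfB /= sreal subr0.
Qed.

Lemma completion_dom (c : C) : cact_dom io (completion_val c).
Proof.
case: domK => [io2|sreal]; first by left.
right; have /set_mem := completion_valP c.
by move=> /(completion_set_real sreal)[r _ <-].
Qed.

Lemma completion_valD (c c' : C) :
  completion_val (c + c') = completion_val c + completion_val c'.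
Proof. by []. Qed.

Lemma completion_valM (c c' : C) :
  completion_val (c * c') = completion_val c * completion_val c'.
Proof. by []. Qed.

Lemma completion_val1 : completion_val (1 : C) = 1.
Proof. by []. Qed.

Lemma completion_val_inj : injective (@completion_val R K sigma).
Proof. exact: val_inj. Qed.

Definition cscal (c : C) (a : A) : A := cact io (completion_val c) * a.

Lemma cact1 : cact io 1 = 1.
Proof. by rewrite -[1 in LHS](rmorph1 (real_complex R)) cact_real scale1r. Qed.

Lemma cscalA a b v : cscal a (cscal b v) = cscal (a * b) v.
Proof.
by rewrite /cscal mulrA completion_valM cactM //; exact: completion_dom.
Qed.

Lemma cscal1 : left_id 1 cscal.
Proof. by move=> v; rewrite /cscal completion_val1 cact1 mul1r. Qed.

Lemma cscalDr : right_distributive cscal +%R.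
Proof. by move=> c u v; rewrite /cscal mulrDr. Qed.

Lemma cscalDl v : {morph cscal^~ v : a b / a + b}.
Proof. by move=> a b; rewrite /cscal completion_valD cactD mulrDl. Qed.

Lemma cscalAl a u v : cscal a (u * v) = cscal a u * v.
Proof. by rewrite /cscal mulrA. Qed.

Lemma cscalAr a u v : cscal a (u * v) = u * cscal a v.
Proof. by rewrite /cscal mulrA cactC // -mulrA. Qed.

Definition completion_structure : algebra_structure C A :=
  AlgebraStructure cscalA cscal1 cscalDr cscalDl cscalAl cscalAr.

Lemma completion_structure_extends :
  extends_scalars (A := A) (real_to_completion sigma) completion_structure.
Proof. by move=> r a; rewrite /= /cscal /= cact_real mulr_algl. Qed.

Lemma scale_completion (c : C) (a : alg_over completion_structure) :
  c *: a = cscal c a.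
Proof. by []. Qed.

End CompletionAction.

(** Commuting with the matrix unit at (0, 0) clears the first column outside the diagonal, so the
    corner entry of [M * M] is a real square. This excludes complex scalars on a real matrix
    algebra. *)
Lemma matrix_central_sqr (R : realType) n (M : 'M[R]_n.+1) :
  (forall N, M * N = N * M) -> M * M != -1.
Proof.
move=> MC; apply/eqP => M2.
have M0 k : k != 0 -> M k 0 = 0.
  move=> k0; have := congr1 (fun N : 'M[R]_n.+1 => N k 0) (MC (delta_mx 0 0)).
  rewrite !mxE (bigD1 0) //= mxE !eqxx mulr1 big1 ?addr0 => [->|i i0].
    by rewrite big1 // => i _; rewrite mxE (negbTE k0) mul0r.
  by rewrite mxE (negbTE i0) mulr0.
have := congr1 (fun N : 'M[R]_n.+1 => N 0 0) M2.
rewrite !mxE (bigD1 0) //= big1 ?addr0 => [|i /M0 ->]; last by rewrite mulr0.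
move=> E; have := sqr_ge0 (M 0 0); rewrite expr2 E.
by rewrite oppr_ge0 ler10.
Qed.

(** * Additive functions close to linear ones *)

Lemma bounded_functional_eq0 (R : realType) (V : vectType R) (Z : set V)
    (h : V -> R^o) : relatively_dense Z -> rlinear h ->
  bdd_on (h : V -> R) Z -> forall v, h v = 0.
Proof.
move=> [K ZK] hl [M hM] v; have [C C0 hC] := rlinear_bounded hl.
apply/eqP/negP => /negP hv.
pose t : R := (M + C * `|K| + 1) / `|h v|.
have hv0 : 0 < `|h v| by rewrite normr_gt0.
have [z Zz zK] := ZK (t *: v).
have : `|h (t *: v)| <= M + C * `|K|.
  have -> : h (t *: v) = h z + h (t *: v - z).
    have E := hl (-1) z (t *: v); rewrite !scaleN1r in E.
    by rewrite [t *: v - z]addrC E addrA subrr add0r.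
  rewrite (le_trans (ler_normD _ _)) // lerD ?hM // (le_trans (hC _)) //.
  by rewrite ler_wpM2l // (le_trans zK) // ler_norm.
have -> : h (t *: v) = t * h v.
  by have := hl t v 0; rewrite (rlinear0 hl) !addr0.
rewrite normrM /t normrM normfV normr_id divfK ?gt_eqF //.
have := ler_norm (M + C * `|K| + 1); lra.
Qed.

(* Apply relatively_dense_of_unbounded_functionals to the graph of f: if f were
   not close to a linear functional, the graph would be relatively dense, while
   only finitely many points of Z have bounded norm. *)
Lemma almost_linear (R : realType) (V : vectType R) (H Z : set V) (f : V -> R) :
  subgroup_set H -> Z `<=` H -> symmetric_set Z ->
  covered_by_translates [set x + y | x in Z & y in Z] Z ->
  relatively_dense Z -> locally_finite Z ->
  (forall x y, H x -> H y -> f (x + y) = f x + f y) ->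
  exists2 a : V -> R^o, rlinear a & bdd_on (fun z => f z - a z) Z.
Proof.
move=> [H0 HB] ZH [Z0 ZN] covZ ZK lfZ fD; apply: contrapT => no.
have f0 : f 0 = 0 by apply: (addrI (f 0)); rewrite -fD // !addr0.
have fN x : H x -> f (- x) = - f x.
  move=> Hx; apply: (addrI (f x)); rewrite -fD ?subrr ?f0 //.
  by rewrite -[- x]sub0r; exact: HB.
pose S : set (V * R^o)%type := [set (z, f z) | z in Z].
have [|||K SK] := @relatively_dense_of_unbounded_functionals R (V * R^o)%type S.
- split; first by exists 0 => //; rewrite f0.
  move=> _ [z Zz <-]; exists (- z); first exact: ZN.
  by rewrite fN //; exact: ZH.
- have [F [finF ZF]] := covZ.
  exists [set (u, f u) | u in F]; split; first exact: finite_image.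
  move=> _ [_ [z Zz <-] [_ [t Zt <-] <-]].
  have /ZF[u Fu [y Zy uy]] : [set x + y | x in Z & y in Z] (z + t).
    by exists z => //; exists t.
  have Hzt : H (z + t) by apply: (subgroup_setD (conj H0 HB)); exact: ZH.
  have Hu : H u.
    have -> : u = z + t - y by rewrite -uy addrK.
    by apply: HB => //; exact: ZH.
  exists (u, f u); first by exists u.
  exists (y, f y); first by exists y.
  have E : f u + f y = f z + f t.
    by rewrite -!fD // ?uy //; exact: ZH.
  exact: (congr2 pair uy E).
- move=> g gl [M gM].
  have g0 := rlinear0 gl.
  have gE x t : g (x, t) = g (x, 0) + t * g (0, 1).
    have -> : (x, t) = t *: ((0, 1) : V * R^o) + (x, 0).
      apply: (congr2 pair); first by rewrite /= scaler0 add0r.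
      by rewrite /= addr0 [RHS]mulr1.
    by rewrite gl addrC.
  pose h x : R^o := g (x, 0).
  have hl : rlinear h.
    move=> c x y; rewrite /h -gl; congr g.
    apply: (congr2 pair) => //=; first by rewrite scaler0 addr0.
  (* A bounded functional without component on the second factor is bounded on [Z], hence zero. With
     a nonzero component, dividing by it yields a linear function at bounded distance from [f],
     which is excluded. *)
  have [l0|l0] := eqVneq (g (0, 1)) 0.
    move=> [x t]; rewrite gE l0 mulr0 addr0.
    apply: (bounded_functional_eq0 ZK hl); exists M => z Zz.
    by have := gM (z, f z); rewrite gE l0 mulr0 addr0; apply; exists z.
  case: no; exists (fun x => - (g (0, 1))^-1 *: h x).
    move=> c x y; rewrite hl !scalerDr; congr (_ + _).
    by rewrite !scalerA mulrC.
  exists (`|(g (0, 1))^-1| * M) => z Zz.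
  have -> : f z - (- (g (0, 1))^-1 *: h z) = (g (0, 1))^-1 * g (z, f z).
    have -> : - (g (0, 1))^-1 *: h z = - ((g (0, 1))^-1 * h z) by rewrite scaleNr.
    by rewrite [g (z, _)]gE mulrDr opprK addrC mulrCA mulVf ?mulr1.
  by rewrite normrM ler_wpM2l // gM //; exists z.
have [C1 C10 fstC] : exists2 C, 0 <= C & forall p : (V * R^o)%type, vnorm p.1 <= C * vnorm p.
  apply: (@rlinear_bounded R (V * R^o)%type _ (fun p => vcoord p.1)) => c x y /=.
  by rewrite linearP.
have [C2 C20 sndC] : exists2 C, 0 <= C & forall p : (V * R^o)%type, `|p.2 : R| <= C * vnorm p.
  exact: (@rlinear_bounded R (V * R^o)%type R^o snd).
have K0 : 0 <= K by have [s _] := SK 0; exact/le_trans/vnorm_ge0.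
have /finite_seqP[s sE] := lfZ (C1 * K).
pose M := \sum_(z <- s) `|f z|.
(* A graph point near this one lies over the finitely many points of [Z] where [f] is at most [M],
   yet its height exceeds [M]. *)
have [_ [z Zz <-] zK] := SK (0, M + C2 * K + 1).
have zs : z \in s.
  have : (Z `&` [set x | vnorm x <= C1 * K]) z.
    split=> //=; have := fstC ((0, M + C2 * K + 1) - (z, f z)).
    rewrite /= sub0r vnormN => /le_trans; apply.
    by rewrite ler_wpM2l.
  by rewrite sE.
have fM : `|f z| <= M.
  by rewrite /M (big_rem z) //= lerDl sumr_ge0.
have := sndC ((0, M + C2 * K + 1) - (z, f z)); rewrite /= => H1.
have H2 : C2 * vnorm ((0, M + C2 * K + 1) - (z, f z)) <= C2 * K by rewrite ler_wpM2l.
have := le_trans H1 H2; rewrite ler_norml => /andP[_].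
by move: fM; rewrite ler_norml => /andP[_]; lra.
Qed.

(** * Comparison with the lattice of integers *)

Section Lattice.
Variables (R : realType) (A : falgType R) (X : set A).
Hypotheses (simpleA : simple_algebra A) (spanX : spans X).
Hypotheses (X_inf : infinite_set X) (lfX : locally_finite X).
Hypothesis apX : approximate_subring X.
Variables (N : nat) (b : 'I_N -> A).
Local Notation B := (qspan b).
Hypothesis covXB : covered_by_translates X B.
Hypothesis minB : forall P, qsubspace P -> P `<=` B ->
  covered_by_translates X P -> B `<=` P.
Local Notation Z := (core_set X b).

Let subB : qsubspace B. Proof. exact: qspan_subspace. Qed.
Let grpB : subgroup_set B. Proof. exact: qsubspace_subgroup. Qed.
Let symZ : symmetric_set Z. Proof. exact: core_sym. Qed.

(** A product of two differences of elements of [X] expands into four products up to sign, each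
    covered by translates of [X]. *)
Lemma cov_coreM : covered_by_translates [set x * y | x in Z & y in Z] Z.
Proof.
apply: cov_trans (cov_X_core covXB).
pose XX := [set x * y | x in X & y in X].
have [X0 XN] := approximate_subring_sym apX.
have covXX : covered_by_translates XX X := approximate_subringM apX.
have XD := approximate_subringD apX.
apply: (@cov_trans _ _ [set x + y | x in X & y in X]) => //.
apply: (@cov_trans _ _ [set x + y | x in [set x + y | x in X & y in X] &
    y in [set x + y | x in X & y in X]]); last exact: cov_add.
apply: (@cov_trans _ _ [set x + y | x in [set x + y | x in XX & y in XX] &
    y in [set x + y | x in XX & y in XX]]); last by do 2!apply: cov_add => //.
apply: cov_sub => _ [_ [_ [x [y [Xx Xy ->]]]] [_ [_ [z [t [Xz Xt ->]]]] <-]].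
exists (x * z + x * (- t)).
  exists (x * z); first by exists x => //; exists z.
  by exists (x * (- t)) => //; exists x => //; exists (- t) => //; exact: XN.
exists ((- y) * z + y * t).
  exists ((- y) * z); first by exists (- y); [exact: XN | exists z].
  by exists (y * t) => //; exists y => //; exists t.
by rewrite mulrBl !mulrBr mulrN mulNr opprB [- _ + _ in LHS]addrC.
Qed.

Lemma cov_core_int (p : int) : covered_by_translates [set z *~ p | z in Z] Z.
Proof.
have nat_case n : covered_by_translates [set z *+ n | z in Z] Z.
  elim: n => [|n IHn].
    apply: cov_sub => _ [z _ <-]; rewrite mulr0n; by case: symZ.
  apply: cov_trans (cov_coreD apX covXB).
  apply: (@cov_trans _ _ [set x + y | x in Z & y in [set z *+ n | z in Z]]).
    apply: cov_sub => _ [z Zz <-]; exists z => //; exists (z *+ n); first by exists z.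
    by rewrite mulrS.
  by apply: cov_add => //; exact: cov_sub.
case: p => n; first exact: nat_case.
apply: cov_trans (nat_case n.+1); apply: cov_sub => _ [z Zz <-].
exists (- z); first by case: symZ => _; apply.
by rewrite mulNrn.
Qed.

(** Multiplication by [x] introduces denominators, which [D] clears. The [x] admitting such a [D]
    form a rational subspace, and it contains [Z] by [cov_coreM]. *)
Lemma rational_quasi_stable x : B x -> exists2 D : nat, (0 < D)%N &
  covered_by_translates [set (x * z) *+ D | z in Z] Z.
Proof.
have [Z0 ZN] := symZ.
have muln_cov (D : nat) (Y : set A) : covered_by_translates Y Z ->
    covered_by_translates [set y *+ D | y in Y] Z.
  move=> /(cov_image (h := fun y => y *+ D) (mulrnDl D)) H.
  exact: cov_trans H (cov_core_int D).
pose Q := [set x | exists2 D : nat, (0 < D)%N &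
  covered_by_translates [set (x * z) *+ D | z in Z] Z].
suff : B `<=` Q by apply.
apply: (core_min covXB minB); last first.
  move=> z Zz; exists 1%N => //; apply: cov_trans cov_coreM.
  by apply: cov_sub => _ [t Zt <-]; exists z => //; exists t.
split.
- exists 1%N => //; apply: cov_sub => _ [z Zz <-]; by rewrite mul0r.
- move=> u v [D D0 cu] [E E0 cv]; exists (D * E)%N; first by rewrite muln_gt0 D0.
  apply: cov_trans (cov_coreD apX covXB).
  apply: cov_trans (cov_add (muln_cov E _ cu) (muln_cov D _ cv)).
  apply: cov_sub => _ [z Zz <-].
  exists ((u * z) *+ D *+ E).
    by exists ((u * z) *+ D) => //; exists z.
  exists ((v * z) *+ E *+ D).
    by exists ((v * z) *+ E) => //; exists z.
  by rewrite mulrDl mulrnDl -!mulrnA [(E * D)%N]mulnC.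
move=> q u [D D0 cu]; exists (D * `|denq q|)%N.
  by rewrite muln_gt0 D0 absz_gt0 denq_neq0.
apply: cov_trans (cov_core_int (numq q)).
apply: cov_trans (cov_image (h := fun y => y *~ (numq q)) (mulrzDl (numq q)) cu).
apply: cov_sub => _ [z Zz <-]; exists ((u * z) *+ D); first by exists z.
rewrite -scalerAl -[RHS]scaler_nat natrM scalerA -[LHS]scaler_int -scaler_nat scalerA.
congr (_ *: _); rewrite -mulrA [RHS]mulrC; congr (_ * _).
rewrite -(ratr_nat _ `|denq q|) -rmorphM /= -(ratr_int _ (numq q)); congr ratr.
by rewrite natr_absz normr_denq mulrC -numqE.
Qed.

(** One [a] serves every [x]: the difference [f - a] is additive on [B] and bounded on [Z], hence on
    the elements [(x * z) *+ D], and division by [D] bounds it at [x * z]. *)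
Lemma core_almost_linear (f : A -> R) :
  (forall x y, B x -> B y -> f (x + y) = f x + f y) ->
  exists2 a : A -> R^o, rlinear a & forall x, B x ->
    exists M, forall z, Z z -> `|f (x * z) - a (x * z)| <= M.
Proof.
move=> fD.
have lfZ : locally_finite Z := locally_finite_cov (cov_core_X apX b) lfX.
have [a al aZ] := almost_linear grpB (@core_setB _ _ X _ b) symZ
  (cov_coreD apX covXB) (core_relatively_dense simpleA spanX X_inf lfX apX covXB) lfZ fD.
exists a => // x Bx; have [D D0 cD] := rational_quasi_stable Bx.
pose h y := f y - a y.
have aD u v : a (u + v) = a u + a v by have := al 1 u v; rewrite !scale1r.
have hD u v : B u -> B v -> h (u + v) = h u + h v.
  by move=> Bu Bv; rewrite /h fD // aD opprD addrACA.
have BM z : Z z -> B (x * z).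
  move=> Zz; by apply: (rational_mul apX covXB minB Bx); exact: core_setB Zz.
have h0 : h 0 = 0.
  have [B0 _ _] := subB.
  by apply: (addrI (h 0)); rewrite -hD // !addr0.
have hMn y n : B y -> B (y *+ n) /\ h (y *+ n) = h y *+ n.
  move=> By; have [B0 BD _] := subB; elim: n => [|n [Bn IHn]]; first by rewrite !mulr0n.
  by rewrite !mulrS -IHn -hD //; split=> //; exact: BD.
have [||M hM] := bdd_on_cov grpB _ _ hD cD aZ.
- exact: core_setB.
- by move=> _ [z /BM Bz <-]; case: (hMn _ D Bz).
exists M => z Zz.
have [_ E] := hMn _ D (BM z Zz).
have := hM _ (ex_intro2 _ _ z Zz erefl); rewrite E normrMn; apply: le_trans.
by rewrite -[leLHS]mulr1n ler_wpMn2l.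
Qed.

End Lattice.

(** * Coordinates over the number field *)

Section Coordinates.
Variables (R : realType) (A : falgType R) (X : set A).
Hypotheses (simpleA : simple_algebra A) (spanX : spans X).
Hypotheses (X_inf : infinite_set X) (lfX : locally_finite X).
Hypothesis apX : approximate_subring X.
Variables (N : nat) (b : 'I_N -> A).
Local Notation B := (qspan b).
Hypothesis covXB : covered_by_translates X B.
Hypothesis minB : forall P, qsubspace P -> P `<=` B ->
  covered_by_translates X P -> B `<=` P.
Local Notation Z := (core_set X b).
Variables (K : fieldExtType rat) (j : {rmorphism K -> A}).
Hypothesis jE : range j = rational_center b.
Variables (io : A) (sigma : {rmorphism K -> R[i]}).
Hypothesis ioC : forall a, io * a = a * io.
Hypothesis jcact : forall k, j k = cact io (sigma k).
Hypothesis domK : io * io = -1 \/ forall k, complex.Im (sigma k) = 0.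
Variables (d : nat) (e : 'I_d -> A).
Hypothesis eB : forall i, B (e i).
Hypothesis Be : forall a, B a -> kspan j e a.
Hypothesis e_free : forall c : 'I_d -> K, \sum_i j (c i) * e i = 0 ->
  forall i, c i = 0.
Local Notation C := (completion sigma).
Local Notation cs := (completion_structure ioC domK).

Let subB : qsubspace B. Proof. exact: qspan_subspace. Qed.
Let grpB : subgroup_set B. Proof. exact: qsubspace_subgroup. Qed.

Let jB k : B (j k).
Proof. by have [] : rational_center b (j k) by rewrite -jE; exists k. Qed.

Let jC k a : j k * a = a * j k.
Proof. by have [_] : rational_center b (j k) by rewrite -jE; exists k. Qed.

Lemma rational_sum (I : Type) (s : seq I) (F : I -> A) :
  (forall i, B (F i)) -> B (\sum_(i <- s) F i).
Proof. by have [B0 BD _] := subB; move=> BF; elim/big_ind: _. Qed.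

Lemma kcomb_rational (c : 'I_d -> K) : B (\sum_i j (c i) * e i).
Proof.
by apply: rational_sum => i; apply: (rational_mul apX covXB minB).
Qed.

Lemma kcoord_subproof : exists alpha : A -> 'I_d -> K,
  forall a, B a -> a = \sum_i j (alpha a i) * e i.
Proof.
suff /choice[f fP] : forall a, exists c : 'I_d -> K, B a -> a = \sum_i j (c i) * e i.
  by exists f.
move=> a; have [/Be[c aE]|nBa] := pselect (B a); first by exists c.
by exists (fun=> 0).
Qed.

Definition kcoord : A -> 'I_d -> K := projT1 (cid kcoord_subproof).
Local Notation alpha := kcoord.

Lemma kcoordE a : B a -> a = \sum_i j (alpha a i) * e i.
Proof. exact: (projT2 (cid kcoord_subproof)). Qed.

Lemma kcoord_unique a (c : 'I_d -> K) : a = \sum_i j (c i) * e i ->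
  forall i, alpha a i = c i.
Proof.
move=> aE i; have Ba : B a by rewrite aE; exact: kcomb_rational.
apply/eqP; rewrite -subr_eq0; apply/eqP; move: i; apply: e_free.
under eq_bigr do rewrite rmorphB mulrBl.
by rewrite sumrB -aE -kcoordE // subrr.
Qed.

Lemma kcoordB x y i : B x -> B y -> alpha (x - y) i = alpha x i - alpha y i.
Proof.
move=> Bx By; move: i; apply: kcoord_unique.
under eq_bigr do rewrite rmorphB mulrBl.
by rewrite sumrB -!kcoordE.
Qed.

Lemma kcoordD x y i : B x -> B y -> alpha (x + y) i = alpha x i + alpha y i.
Proof.
move=> Bx By; move: i; apply: kcoord_unique.
under eq_bigr do rewrite rmorphD mulrDl.
by rewrite big_split -!kcoordE.
Qed.

Lemma kcoordM k x i : B x -> alpha (j k * x) i = k * alpha x i.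
Proof.
move=> Bx; move: i; apply: kcoord_unique.
under eq_bigr do rewrite rmorphM -mulrA.
by rewrite -mulr_sumr -kcoordE.
Qed.

(** Expand the scalars in a [K]-basis [s] of their span: the relation becomes one between the
    central elements [s l] with coefficients in [B]. By [central_relation], either these
    coefficients vanish, and with them all scalars, or the [s l] are dependent over [K], which they
    are not. *)
Lemma kbasis_complex_free (t : 'I_d -> R[i]) : (forall i, cact_dom io (t i)) ->
  \sum_i cact io (t i) * e i = 0 -> forall i, t i = 0.
Proof.
move=> dt tE; pose u i := cact io (t i).
have [m [s [us su s_free]]] := kspan_basis j u.
have [c cE] : exists c : 'I_d -> 'I_m -> K, forall i, u i = \sum_l j (c i l) * s l.
  by have /choice[c cE] := su; exists c.
have sC l a : s l * a = a * s l.
  have [z ->] := us l; rewrite mulr_suml mulr_sumr; apply: eq_bigr => i _.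
  by rewrite [RHS]mulrA -jC -!mulrA /u cactC.
have E : \sum_l (\sum_i j (c i l) * e i) * s l = 0.
  rewrite -[RHS]tE; under [RHS]eq_bigr do rewrite -/(u _) cE mulr_suml.
  rewrite exchange_big; apply: eq_bigr => l _; rewrite mulr_suml.
  by apply: eq_bigr => i _; rewrite -!mulrA sC.
have [H i|[z [Kz [l zl] zE]]] := central_relation simpleA spanX X_inf apX covXB minB
    (fun l => kcomb_rational (fun i => c i l)) sC E.
  apply: (cact_inj (io := io)) => //; rewrite -/(u i) cE big1 // => l _.
  by rewrite (e_free (H l)) rmorph0 mul0r.
have /choice[z' z'E] : forall l, exists k, j k = z l.
  by move=> l'; have := Kz l'; rewrite -jE => -[k _ <-]; exists k.
case/eqP: zl; rewrite -z'E (s_free z') ?rmorph0 //.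
by rewrite -[RHS]zE; apply: eq_bigr => l' _; rewrite z'E.
Qed.

Lemma kbasis_complex_unique (c c' : 'I_d -> C) :
  \sum_i cscal io (c i) (e i) = \sum_i cscal io (c' i) (e i) -> c =1 c'.
Proof.
move=> E i; apply: completion_val_inj; apply/eqP.
rewrite -subr_eq0; apply/eqP; move: i.
apply: (kbasis_complex_free (t := fun i => completion_val (c i) - completion_val (c' i))).
  by move=> i; exact: (completion_dom domK (c i - c' i)).
under eq_bigr do rewrite cactB mulrBl.
by rewrite sumrB; apply/eqP; rewrite subr_eq0; apply/eqP.
Qed.

(** For generation: combinations over the completion are closed under real combinations and contain
    [B], which spans [A] over the reals. *)
Lemma kbasis_is_basis : is_basis (e : 'I_d -> alg_over cs).
Proof.
suff gen (v : A) : exists c : {ffun 'I_d -> C}, v = \sum_i cscal io (c i) (e i).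
  move=> v; have [c vE] := gen v; exists c; split=> // c' vE'.
  by apply/ffunP/kbasis_complex_unique; rewrite -vE; exact: vE'.
move: v; apply: (rational_real_span simpleA spanX X_inf apX covXB minB).
  split.
    exists [ffun=> 0]; rewrite big1 // => i _.
    by rewrite ffunE /cscal /= -[0](rmorph0 (real_complex R)) cact_real scale0r mul0r.
  move=> r x y [c ->] [c' ->].
  exists [ffun i => real_to_completion sigma r * c i + c' i].
  rewrite scaler_sumr -big_split; apply: eq_bigr => i _ /=; rewrite ffunE.
  rewrite (cscalDl io (e i)) -(cscalA domK); congr (_ + _).
  by rewrite /cscal /= cact_real mulr_algl.
move=> x Bx; exists [ffun i => to_completion sigma (alpha x i)].
by rewrite {1}(kcoordE Bx); apply: eq_bigr => i _; rewrite ffunE /cscal /= -jcact.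
Qed.

(** On [B], [sigma] of a coordinate agrees with the coordinate over the completion, whose real and
    imaginary parts are real-linear functions on all of [A]. *)
Lemma kcoord_bound : exists2 M : R, 0 <= M &
  forall x i, B x -> nc (sigma (alpha x i)) <= M * vnorm x.
Proof.
have /choice[g gE] : forall v : A, exists c : {ffun 'I_d -> C},
    v = \sum_i cscal io (c i) (e i).
  by move=> v; have [c [vE _]] := kbasis_is_basis v; exists c.
have gB x i : B x -> completion_val (g x i) = sigma (alpha x i).
  move=> Bx; pose c' i := to_completion sigma (alpha x i).
  rewrite (kbasis_complex_unique (c' := c')) //.
  rewrite -gE [LHS](kcoordE Bx).
  by apply: eq_bigr => l _; rewrite /cscal /= -jcact.
have gD r x y i : g (r *: x + y) i = real_to_completion sigma r * g x i + g y i.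
  move: i; apply: kbasis_complex_unique; rewrite -gE {1}(gE x) {1}(gE y).
  rewrite scaler_sumr -big_split; apply: eq_bigr => i _ /=.
  rewrite (cscalDl io (e i)) -(cscalA domK); congr (_ + _).
  by rewrite /cscal /= cact_real mulr_algl.
pose f (p : bool * 'I_d) x : R^o :=
  if p.1 then complex.Re (completion_val (g x p.2)) else complex.Im (completion_val (g x p.2)).
have fl p : rlinear (f p).
  case: p => c i r x y; rewrite /f /= gD completion_valD completion_valM.
  case: c; case: (completion_val (g x i)) => u v;
    case: (completion_val (g y i)) => u' v' /=;
    by rewrite mul0r ?subr0 ?addr0.
have /choice[M MP] : forall p, exists C : R, 0 <= C /\ forall x, `|f p x| <= C * vnorm x.
  by move=> p; have [C C0 fC] := rlinear_bounded (fl p); exists C.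
exists (\sum_p M p); first by apply: sumr_ge0 => p _; case: (MP p).
move=> x i Bx; rewrite -gB // (le_trans (nc_le_ReIm _)) //.
have [M1 H1] := MP (true, i); have [M2 H2] := MP (false, i).
rewrite (le_trans (lerD (H1 x) (H2 x))) // -mulrDl ler_wpM2r ?vnorm_ge0 //.
rewrite (bigD1 (true, i)) //= (bigD1 (false, i)) //= addrA lerDl.
by apply: sumr_ge0 => p _; case: (MP p).
Qed.

Variable theta : K.
Hypothesis genK : <<1%VS; theta>>%VS = fullv.
Local Notation isint := (integralOver (intr : int -> K)).
Local Notation away := (away_from sigma theta).

Lemma cact_quadratic k : j k * j k =
  (2 * complex.Re (sigma k)) *: j k - (nc (sigma k) ^+ 2)%:A.
Proof.
have dk : cact_dom io (sigma k) by case: domK => H; [left | right].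
rewrite {1 2}jcact -cactM // jcact nc_sqr /cact scalerDr !scalerA addrAC -scalerBl.
case: (sigma k) => u v /=.
by congr (_ *: _ + _ *: _); ring.
Qed.

Lemma away_quadratic (s w : R[i]) : w != s -> w != conjc s ->
  w * w - real_complex R (2 * complex.Re s) * w + real_complex R (nc s ^+ 2) != 0.
Proof.
move=> ws wcs; rewrite trace_conjc norm_conjc.
have -> : w * w - (s + conjc s) * w + s * conjc s = (w - s) * (w - conjc s) by ring.
by rewrite mulf_neq0 // subr_eq0.
Qed.

(* The coordinate rho (alpha z i) differs from an R-linear function of z by a
   bounded amount. The quadratic polynomial of theta over R annihilates that
   function but not rho. *)
Lemma kcoord_away_bounded (rho : {rmorphism K -> R[i]}) i : away rho ->
  exists M : R, forall z, Z z -> nc (rho (alpha z i)) <= M.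
Proof.
move=> [ws wcs]; pose th := j theta.
have B1 : B 1 := rational_one simpleA spanX X_inf apX covXB minB.
have BM x y : B x -> B y -> B (x * y) := rational_mul apX covXB minB (y := y).
have [|a al ab] := core_almost_linear simpleA spanX X_inf lfX apX covXB minB
    (f := fun x => complex.Re (rho (alpha x i))).
  by move=> x y Bx By; rewrite kcoordD // rmorphD raddfD.
have [|a' al' ab'] := core_almost_linear simpleA spanX X_inf lfX apX covXB minB
    (f := fun x => complex.Im (rho (alpha x i))).
  by move=> x y Bx By; rewrite kcoordD // rmorphD raddfD.
pose L v : R[i] := Complex (a v) (a' v).
have bnd x : B x -> exists M : R, forall z, Z z -> nc (rho (alpha (x * z) i) - L (x * z)) <= M.
  move=> Bx; have [M MP] := ab x Bx; have [M' MP'] := ab' x Bx.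
  exists (M + M') => z Zz; rewrite (le_trans (nc_le_ReIm _)) //.
  by rewrite !raddfB /= lerD ?MP ?MP'.
have [M0 H0] := bnd 1 B1; have [M1 H1] := bnd th (jB _).
have [M2 H2] := bnd (th * th) (BM _ _ (jB _) (jB _)).
set w := rho theta in ws wcs; set s := sigma theta in ws wcs.
pose t := real_complex R (2 * complex.Re s); pose n := real_complex R (nc s ^+ 2).
have q0 := away_quadratic ws wcs; rewrite -/t -/n in q0.
exists ((nc (w * w - t * w + n))^-1 * (M2 + nc t * M1 + nc n * M0)) => z Zz.
have Bz : B z := core_setB Zz.
have qn : 0 < nc (w * w - t * w + n).
  by rewrite lt_def nc_ge0 andbT; apply: contraNneq q0 => /nc_eq0 ->.
rewrite -(ler_pM2l qn) mulrA divff ?gt_eqF // mul1r -ncM.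
set u := rho (alpha z i).
have E1 : rho (alpha (th * z) i) = w * u by rewrite kcoordM // rmorphM.
have E2 : rho (alpha (th * th * z) i) = w * w * u.
  by rewrite -[th * th * z]mulrA kcoordM ?rmorphM /= ?E1 ?mulrA //; apply: BM; first exact: jB.
have LE : L (th * th * z) = t * L (th * z) - n * L z.
  have -> : th * th * z = (2 * complex.Re s) *: (th * z) + (- nc s ^+ 2) *: z.
    by rewrite cact_quadratic mulrBl -scalerAl mulr_algl scaleNr.
  have lin (h : A -> R^o) (r r' : R) x y : rlinear h ->
      h (r *: x + r' *: y) = r * h x + r' * h y.
    by move=> hl; rewrite hl -[r' *: y]addr0 hl (rlinear0 hl) addr0.
  rewrite /L !lin //; apply/eqP; rewrite eq_complex /=.
  by apply/andP; split; apply/eqP; ring.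
have -> : (w * w - t * w + n) * u = (w * w * u - L (th * th * z))
    - t * (w * u - L (th * z)) + n * (u - L z) by rewrite LE; ring.
rewrite -E2 -E1 (le_trans (ncD _ _)) // lerD // ?ncM.
  rewrite (le_trans (ncB _ _)) // ncM lerD ?H2 // ler_wpM2l ?nc_ge0 //.
  exact: H1.
by rewrite ler_wpM2l ?nc_ge0 //; have := H0 z Zz; rewrite mul1r.
Qed.

Lemma kcoord_integral : exists2 D : nat, (0 < D)%N &
  forall z, Z z -> forall i, isint (D%:R * alpha z i).
Proof.
have [Z0 ZN] := core_sym apX b.
have [G [/finite_seqP[s ->] sZ genZ]] := finitely_generated Z0
  (core_relatively_dense simpleA spanX X_inf lfX apX covXB)
  (core_diff_locally_finite lfX apX covXB).
have int_nat n (x : K) : isint x -> isint (n%:R * x).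
  by move=> ix; apply: integral_mul => //; exact: integral_nat.
have [D D0 DP] : exists2 D : nat, (0 < D)%N &
    forall x, x \in s -> forall i, isint (D%:R * alpha x i).
  elim: s {sZ genZ} => [|x s [D D0 DP]]; first by exists 1%N.
  have /choice[f fP] : forall i : 'I_d, exists n : nat, (0 < n)%N /\ isint (n%:R * alpha x i).
    by move=> i; have [n n0 H] := integral_multiple (alpha x i); exists n.
  exists (D * \prod_i f i)%N.
    by rewrite muln_gt0 D0 prodn_gt0 // => i; case: (fP i).
  move=> y; rewrite inE => /orP[/eqP -> i|ys i].
    have [_ fi] := fP i; rewrite (bigD1 i) //= mulnCA mulnC natrM -mulrA.
    exact: int_nat.
  by rewrite mulnC natrM -mulrA; apply: int_nat; exact: DP.
exists D => // z Zz i.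
pose H := [set x | B x /\ forall i, isint (D%:R * alpha x i)].
have /genZ : subgroup_set H.
  split.
    split; first by case: subB.
    move=> l; rewrite -(subrr 0) kcoordB ?subrr ?mulr0; try by case: subB.
    exact: mxpoly.integral0.
  move=> x y [Bx Hx] [By Hy]; split; first by case: grpB => _; apply.
  by move=> l; rewrite kcoordB // mulrBr; apply: integral_sub.
move=> ZH; suff sH : [set` s] `<=` H by have [_] := ZH sH z Zz; apply.
move=> x xs; split; last exact: DP.
have [u Zu [v Zv <-]] := sZ x xs.
by case: grpB => _; apply; [exact: core_setB Zu | exact: core_setB Zv].
Qed.

(** Conjugates away from [sigma] are controlled by [M], the remaining ones by [kcoord_bound]. So [D]
    times each coordinate is one of finitely many integral elements. *)
Lemma finite_kcoord_bounded (D : nat) (M r : R) : (0 < D)%N ->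
  finite_set [set y | [/\ B y, vnorm y <= r &
    forall i, isint (D%:R * alpha y i) /\
      forall rho, away rho -> nc (rho (alpha y i)) <= M]].
Proof.
move=> D0; have [M1 M10 sM1] := kcoord_bound.
have /finite_seqP[s sE] := @finite_integral R K sigma (D%:R * Num.max M (M1 * r)).
pose f (c : {ffun 'I_d -> 'I_(size s).+1}) := \sum_i j (D%:R^-1 * s`_(c i)) * e i.
apply: (@sub_finite_set _ _ (range f)); last exact/finite_image/finite_finset.
move=> y [By yr ycoord].
have D1 : D%:R != 0 :> K.
  by rewrite -(rmorph_nat (in_alg K)) /= scaler_eq0 oner_eq0 orbF pnatr_eq0 -lt0n.
have ys i : D%:R * alpha y i \in s.
  suff : [set` s] (D%:R * alpha y i) by [].
  have [iy ay] := ycoord i; rewrite -sE; split=> // rho.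
  rewrite rmorphM ncM rmorph_nat -(ratr_nat R[i] D) nc_rat ratr_nat normr_nat.
  rewrite ler_wpM2l // le_max; have [/ay -> //|naw] := pselect (away rho).
  apply/orP; right; rewrite (nc_not_away genK naw) (le_trans (sM1 y i By)) //.
  by rewrite ler_wpM2l.
exists [ffun i => inord (index (D%:R * alpha y i) s)] => //.
rewrite [RHS](kcoordE By); apply: eq_bigr => i _; rewrite ffunE inordK ?nth_index //.
  by rewrite mulrA mulVf // mul1r.
  exact: ys.
by rewrite ltnS index_size.
Qed.

(** The set [combinations] written with [j] in place of the action of the completion, as a plain
    subset of [A]. *)
Definition kcombinations : set A :=
  [set \sum_i j (beta i) * e i |
     beta in [set beta : 'I_d -> K | forall i, OKv (absv_of sigma) (beta i)]].
Local Notation Y := kcombinations.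

Lemma combinations_kcombinations :
  combinations (OKv (absv_of sigma)) (e : 'I_d -> alg_over cs) = Y.
Proof.
apply/seteqP; split=> _ [beta Obeta <-]; exists beta => //;
  by apply: eq_bigr => i _; rewrite scale_completion /cscal /= -jcact.
Qed.

Lemma kcombinations_kcoord y : Y y ->
  B y /\ forall i, OKv (absv_of sigma) (alpha y i).
Proof.
move=> [beta Obeta <-]; split; first exact: kcomb_rational.
by move=> i; rewrite (kcoord_unique (c := beta)).
Qed.

Lemma core_away_bound : exists M : R, forall z rho i, Z z -> away rho ->
  nc (rho (alpha z i)) <= M.
Proof.
have [tau [tau_all _]] := embeddings sigma genK.
have /choice[f fP] : forall p : 'I_(\dim {:K}) * 'I_d, exists M : R, away (tau p.1) ->
    forall z, Z z -> nc (tau p.1 (alpha z p.2)) <= M.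
  move=> [l i]; have [/(kcoord_away_bounded i)[M MP]|naw] := pselect (away (tau l)).
    by exists M.
  by exists 0 => /naw.
exists (\sum_p `|f p|) => z rho i Zz aw; have [l rE] := tau_all rho.
have awl : away (tau l) by move: aw; rewrite /away_from !rE.
rewrite rE (le_trans (fP (l, i) awl z Zz)) // (le_trans (ler_norm _)) //.
by rewrite (bigD1 (l, i)) //= lerDl sumr_ge0.
Qed.

Lemma kcombinations_relatively_dense : relatively_dense Y.
Proof.
have [D D0 DZ] := kcoord_integral; have [M MP] := core_away_bound.
have [K0 ZK0] := core_relatively_dense simpleA spanX X_inf lfX apX covXB.
have DR0 : 0 < D%:R :> R by rewrite ltr0n.
have [tau [tau_all _]] := embeddings sigma genK.
pose g (p : bool * 'I_(\dim {:K}) * 'I_d) (z : A) : R :=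
  if `[< away (tau p.1.2) >] then
    if p.1.1 then complex.Re (tau p.1.2 (D%:R * alpha z p.2))
    else complex.Im (tau p.1.2 (D%:R * alpha z p.2))
  else 0.
have ncD_ (rho : {rmorphism K -> R[i]}) x : nc (rho (D%:R * x)) = D%:R * nc (rho x).
  by rewrite rmorphM ncM rmorph_nat -(ratr_nat R[i] D) nc_rat ratr_nat normr_nat.
(* Mesh one half in both the real and the imaginary part makes the modulus of a difference at most
   1, the bound required by [OKv]. *)
have [|p z Zz|F [finF FZ netF]] := @finite_net R A Z _ g (D%:R * `|M|) (2^-1).
- by rewrite invr_gt0.
- rewrite /g; case: asboolP => aw; last by rewrite normr0 mulr_ge0.
  have le : nc (tau p.1.2 (D%:R * alpha z p.2)) <= D%:R * `|M|.
    by rewrite ncD_ ler_wpM2l // (le_trans (MP _ _ _ Zz aw)) ?ler_norm.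
  by case: p.1.1; rewrite (le_trans _ le) ?Re_le_nc ?Im_le_nc.
have DrD z : B z -> B (D%:R *: z).
  by have [_ _ BZ] := subB; rewrite -(ratr_nat R D); exact: BZ.
have alphaD z i : B z -> alpha (D%:R *: z) i = D%:R * alpha z i.
  move=> Bz; have -> : D%:R *: z = j D%:R * z by rewrite rmorph_nat scaler_nat mulr_natl.
  exact: kcoordM.
apply: (@relatively_dense_cov _ _ Y [set D%:R *: z | z in Z]).
  exists [set D%:R *: z | z in F]; split; first exact: finite_image.
  move=> _ [z Zz <-]; have [z0 Fz0 close] := netF z Zz.
  exists (D%:R *: z0); first by exists z0.
  have Zz0 := FZ _ Fz0; have [Bz Bz0] := (core_setB Zz, core_setB Zz0).
  have BB : B (D%:R *: z - D%:R *: z0) by case: grpB => _; apply; exact: DrD.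
  exists (D%:R *: z - D%:R *: z0); last by rewrite addrC subrK.
  exists (alpha (D%:R *: z - D%:R *: z0)); last by rewrite -kcoordE.
  move=> i; rewrite kcoordB ?alphaD; try exact: DrD; try by [].
  apply: (OKv_of_integral genK); first by apply: integral_sub; exact: DZ.
  move=> rho aw; have [l rE] := tau_all rho.
  have awl : away (tau l) by move: aw; rewrite /away_from !rE.
  rewrite rE (le_trans (nc_le_ReIm _)) //.
  have := close (true, l, i); have := close (false, l, i).
  rewrite /g /=; case: asboolP => // _; rewrite rmorphB !raddfB /=; lra.
exists (D%:R * K0) => v; have [z Zz vz] := ZK0 (D%:R^-1 *: v).
exists (D%:R *: z); first by exists z.
have -> : v - D%:R *: z = D%:R *: (D%:R^-1 *: v - z).
  by rewrite scalerBr scalerA divff ?gt_eqF // scale1r.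
by rewrite vnormZ normr_nat ler_wpM2l.
Qed.

Lemma core_commensurable_kcombinations : commensurable Z Y.
Proof.
have [D D0 DZ] := kcoord_integral; have [M MP] := core_away_bound.
have ncOK y rho i : Y y -> away rho -> nc (rho (alpha y i)) <= 1.
  by move=> /kcombinations_kcoord[_ Oy] aw; exact: (OKv_away (Oy i) aw).
(* The bound [M + 1] adds the bound [M] for the coordinates of [z] away from [sigma] and the bound 1
   for those of [y]. *)
have diff z y r : Z z -> Y y -> vnorm (z - y) <= r ->
    [/\ B (z - y), vnorm (z - y) <= r & forall i, isint (D%:R * alpha (z - y) i) /\
      forall rho, away rho -> nc (rho (alpha (z - y) i)) <= M + 1].
  move=> Zz Yy zyr; have [By Oy] := kcombinations_kcoord Yy; have Bz := core_setB Zz.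
  split=> //; first by case: grpB => _; apply.
  move=> i; rewrite kcoordB // mulrBr; split.
    apply: integral_sub; first exact: DZ.
    by apply: integral_mul; [exact: integral_nat | exact: OKv_integral].
  by move=> rho aw; rewrite rmorphB (le_trans (ncB _ _)) // lerD ?MP ?ncOK.
have fin r := finite_kcoord_bounded (M + 1) r D0.
split; apply: cov_of_relatively_dense.
- exact: kcombinations_relatively_dense.
- move=> r; apply: sub_finite_set (fin r) => _ [y [z [Yy Zz -> zyr]]].
  exact: diff.
- exact: (core_relatively_dense simpleA spanX X_inf lfX apX covXB).
move=> r; apply: sub_finite_set (finite_image (fun x => - x) (fin r)).
move=> _ [z [y [Zz Yy -> yzr]]]; exists (z - y); last by rewrite opprB.
by apply: diff => //; rewrite -vnormN opprB.
Qed.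

Lemma commensurable_kcombinations : commensurable X Y.
Proof.
have [ZY YZ] := core_commensurable_kcombinations; split.
  exact: cov_trans (cov_X_core covXB) ZY.
exact: cov_trans YZ (cov_core_X apX b).
Qed.

End Coordinates.

Theorem theorem1p6 (R : realType) (A : falgType R) (X : set A) :
  simple_algebra A ->
  infinite_set X ->
  uniformly_discrete X ->
  approximate_subring X ->
  spans X ->
  exists (K : fieldExtType rat) (v : absolute_value R K)
         (sigma : {rmorphism K -> R[i]})
         (s : algebra_structure (completion sigma) A)
         (d : nat) (e : 'I_d -> alg_over s),
    [/\ archimedean_place v,
        induces sigma v,
        extends_scalars (real_to_completion sigma) s,
        is_basis e &
        commensurable X (combinations (OKv v) e)] /\
    (forall (n : nat) (phi : {lrmorphism A -> 'M[R]_n.+1}), bijective phi ->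
      [/\ completion_set sigma = range (real_complex R),
          OKv v = PK sigma &
          commensurable X (combinations (PK sigma) e)]).
Proof.
move=> simpleA X_inf udX apX spanX.
have lfX := uniformly_discrete_locally_finite udX.
have [X0 XN] := approximate_subring_sym apX.
have rdX := approximate_subring_relatively_dense simpleA spanX X_inf lfX apX.
have lfXX : locally_finite [set x - y | x in X & y in X].
  apply: locally_finite_cov lfX; apply: cov_trans (approximate_subringD apX).
  by apply: cov_sub => _ [x Xx [y Xy <-]]; exists x => //; exists (- y) => //; exact: XN.
have [G [finG _ genX]] := finitely_generated X0 rdX lfXX.
have [N0 [b0 Gb0]] := finite_qspan finG.
have Xb0 := genX _ (qsubspace_subgroup (qspan_subspace b0)) Gb0.
have [N [b [_ covXB minB]]] := minimal_qspan Xb0.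
have [B0 BD BZ] := qspan_subspace b.
have BM := rational_mul apX covXB minB.
have [||||||K [j jE]] := @number_field_of_center R A (rational_center b) N b.
- split; first by split=> // a; rewrite mul0r mulr0.
    move=> x y [Bx xC] [By yC]; split; first exact: BD.
    by move=> a; rewrite mulrDl mulrDr xC yC.
  move=> q x [Bx xC]; split; first exact: BZ.
  by move=> a; rewrite -scalerAl -scalerAr xC.
- by move=> x [].
- split; first exact: (rational_one simpleA spanX X_inf apX covXB minB).
  by move=> a; rewrite mul1r mulr1.
- move=> x y [Bx xC] [By yC]; split; first exact: BM.
  by move=> a; rewrite -mulrA yC mulrA xC mulrA.
- by move=> x y [_ xC] _.
- exact: (rational_center_inv simpleA spanX X_inf apX covXB minB).
have jB k : rational_center b (j k) by rewrite -jE; exists k.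
have jC k a : j k * a = a * j k by have [_] := jB k.
have [io [sigma [ioC jcact domK]]] := central_embedding simpleA jC.
(* The rational generators of [B] also generate it over [K], so a basis of their span over [K] is a
   basis of [B]. *)
have [d [e [be eb e_free]]] := kspan_basis j b.
have eB i : qspan b (e i).
  have [c ->] := be i; elim/big_ind: _ => // l _.
  apply: BM; first by case: (jB (c l)).
  by exists (delta_mx 0 l) => //; rewrite qcomb_delta.
have Be a : qspan b a -> kspan j e a.
  move=> [c _ <-]; apply: kspan_trans eb _; exists (fun i => (c 0 i)%:A).
  by apply: eq_bigr => i _; rewrite rmorph_rat_alg mulr_algl.
have [theta genK] := primitive_element_exists K.
have comm := commensurable_kcombinations simpleA spanX X_inf lfX apX covXB minB jE
  ioC jcact domK eB Be e_free genK.
have combE := combinations_kcombinations ioC jcact domK e.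
exists K, (absv_of sigma), sigma, (completion_structure ioC domK), d, e; split.
  split.
  - exact: absv_of_archimedean.
  - exact: absv_of_induces.
  - exact: completion_structure_extends.
  - exact: (kbasis_is_basis simpleA spanX X_inf apX covXB minB jE jcact eB Be e_free).
  - by rewrite combE.
move=> n phi [psi phiK psiK].
(* In the complex case the isomorphism would carry [io] to a central matrix with square -1. *)
have sigma_real k : complex.Im (sigma k) = 0.
  have [io2|//] := domK.
  have /matrix_central_sqr/eqP[] : forall M, phi io * M = M * phi io.
    by move=> M; rewrite -[M]psiK -!rmorphM ioC.
  by rewrite -rmorphM io2 rmorphN1.
split; last by rewrite -(OKv_PK sigma_real) combE.
  apply/seteqP; split; first exact: completion_set_real.
  by move=> _ [r _ <-]; exact/set_mem/completion_real_subproof.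
exact: OKv_PK.
Qed.
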